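(* Let $\gamma>1$ and $T>0$. Let $(\rho,u)$ be an admissible weak solution and $(R,U)$ a $C^1$ solution of the isentropic compressible Euler equations with exponent $\gamma$ on $\mathbb{R}^d\times(0,T)$, and assume that the initial data of both solutions agree outside of a ball $B_\eta(0)$. Suppose further there exist numbers $0\leq\underline{r}<\overline{r}<\infty$ (if $\gamma<2$ assume $\underline{r}>0$) and $v>0$ such that $$\underline{r}\leq\rho,R\leq\overline{r}\quad\text{and}\quad|u|,|U|\leq v\quad\text{almost everywhere in }\mathbb{R}^d\times(0,T).$$ Let $C$ be a constant, depending only on $\underline{r},\overline{r},v,\gamma$, such that $|B(R',U';\rho',u')|\le C\,A(R',U';\rho',u')$ whenever $R',\rho'\in[\underline{r},\overline{r}]$ and $|U'|,|u'|\le v$ (with $A$, $B$ as defined in the context). Then $(\rho,u)=(R,U)$ on the complement of the ball $B_{\eta+Ct}(0)$ for almost every $t\in(0,T)$.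
   Context: For $R,\rho\ge0$ and $U,u\in\mathbb{R}^d$, $$A(R,U;\rho,u)=\frac12\rho|u-U|^2+R^\gamma-\frac{\gamma}{\gamma-1}\rho R^{\gamma-1}+\frac{1}{\gamma-1}\rho^\gamma,$$ $$B(R,U;\rho,u)=\frac12\rho|u-U|^2u-\frac{\gamma}{\gamma-1}(R^{\gamma-1}-\rho^{\gamma-1})\rho u+(R^\gamma-\rho^\gamma)U.$$ (Under the stated conditions on $\underline r,\overline r,v,\gamma$ the paper shows that such a constant $C$ exists.) Equality of the measurable functions $(\rho,u)(\cdot,t)$ and $(R,U)(\cdot,t)$ on a set is understood almost everywhere. The isentropic compressible Euler equations with adiabatic exponent $\gamma>1$ are $$\partial_t(\rho u)+\operatorname{div}(\rho u\otimes u)+\nabla\rho^\gamma=0,\qquad \partial_t\rho+\operatorname{div}(\rho u)=0,$$ with density $\rho\ge0$ and velocity $u$ ($\mathbb{R}^d$-valued). $C^1$ solution: a pair $(R,U)$, $C^1$ on $\mathbb{R}^d\times[0,T]$, satisfying the equations pointwise; its initial data is $(R(0),U(0))$. Admissible weak solution with initial datum $(\rho^0,u^0)$ (where $\rho^0\ge0$, $\rho^0\in L^\gamma_{loc}(\mathbb{R}^d)$, $\rho^0|u^0|^2\in L^1_{loc}(\mathbb{R}^d)$): with $\Omega=\mathbb{R}^d$, a pair $(\rho,u)$ with $\rho\in L^\gamma_{loc}(\Omega\times[0,T])$, $\rho|u|^2\in L^1_{loc}(\Omega\times[0,T])$ such that for almost every $\tau\in(0,T)$, every $\psi\in C_c^1(\Omega\times[0,T])$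 and every $\zeta\in C_c^1(\Omega\times[0,T];\mathbb{R}^d)$ (test functions need not vanish at $t=0$ or $t=T$), $$\int_0^\tau\!\!\int_{\Omega}\partial_t\psi\,\rho+\nabla\psi\cdot\rho u\,dx\,dt+\int_{\Omega}\psi(x,0)\rho^0-\psi(x,\tau)\rho(x,\tau)\,dx=0,$$ $$\int_0^\tau\!\!\int_{\Omega}\partial_t\zeta\cdot\rho u+\nabla\zeta:(\rho u\otimes u)+\rho^\gamma\operatorname{div}\zeta\,dx\,dt+\int_{\Omega}\zeta(x,0)\cdot\rho^0u^0-\zeta(x,\tau)\cdot\rho u(x,\tau)\,dx=0,$$ and such that the local energy inequality holds: for almost every $\tau\in(0,T)$ and every nonnegative $\chi\in C_c^1(\Omega\times[0,T])$, $$\begin{aligned}\int_\Omega\frac12\chi(\tau)\rho(\tau)|u(\tau)|^2+\frac{1}{\gamma-1}\chi(\tau)\rho(\tau)^\gamma dx\le&\int_\Omega\frac12\chi(0)\rho^0|u^0|^2+\frac{1}{\gamma-1}\chi(0)(\rho^0)^\gamma dx\\&+\int_0^\tau\!\!\int_\Omega\partial_t\chi\left(\frac{\rho|u|^2}{2}+\frac{\rho^\gamma}{\gamma-1}\right)+\left(\frac{\rho|u|^2}{2}+\frac{\gamma}{\gamma-1}\rho^\gamma\right)\nabla\chi\cdot u\,dx\,dt,\end{aligned}$$ where it is part of the definition that all these integrals are well-defined.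
   Formalization: Equality of (ρ,u) and (R,U), for the initial data and in the conclusion, is taken as ρ=R and u=U wherever ρ≠0, since the velocity is undetermined in vacuum: ρ=R=0, u=0, U=f(t)e₁ with f(0)=0 refutes literal equality when γ≥2 and the lower density bound is 0. *)

(* Defs.v *)
From HB Require Import structures.
From mathcomp Require Import all_boot all_order all_algebra.
From mathcomp Require Import all_classical all_reals all_analysis.

Set Implicit Arguments.
Unset Strict Implicit.
Unset Printing Implicit Defensive.

Import Order.TTheory GRing.Theory Num.Theory.
Import numFieldNormedType.Exports.

Local Open Scope classical_set_scope.
Local Open Scope ring_scope.

(* Product sigma-algebra on row vectors, generated by the coordinates; for
   T = R this is the Borel sigma-algebra of R^n. *)
Section measurable_rV.
Context {d : measure_display} {T : measurableType d} (n : nat).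

Let coord : 'I_n -> 'rV[T]_n -> T := fun i x => x 0 i.

Let rV_set0 : g_sigma_preimage coord set0.
Proof. exact: sigma_algebra0. Qed.

Let rV_setC A : g_sigma_preimage coord A -> g_sigma_preimage coord (~` A).
Proof. exact: sigma_algebraC. Qed.

Let rV_bigcup (F : (set 'rV[T]_n)^nat) :
  (forall i, g_sigma_preimage coord (F i)) ->
  g_sigma_preimage coord (\bigcup_i (F i)).
Proof. exact: sigma_algebra_bigcup. Qed.

HB.instance Definition _ := @isMeasurable.Build (measure_tuple_display d)
  'rV[T]_n (g_sigma_preimage coord) rV_set0 rV_setC rV_bigcup.

Lemma measurable_coord (i : 'I_n) :
  measurable_fun [set: 'rV[T]_n] (fun x : 'rV[T]_n => x 0 i).
Proof.
move=> _ Y mY; rewrite setTI; apply: sub_sigma_algebra => /=.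
rewrite -bigcup_seq/=; exists i => /=; first by rewrite mem_index_enum.
by exists Y => //; rewrite setTI.
Qed.

Lemma measurable_fun_coord d1 (T1 : measurableType d1) (f : T1 -> 'rV[T]_n) :
  (forall i, measurable_fun [set: T1] (fun x => f x 0 i)) ->
  measurable_fun [set: T1] f.
Proof.
move=> mf _ A mA.
have : g_sigma_preimage (fun i => coord i \o f) (f @^-1` A).
  by rewrite g_sigma_preimage_comp; exists A => //; rewrite setTI.
rewrite setTI; apply: smallest_sub; first exact: sigma_algebra_measurable.
rewrite -bigcup_seq/=; apply: bigcup_sub => i _ B [C mC <-].
exact: mf.
Qed.

End measurable_rV.

Section lebesgue_rV.
Context {R : realType}.

Definition rV_rcons (n : nat) (p : 'rV[R]_n * R) : 'rV[R]_n.+1 :=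
  \row_i (if unlift ord_max i is Some j then p.1 0 j else p.2).

Lemma measurable_rV_rcons n : measurable_fun setT (@rV_rcons n).
Proof.
apply: measurable_fun_coord => i.
under eq_fun do rewrite mxE.
case: (unlift ord_max i) => [j|]; last exact: measurable_snd.
exact: (measurableT_comp (measurable_coord j) measurable_fst).
Qed.

Section step.
Context (n : nat) (mu : {measure set 'rV[R]_n -> \bar R}).

Definition rV_rcons_measure : set 'rV[R]_n.+1 -> \bar R :=
  pushforward (mu \x @lebesgue_measure R)%E (@rV_rcons n).

HB.instance Definition _ := Measure.copy rV_rcons_measure
  (measure_function_pushforward__canonical__measure_function_Measure
    (mu \x @lebesgue_measure R)%E (@measurable_rV_rcons n)).

End step.

(* Iterated product of the Lebesgue measure of R; lebesgue_rV_box characterizes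
   it. *)
Fixpoint lebesgue_rV (n : nat) : {measure set 'rV[R]_n -> \bar R} :=
  match n with
  | 0 => dirac (0 : 'rV[R]_0)
  | m.+1 => rV_rcons_measure (lebesgue_rV m)
  end.

Lemma lebesgue_rV_box n (A : 'I_n -> set R) :
  (forall i, measurable (A i)) ->
  lebesgue_rV n [set x | forall i, A i (x 0 i)] =
  (\prod_(i < n) lebesgue_measure (A i))%E.
Proof.
elim: n A => [|n IHn] A mA.
  by rewrite /= diracE big_ord0 mem_set// => -[].
pose B := [set x : 'rV[R]_n | forall i, A (lift ord_max i) (x 0 i)].
have preE : @rV_rcons n @^-1` [set x | forall i, A i (x 0 i)] =
    B `*` A ord_max.
  apply/seteqP; split => -[x t] /=.
    move=> h; split => [i|]; last by have := h ord_max; rewrite mxE unlift_none.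
    by have := h (lift ord_max i); rewrite mxE liftK.
  by move=> [Bx At] i; rewrite mxE; case: unliftP => [j|] ->.
have mB : measurable B.
  have -> : B = \bigcap_(i in [set: 'I_n])
      ((fun x : 'rV[R]_n => x 0 i) @^-1` A (lift ord_max i)).
    by apply/seteqP; split => x /= Bx i; [move=> _; exact: Bx|exact: Bx].
  apply: fin_bigcap_measurable; first exact: finite_finset.
  move=> i _; rewrite -[X in measurable X]setTI.
  exact: measurable_coord.
rewrite /= /rV_rcons_measure /pushforward preE product_measure1E//; last first.
  exact: mA.
rewrite (IHn (fun i => A (lift ord_max i)))// big_ord_recr/=.
congr (_ * _)%E; apply: eq_bigr => i _; congr (lebesgue_measure (A _)).
by apply: val_inj; rewrite /= /bump leqNgt ltn_ord.
Qed.

End lebesgue_rV.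

Section euclidean.
Context {R : realType} {d : nat}.

Definition dotv (u w : 'rV[R]_d) : R := \sum_i u 0 i * w 0 i.

(* The norm `|u| of 'rV[R]_d in the library is the sup norm. *)
Definition enorm (u : 'rV[R]_d) : R := Num.sqrt (dotv u u).

Definition eball (r : R) : set 'rV[R]_d := [set x | enorm x < r].

End euclidean.

(* A point of R^d x [0, T] is a pair (x, t) : 'rV[R]_d * R. Functions are total;
   their values outside R^d x [0, T] are irrelevant. *)
Section spacetime.
Context {R : realType} {d : nat}.
Local Notation X := ('rV[R]_d * R)%type.

Definition strip (T : R) : set X := [set z | 0 <= z.2 <= T].

Definition open_strip (T : R) : set X := [set z | 0 < z.2 < T].

(* measurableTypeR R is R with the sigma-algebra that carries lebesgue_measure;
   it is convertible to the one found by inference on R. *)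
Local Notation mX := ('rV[R]_d * measurableTypeR R)%type.

Definition lebesgue_spacetime : {measure set mX -> \bar R} :=
  (lebesgue_rV d \x @lebesgue_measure R)%E.

Definition dt {W : normedModType R} (f : X -> W) (z : X) : W :=
  'D_((0, 1) : X) f z.

Definition dx {W : normedModType R} (i : 'I_d) (f : X -> W) (z : X) : W :=
  'D_((delta_mx 0 i, 0) : X) f z.

Definition grad (f : X -> R) (z : X) : 'rV[R]_d := \row_i dx i f z.

Definition divx (f : X -> 'rV[R]_d) (z : X) : R := \sum_i (dx i f z) 0 i.

(* C^1 up to the boundary: the derivatives, taken at interior times, extend
   continuously to the closed strip. *)
Definition C1_strip {W : normedModType R} (T : R) (f : X -> W) : Prop :=
  [/\ {within strip T, continuous f},
      forall z, open_strip T z -> differentiable f z &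
      forall w : X, exists2 g : X -> W,
        {within strip T, continuous g} &
        forall z, open_strip T z -> 'D_w f z = g z].

Definition C1c_strip {W : normedModType R} (T : R) (f : X -> W) : Prop :=
  C1_strip T f /\
  exists2 K : set X, compact K & forall z, strip T z -> ~ K z -> f z = 0.

Definition L1loc_space (f : 'rV[R]_d -> R) : Prop :=
  measurable_fun setT f /\
  forall K : set 'rV[R]_d, compact K ->
    (lebesgue_rV d).-integrable K (EFin \o f).

Definition L1loc_strip (T : R) (f : X -> R) : Prop :=
  measurable_fun (strip T : set mX) f /\
  forall K : set X, compact K -> K `<=` strip T ->
    lebesgue_spacetime.-integrable K (EFin \o f).

Definition Lploc_space (p : R) (f : 'rV[R]_d -> R) : Prop :=
  measurable_fun setT f /\ L1loc_space (fun x => `|f x| `^ p).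

Definition Lploc_strip (T p : R) (f : X -> R) : Prop :=
  measurable_fun (strip T : set mX) f /\ L1loc_strip T (fun z => `|f z| `^ p).

End spacetime.

Section euler.
Context {R : realType} {d : nat}.
Local Notation V := ('rV[R]_d).
Local Notation X := (V * R)%type.

Definition energy (gamma rho : R) (u : V) : R :=
  2^-1 * rho * dotv u u + (gamma - 1)^-1 * rho `^ gamma.

Definition mass_integrand (psi rho : X -> R) (u : X -> V) (z : X) : R :=
  dt psi z * rho z + dotv (grad psi z) (rho z *: u z).

Definition mass_boundary (tau : R) (psi rho : X -> R) (rho0 : V -> R)
    (x : V) : R :=
  psi (x, 0) * rho0 x - psi (x, tau) * rho (x, tau).

Definition momentum_integrand (gamma : R) (zeta : X -> V) (rho : X -> R)
    (u : X -> V) (z : X) : R :=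
  dotv (dt zeta z) (rho z *: u z) +
  (\sum_i \sum_j (dx j zeta z) 0 i * (rho z * u z 0 i * u z 0 j)) +
  rho z `^ gamma * divx zeta z.

Definition momentum_boundary (tau : R) (zeta : X -> V) (rho : X -> R)
    (u : X -> V) (rho0 : V -> R) (u0 : V -> V) (x : V) : R :=
  dotv (zeta (x, 0)) (rho0 x *: u0 x) -
  dotv (zeta (x, tau)) (rho (x, tau) *: u (x, tau)).

Definition energy_integrand (gamma : R) (chi rho : X -> R) (u : X -> V)
    (z : X) : R :=
  dt chi z * energy gamma (rho z) (u z) +
  (2^-1 * rho z * dotv (u z) (u z) + gamma / (gamma - 1) * rho z `^ gamma) *
    dotv (grad chi z) (u z).

Definition energy_slice (gamma : R) (chi rho : V -> R) (u : V -> V)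
    (x : V) : R :=
  chi x * energy gamma (rho x) (u x).

Definition weak_mass (tau : R) (psi rho : X -> R) (u : X -> V)
    (rho0 : V -> R) : Prop :=
  [/\ lebesgue_spacetime.-integrable (open_strip tau)
        (EFin \o mass_integrand psi rho u),
      (lebesgue_rV d).-integrable setT
        (EFin \o mass_boundary tau psi rho rho0) &
      \int[lebesgue_spacetime]_(z in open_strip tau)
          mass_integrand psi rho u z +
        \int[lebesgue_rV d]_x mass_boundary tau psi rho rho0 x = 0].

Definition weak_momentum (gamma tau : R) (zeta : X -> V) (rho : X -> R)
    (u : X -> V) (rho0 : V -> R) (u0 : V -> V) : Prop :=
  [/\ lebesgue_spacetime.-integrable (open_strip tau)
        (EFin \o momentum_integrand gamma zeta rho u),
      (lebesgue_rV d).-integrable setT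
        (EFin \o momentum_boundary tau zeta rho u rho0 u0) &
      \int[lebesgue_spacetime]_(z in open_strip tau)
          momentum_integrand gamma zeta rho u z +
        \int[lebesgue_rV d]_x momentum_boundary tau zeta rho u rho0 u0 x = 0].

Definition local_energy_ineq (gamma tau : R) (chi rho : X -> R) (u : X -> V)
    (rho0 : V -> R) (u0 : V -> V) : Prop :=
  let E0 := energy_slice gamma (fun x => chi (x, 0)) rho0 u0 in
  let Etau := energy_slice gamma (fun x => chi (x, tau))
    (fun x => rho (x, tau)) (fun x => u (x, tau)) in
  let Q := energy_integrand gamma chi rho u in
  [/\ (lebesgue_rV d).-integrable setT (EFin \o Etau),
      (lebesgue_rV d).-integrable setT (EFin \o E0),
      lebesgue_spacetime.-integrable (open_strip tau) (EFin \o Q) &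
      \int[lebesgue_rV d]_x Etau x <=
        \int[lebesgue_rV d]_x E0 x +
        \int[lebesgue_spacetime]_(z in open_strip tau) Q z].

Record admissible_initial_datum (gamma : R) (rho0 : V -> R) (u0 : V -> V) :
    Prop := {
  initial_density_ge0 : {ae lebesgue_rV d, forall x, 0 <= rho0 x};
  initial_density_Lp : Lploc_space gamma rho0;
  initial_velocity_measurable : measurable_fun setT u0;
  initial_kinetic_L1 : L1loc_space (fun x => rho0 x * dotv (u0 x) (u0 x))
}.

Record admissible_weak_solution (gamma T : R) (rho0 : V -> R) (u0 : V -> V)
    (rho : X -> R) (u : X -> V) : Prop := {
  weak_initial_datum : admissible_initial_datum gamma rho0 u0;
  weak_density_ge0 :
    {ae lebesgue_spacetime, forall z, open_strip T z -> 0 <= rho z};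
  weak_density_Lp : Lploc_strip T gamma rho;
  weak_velocity_measurable :
    measurable_fun (strip T : set (V * measurableTypeR R)) u;
  weak_kinetic_L1 : L1loc_strip T (fun z => rho z * dotv (u z) (u z));
  weak_equations : {ae @lebesgue_measure R, forall tau, 0 < tau < T ->
    (forall psi : X -> R, C1c_strip T psi -> weak_mass tau psi rho u rho0) /\
    (forall zeta : X -> V, C1c_strip T zeta ->
      weak_momentum gamma tau zeta rho u rho0 u0)};
  weak_energy : {ae @lebesgue_measure R, forall tau, 0 < tau < T ->
    forall chi : X -> R, C1c_strip T chi ->
      (forall z, strip T z -> 0 <= chi z) ->
      local_energy_ineq gamma tau chi rho u rho0 u0}
}.

Record C1_solution (gamma T : R) (r : X -> R) (U : X -> V) : Prop := {
  strong_density_C1 : C1_strip T r;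
  strong_velocity_C1 : C1_strip T U;
  strong_density_ge0 : forall z, strip T z -> 0 <= r z;
  strong_momentum : forall z, open_strip T z ->
    dt (fun y => r y *: U y) z +
    \sum_j dx j (fun y => (r y * U y 0 j) *: U y) z +
    grad (fun y => r y `^ gamma) z = 0;
  strong_mass : forall z, open_strip T z ->
    dt r z + divx (fun y => r y *: U y) z = 0
}.

Definition relative_energy (gamma r : R) (U : V) (rho : R) (u : V) : R :=
  2^-1 * rho * enorm (u - U) ^+ 2 + r `^ gamma -
  gamma / (gamma - 1) * rho * r `^ (gamma - 1) +
  (gamma - 1)^-1 * rho `^ gamma.

Definition relative_flux (gamma r : R) (U : V) (rho : R) (u : V) : V :=
  (2^-1 * rho * enorm (u - U) ^+ 2) *: u -
  (gamma / (gamma - 1) * (r `^ (gamma - 1) - rho `^ (gamma - 1)) * rho) *: u +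
  (r `^ gamma - rho `^ gamma) *: U.

(* Equality of states (density, velocity). A velocity carries no information
   where the density vanishes: weak solutions are invariant under changes of u
   on the vacuum set, and (0, U) is a C^1 solution for every C^1 field U. *)
Definition same_state (rho1 : R) (u1 : V) (rho2 : R) (u2 : V) : Prop :=
  rho1 = rho2 /\ (rho1 != 0 -> u1 = u2).

End euler.

(* Main.v *)
Require Import Defs.
From HB Require Import structures.
From mathcomp Require Import all_boot all_order all_algebra.
From mathcomp Require Import all_classical all_reals all_analysis.
From mathcomp Require Import measurable_realfun ring lra.

Set Implicit Arguments.
Unset Strict Implicit.
Unset Printing Implicit Defensive.

Import Order.TTheory GRing.Theory Num.Theory.
Import numFieldNormedType.Exports.

Local Open Scope classical_set_scope.
Local Open Scope ring_scope.

(** Finite speed of propagation follows from the relative energy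
    A = A(r, U; rho, u), which vanishes exactly where the two states agree. Test
    the energy inequality with a cutoff phi, the momentum equation with phi U
    and the mass equation with phi (|U|^2 / 2 - Q), where Q is the enthalpy
    g / (g - 1) r^(g - 1): the integral of phi A at time t is bounded by its
    initial value plus the space-time integral of
    dt phi A + grad phi . B + phi D, where D collects the terms with derivatives
    of U ([relative_energy_ineq]). The cutoff is supported in the complement of
    the ball of radius eta + C t, inside a large shrinking ball, and decreases so
    fast that dt phi A + grad phi . B <= - K phi A as soon as |B| <= C A
    ([cutoff_transport]). If D <= K A, the integral of phi A cannot become
    positive, and phi A = 0.

    Where r > 0 the momentum equation can be divided by r; then U has
    acceleration - grad Q and D <= K A with a constant given by the gradient of
    U. The vacuum r = 0, which may occur when g >= 2, is the difficulty: there
    the momentum equation is void, the acceleration of U is arbitrary, and D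
    contains a term of order rho that A, of order rho^g, does not control.

    The remedy is to compare with another velocity field. The inequality only
    uses that the comparison field W satisfies the mass equation together with
    r; as the gradient of a nonnegative C^1 function vanishes with the function,
    every field W that is equal to U in the fluid r > 0 will do
    ([comparison_transport]). In the vacuum one wants W to have almost no
    acceleration, that is, almost to solve the Burgers equation with the data of
    U at the final time t. The Picard iterates W_0 = U,
    W_(n+1) (x, q) = U (x - (q - t) W_n (x, q), t) converge to such a solution:
    on a short time interval their acceleration is O((3/4)^n)
    ([iterate_residual]). They differ from U in the fluid, but little near its
    edge: along the particle paths of the fluid the acceleration is - grad Q,
    which is at most e + K r for each e > 0, and a maximum principle turns this
    into |W_n - U| <= e + K r ([characteristic_defect], [iterate_fluid]). A
    threshold on |W_n - U|^2 - M r therefore glues U in the fluid to W_n in the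
    vacuum ([blend]). The gluing costs acceleration only where U and W_n are
    close but distinct; where they coincide their first derivatives agree almost
    everywhere ([null_critical]). The remaining error tends to 0 with the
    threshold, by dominated convergence ([gate_integral_small]), so that the
    total error in the vacuum is as small as desired ([comparison_fields]).

    Since the Picard iteration needs a short time interval, the theorem is
    proved by finitely many time steps: before the last step the states already
    agree in the cone, where the integrand is nonpositive for any comparison
    field equal to U in the fluid ([cone_step]). *)

(** * Lebesgue measure on space-time *)

Lemma norm_coord (R : realType) n (x : 'rV[R]_n) i : `|x 0 i| <= `|x|.
Proof.
rewrite [leRHS]/Num.norm/= mx_normrE.
exact: (le_bigmax _ (fun ij => `|x ij.1 ij.2|) (0, i)).
Qed.

Lemma normv_le (R : realType) n (x : 'rV[R]_n) c : 0 <= c ->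
  (forall i, `|x 0 i| <= c) -> `|x| <= c.
Proof.
move=> c0 xc; rewrite [leLHS]/Num.norm/= mx_normrE.
by apply/bigmax_leP; split => // -[i j] _ /=; rewrite ord1.
Qed.

Section lebesgue_rV_theory.
Context {R : realType}.
Implicit Types n : nat.

(** An alias of [lebesgue_rV n] that carries the sigma-finite structure needed
    by the theorems of Fubini and Tonelli. *)
Definition lam n : set 'rV[R]_n -> \bar R := lebesgue_rV n.

HB.instance Definition _ n := Measure.copy (@lam n) (lebesgue_rV n).

Lemma measurable_box n (A : 'I_n -> set R) : (forall i, measurable (A i)) ->
  measurable [set x : 'rV[R]_n | forall i, A i (x 0 i)].
Proof.
move=> mA; have -> : [set x : 'rV[R]_n | forall i, A i (x 0 i)] =
    \bigcap_(i in [set: 'I_n]) ((fun x : 'rV[R]_n => x 0 i) @^-1` A i).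
  by apply/seteqP; split => x /= Bx i; [move=> _; exact: Bx|exact: Bx].
apply: fin_bigcap_measurable; first exact: finite_finset.
move=> i _; rewrite -[X in measurable X]setTI.
exact: measurable_coord.
Qed.

Definition cube n (c : R) : set 'rV[R]_n :=
  [set x | forall i, `[- c, c]%classic (x 0 i)].

Lemma measurable_cube n c : measurable (@cube n c).
Proof. exact: (@measurable_box n (fun=> `[- c, c]%classic)). Qed.

Lemma lam_cube_fin n c : (lam (@cube n c) < +oo)%E.
Proof.
rewrite /lam (@lebesgue_rV_box _ _ (fun=> `[- c, c]%classic))//.
elim: n => [|n IH]; first by rewrite big_ord0 ltry.
rewrite big_ord_recr/= lte_mul_pinfty//.
- exact: prode_ge0.
- by rewrite fin_numElt IH andbT (lt_le_trans _ (prode_ge0 _ _)).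
- by rewrite lebesgue_measure_itv/=; case: ifP => _; rewrite ?ltry// -EFinD ltry.
Qed.

Lemma lam_sigma_finite n : sigma_finite setT (@lam n).
Proof.
exists (fun k => @cube n k%:R).
  apply/esym; rewrite -subTset => x _.
  exists (Num.truncn `|x|).+1 => // i /=.
  rewrite in_itv/= -ler_norml (le_trans _ (ltW (truncnS_gt _)))//.
  exact: norm_coord.
by move=> k; split; [exact: measurable_cube|exact: lam_cube_fin].
Qed.

HB.instance Definition _ n := Measure_isSigmaFinite.Build _ _ _ (@lam n)
  (@lam_sigma_finite n).

End lebesgue_rV_theory.

Lemma lebesgue_measure_shift (R : realType) (a : R) (A : set R) :
  measurable A ->
  lebesgue_measure ((fun t => t + a) @^-1` A) = lebesgue_measure A.
Proof.
move=> mA.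
pose f : measurableTypeR R -> measurableTypeR R := fun t => t + a.
have mf : measurable_fun setT f.
  by apply: continuous_measurable_fun => x; apply: cvgD; [exact: cvg_id|exact: cvg_cst].
pose mu : {measure set (measurableTypeR R) -> \bar R} :=
  measure_function_pushforward__canonical__measure_function_Measure
    (@lebesgue_measure R) mf.
rewrite -[LHS]/(mu A); apply/esym.
apply: (@lebesgue_measure_unique _ mu) => // X [[x y] /= _ <-].
rewrite /mu /pushforward/=.
rewrite (_ : f @^-1` _ = `]x - a, y - a]%classic).
  by rewrite !lebesgue_measure_itv/= !lte_fin ltrBDr subrK; congr (if _ then _ else _);
   rewrite -!EFinB; congr (_%:E); ring.
by apply/seteqP; split => t /=; rewrite !in_itv/= ltrBlDr lerBrDr.
Qed.

Section spacetime_measurability.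
Context {R : realType} {d : nat}.
Local Notation X := ('rV[R]_d * R)%type.
Local Notation mX := ('rV[R]_d * measurableTypeR R)%type.

Definition rbox (q : 'rV[rat]_d * rat) (e : R) : set X :=
  [set z : X | forall i, `]ratr (q.1 0 i) - e, ratr (q.1 0 i) + e[%classic (z.1 0 i)]
  `&` [set z : X | `]ratr q.2 - e, ratr q.2 + e[%classic z.2].

Lemma measurable_rbox q e : measurable (rbox q e : set mX).
Proof.
have -> : rbox q e = [set x : 'rV[R]_d | forall i,
    `]ratr (q.1 0 i) - e, ratr (q.1 0 i) + e[%classic (x 0 i)] `*`
    `]ratr q.2 - e, ratr q.2 + e[%classic by [].
apply: measurableX.
  exact: (@measurable_box _ _ (fun i => `]ratr (q.1 0 i) - e, ratr (q.1 0 i) + e[%classic)).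
exact: measurable_itv.
Qed.

Lemma rat_near (x e : R) : 0 < e -> exists q : rat, `|x - ratr q| < e.
Proof.
move=> e0; have /rat_in_itvoo[q] : x < x + e by rewrite ltrDl.
rewrite in_itv/= => /andP[xq qx]; exists q.
by rewrite distrC gtr0_norm ?subr_gt0// ltrBlDl.
Qed.

Lemma open_rbox (O : set X) z : open O -> O z ->
  exists q n, rbox q (n.+1%:R^-1) z /\ rbox q (n.+1%:R^-1) `<=` O.
Proof.
rewrite openE => /(_ z) /[apply] /nbhs_ballP[e /= e0 eO].
have e20 : 0 < e / 4 by rewrite divr_gt0.
pose n := Num.truncn (e / 4)^-1.
have ne : n.+1%:R^-1 < e / 4.
  rewrite -[ltRHS]invrK ltf_pV2 ?posrE ?invr_gt0//.
  exact: truncnS_gt.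
have n0 : 0 < n.+1%:R^-1 :> R by rewrite invr_gt0.
have /choice[q1 q1P] : forall i, exists q : rat, `|z.1 0 i - ratr q| < n.+1%:R^-1.
  by move=> i; exact: rat_near.
have [q2 q2P] := rat_near z.2 n0.
exists (\row_i q1 i, q2), n; split.
  split=> [i|] /=; rewrite in_itv/= ?mxE.
    by rewrite -ltr_distl q1P.
  by rewrite -ltr_distl q2P.
move=> w [/= w1 w2]; apply: eO; split; rewrite -ball_normE/=.
  apply: (@le_lt_trans _ _ (e / 2)); last by rewrite ltr_pdivrMr// ltr_pMr// ltr1n.
  apply: normv_le => [|i]; first by rewrite divr_ge0// ltW.
  have := w1 i; rewrite in_itv/= -ltr_distl !mxE => wi.
  have := q1P i; rewrite !ltr_norml in wi *; rewrite ler_norml.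
  by move: wi ne; set t := ratr _; set s := _^-1; move=> /andP[? ?] ? /andP[? ?]; lra.
move: w2 q2P; rewrite in_itv/= -ltr_distl !ltr_norml.
by move: ne; set t := ratr _; set s := _^-1; move=> ? /andP[? ?] /andP[? ?]; lra.
Qed.

(** The Borel sets of space-time are generated by countably many rational boxes,
    so topological openness entails measurability for the product sigma-algebra.
    *)
Lemma open_measurable_st (O : set X) : open O -> measurable (O : set mX).
Proof.
move=> oO.
pose F k : set mX := if unpickle k is Some (q, n) then
  (if `[< rbox q (n.+1%:R^-1) `<=` O >] then rbox q (n.+1%:R^-1) else set0) else set0.
have -> : O = \bigcup_k F k.
  apply/seteqP; split => [z Oz|z [k _]].
    have [q [n [qz qO]]] := open_rbox oO Oz.
    exists (pickle (q, n)); first exact: I.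
    rewrite /F pickleK.
    by case: asboolP.
  rewrite /F; case: unpickle => // -[q n]; case: asboolP => // qO; exact: qO.
apply: bigcupT_measurable => k; rewrite /F; case: unpickle => // -[q n].
by case: asboolP => // _; exact: measurable_rbox.
Qed.

Lemma closed_measurable_st (O : set X) : closed O -> measurable (O : set mX).
Proof.
by move=> cO; rewrite -(setCK O); apply: measurableC; apply: open_measurable_st; rewrite openC.
Qed.

Lemma continuous_measurable_st (f : X -> R) : continuous f ->
  measurable_fun setT (f : mX -> R).
Proof.
move=> /continuousP cf; apply: (measurability _ (RGenOpens.measurableE R)).
move=> _ [_ [a [b ->] <-]]; rewrite setTI; apply: open_measurable_st.
exact/cf/interval_open.
Qed.

Lemma lam_open_gt0 (q : 'rV[rat]_d * rat) (e : R) : 0 < e ->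
  (0 < lebesgue_spacetime (rbox q e : set mX))%E.
Proof.
move=> e0.
have -> : rbox q e = [set x : 'rV[R]_d | forall i,
    `]ratr (q.1 0 i) - e, ratr (q.1 0 i) + e[%classic (x 0 i)] `*`
    `]ratr q.2 - e, ratr q.2 + e[%classic by [].
have pos (x : R) : (0 < lebesgue_measure `](x - e)%R, (x + e)%R[%classic)%E.
  rewrite lebesgue_measure_itv/= lte_fin ifT; last lra.
  rewrite -EFinD lte_fin; lra.
have -> : forall (A : set 'rV[R]_d) (B : set (measurableTypeR R)),
    measurable A -> measurable B -> lebesgue_spacetime (A `*` B : set mX) =
    (lebesgue_rV d A * lebesgue_measure B)%E.
- by move=> A B mA mB; exact: product_measure1E.
- rewrite mule_gt0//.
  rewrite (@lebesgue_rV_box _ _ (fun i => `]ratr (q.1 0 i) - e, ratr (q.1 0 i) + e[%classic))//.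
  by elim/big_ind : _ => // x y; exact: mule_gt0.
- exact: (@measurable_box _ _ (fun i => `]ratr (q.1 0 i) - e, ratr (q.1 0 i) + e[%classic)).
- exact: measurable_itv.
Qed.

(** Nonempty open sets have positive measure, so an almost everywhere property
    can be tested at some point of each of them; continuity then upgrades it to
    an everywhere property. *)
Lemma ae_open (P : X -> Prop) (O : set X) : open O -> O !=set0 ->
  {ae lebesgue_spacetime, forall z : X, O z -> P z} -> exists2 z, O z & P z.
Proof.
move=> oO [z Oz] [N [mN N0 sN]]; apply: contrapT => nP.
have [q [n [qz qO]]] := open_rbox oO Oz.
have : (lebesgue_spacetime (rbox q n.+1%:R^-1 : set mX) <= lebesgue_spacetime N)%E.
  apply: le_measure; rewrite ?inE//; first exact: measurable_rbox.
  move=> w qw; apply: sN => /= /(_ (qO _ qw)) Pw; apply: nP; exists w => //.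
  exact: qO.
by rewrite N0 leNgt lam_open_gt0.
Qed.

(** Tonelli: a null set of space-time has null slices at almost every time. *)
Lemma ae_slices (P : X -> Prop) :
  {ae lebesgue_spacetime, forall z : X, P z} ->
  {ae @lebesgue_measure R, forall t : R, {ae lebesgue_rV d, forall x, P (x, t)}}.
Proof.
move=> [N [mN N0 sN]].
have mG := @measurable_fun_ysection _ _ _ (measurableTypeR R) R (@lam R d) N mN.
have G0 : (\int[@lebesgue_measure R]_t `|(@lam R d \o ysection N) t| = 0)%E.
  have <- : lebesgue_spacetime N = (\int[@lebesgue_measure R]_t `|(@lam R d \o ysection N) t|)%E.
    have -> : lebesgue_spacetime N =
      (\int[(@lam R d \x @lebesgue_measure R)%E]_z (\1_N z)%:E)%E.
      by rewrite integral_indic// setIT.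
    rewrite fubini_tonelli2//; last by apply/measurable_EFinP.
    rewrite -/(fubini_G _ _) indic_fubini_tonelli_GE//.
    by apply: eq_integral => t _; rewrite gee0_abs//.
  exact: N0.
have [+ _] := ae_eq_integral_abs (@lebesgue_measure R) measurableT mG.
move=> /(_ G0); apply: filterS => t /(_ Logic.I)/= Nt0.
exists (ysection N t); split => //; first exact: measurable_ysection.
move=> x/= nP; rewrite /ysection/= inE; apply: sN => /= Pz; exact: nP.
Qed.

End spacetime_measurability.

Section ae_lemmas.
Context {dd : measure_display} {Y : measurableType dd} {R : realType}
  (mu : {measure set Y -> \bar R}).

Lemma ae_imp (P Q : Y -> Prop) : (forall x, P x -> Q x) ->
  {ae mu, forall x, P x} -> {ae mu, forall x, Q x}.
Proof.
move=> PQ; apply: negligibleS => x /= nQ Px; exact: nQ (PQ _ Px).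
Qed.

Lemma ae_imp2 (P1 P2 Q : Y -> Prop) : (forall x, P1 x -> P2 x -> Q x) ->
  {ae mu, forall x, P1 x} -> {ae mu, forall x, P2 x} -> {ae mu, forall x, Q x}.
Proof.
move=> PQ p1 p2; apply: negligibleS (negligibleU p1 p2) => x /= nQ.
apply: contrapT => /not_orP[/contrapT h1 /contrapT h2]; exact: nQ (PQ _ h1 h2).
Qed.

Lemma ae_imp3 (P1 P2 P3 Q : Y -> Prop) : (forall x, P1 x -> P2 x -> P3 x -> Q x) ->
  {ae mu, forall x, P1 x} -> {ae mu, forall x, P2 x} -> {ae mu, forall x, P3 x} ->
  {ae mu, forall x, Q x}.
Proof.
move=> PQ p1 p2; apply: (ae_imp2 (P1 := fun x => P1 x /\ P2 x)).
  by move=> x [? ?]; exact: PQ.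
exact: (ae_imp2 _ p1 p2).
Qed.

End ae_lemmas.

(** * Translation invariance *)

Section translation.
Context {R : realType}.

Lemma measurable_shift_rV n (a : 'rV[R]_n) :
  measurable_fun setT (fun x : 'rV[R]_n => x + a).
Proof.
apply: measurable_fun_coord => i; under eq_fun do rewrite mxE.
by apply: measurable_funD => //; exact: measurable_coord.
Qed.

Lemma measurable_shift_prod n (a : 'rV[R]_n) (s : R) :
  measurable_fun setT
    ((fun z => (z.1 + a, z.2 + s)) :
      'rV[R]_n * measurableTypeR R -> 'rV[R]_n * measurableTypeR R).
Proof.
apply: measurable_fun_pair.
  exact: (measurableT_comp (@measurable_shift_rV _ a) measurable_fst).
have m2 : measurable_fun setT ((fun t => t + s) : measurableTypeR R -> measurableTypeR R).
  by apply: continuous_measurable_fun => x; apply: cvgD; [exact: cvg_id|exact: cvg_cst].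
exact: (measurableT_comp m2 measurable_snd).
Qed.

Lemma prod_shift n (a : 'rV[R]_n) (s : R) :
  (forall A : set 'rV[R]_n, measurable A ->
    lam ((fun x => x + a) @^-1` A) = lam A) ->
  forall A : set ('rV[R]_n * measurableTypeR R), measurable A ->
  (@lam R n \x @lebesgue_measure R)%E ((fun z => (z.1 + a, z.2 + s)) @^-1` A) =
  (@lam R n \x @lebesgue_measure R)%E A.
Proof.
move=> IH A mA.
pose m := measure_function_pushforward__canonical__measure_function_Measure
  (@lam R n \x @lebesgue_measure R)%E (@measurable_shift_prod n a s).
apply/esym; apply: (@product_measure_unique _ _ _ _ _ (@lam R n) (@lebesgue_measure R) m) => // B C mB mC.
rewrite /m /= /pushforward/=.
rewrite (_ : _ @^-1` _ = ((fun x => x + a) @^-1` B) `*` ((fun t => t + s) @^-1` C))//.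
rewrite product_measure1E//.
- congr (_ * _)%E; [exact: IH|exact: lebesgue_measure_shift].
- by rewrite -[X in measurable X]setTI; exact: measurable_shift_rV.
- rewrite -[X in measurable X]setTI.
  have m2 : measurable_fun setT ((fun t => t + s) : measurableTypeR R -> measurableTypeR R).
    by apply: continuous_measurable_fun => x; apply: cvgD; [exact: cvg_id|exact: cvg_cst].
  exact: m2.
Qed.

Lemma lam_shift n (a : 'rV[R]_n) (A : set 'rV[R]_n) : measurable A ->
  lam ((fun x => x + a) @^-1` A) = lam A.
Proof.
elim: n a A => [|n IHn] a A mA.
  congr (lam _); apply/seteqP; split => x; rewrite /= (thinmx0 a) addr0//.
rewrite /lam/= /rV_rcons_measure /pushforward.
have mA' : measurable (@rV_rcons R n @^-1` A).
  by rewrite -[X in measurable X]setTI; exact: measurable_rV_rcons.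
pose a' : 'rV[R]_n := \row_j a 0 (lift ord_max j).
rewrite -[RHS](@prod_shift n a' (a 0 ord_max) (IHn a') _ mA').
congr ((_ \x _)%E _); apply/seteqP; split => -[x t] /=.
  rewrite (_ : rV_rcons (x, t) + a = rV_rcons (x + a', t + a 0 ord_max))//.
  by apply/rowP => i; rewrite !mxE; case: unliftP => [j|] ->; rewrite ?mxE.
rewrite (_ : rV_rcons (x, t) + a = rV_rcons (x + a', t + a 0 ord_max))//.
by apply/rowP => i; rewrite !mxE; case: unliftP => [j|] ->; rewrite ?mxE.
Qed.

(** Translation invariance, by induction on the dimension from the
    one-dimensional case; [integral_dx] and [disjoint_translates] depend on it.
    *)
Lemma spacetime_shift d (a : 'rV[R]_d) (s : R)
    (A : set ('rV[R]_d * measurableTypeR R)) : measurable A ->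
  lebesgue_spacetime ((fun z => (z.1 + a, z.2 + s)) @^-1` A) =
  lebesgue_spacetime A.
Proof. by move=> mA; exact: (@prod_shift d a s (@lam_shift d a) A mA). Qed.

Lemma integral_spacetime_shift d (a : 'rV[R]_d) (s : R) (f : 'rV[R]_d * R -> R) :
  measurable_fun setT (f : 'rV[R]_d * measurableTypeR R -> R) ->
  (\int[lebesgue_spacetime]_z (f (z.1 + a, z.2 + s))%:E =
   \int[lebesgue_spacetime]_z (f z)%:E)%E.
Proof.
move=> mf.
pose phi : 'rV[R]_d * measurableTypeR R -> 'rV[R]_d * measurableTypeR R :=
  fun z => (z.1 + a, z.2 + s).
have mphi : measurable_fun setT phi by exact: measurable_shift_prod.
pose m := measure_function_pushforward__canonical__measure_function_Measure
  (@lebesgue_spacetime R d) mphi.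
have Em : forall g : 'rV[R]_d * measurableTypeR R -> \bar R,
   measurable_fun setT g -> (forall z, 0 <= g z)%E ->
   (\int[lebesgue_spacetime]_z (g (phi z)) = \int[lebesgue_spacetime]_z g z)%E.
  move=> g mg g0.
  have g0' : {in [set: 'rV[R]_d * measurableTypeR R], forall y, 0 <= g y}%E by move=> y _; exact: g0.
  have H := @ge0_integral_pushforward _ _ _ _ R phi mphi (@lebesgue_spacetime R d)
    setT g measurableT mg g0'.
  rewrite preimage_setT in H; rewrite -[LHS]H.
  apply: eq_measure_integral => A mA _.
  exact: spacetime_shift.
pose F : 'rV[R]_d * measurableTypeR R -> \bar R := fun z => (f z)%:E.
have mF : measurable_fun setT F by apply/measurable_EFinP.
have H1 := Em _ (measurable_funepos mF) (funepos_ge0 F).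
have H2 := Em _ (measurable_funeneg mF) (funeneg_ge0 F).
have E1 : (\int[lebesgue_spacetime]_z (F (phi z)) = \int[lebesgue_spacetime]_z F z)%E.
  etransitivity; first exact: integralE.
  etransitivity; last exact/esym/integralE.
by congr (_ - _)%E; [rewrite -H1|rewrite -H2]; apply: eq_integral => x _; rewrite ?funeposE ?funenegE.
exact: E1.
Qed.

End translation.

(** * Calculus of C^1 functions on the strip *)

Section diff_near.
Context {R : realType} {V W : normedModType R}.

(** The first-order expansion without the little-o notation, a form that can be
    checked by elementary estimates. *)
Lemma is_diff_near (f : V -> W) (L : {linear V -> W}) (z : V) :
  continuous L ->
  (forall e, 0 < e -> \forall y \near z, `|f y - f z - L (y - z)| <= e * `|y - z|) ->
  is_diff z f L.
Proof.
move=> cL H.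
have E : f \o shift z = cst (f z) + L +o_ (0 : V) id.
  apply/eqaddoP => e e0.
  have := H e e0; rewrite (near_shift 0 z) subr0 /=.
  apply: filterS => y /=.
  by rewrite addrK /= => ye; rewrite !fctE opprD addrA.
have DE := diff_unique cL E.
apply: DiffDef => //; apply/diff_locallyP; rewrite DE; split => //.
Qed.

Lemma diff_nearP (f : V -> W) (z : V) : differentiable f z ->
  forall e, 0 < e -> \forall y \near z, `|f y - f z - 'd f z (y - z)| <= e * `|y - z|.
Proof.
move=> /diff_locallyP[_ /eqaddoP H] e e0.
rewrite (near_shift 0 z) subr0 /=.
by apply: filterS (H e e0) => y /=; rewrite !fctE /= addrK opprD addrA.
Qed.

Lemma near_eq_diff (f g : V -> W) (z : V) : (\near z, f z = g z) ->
  differentiable f z -> differentiable g z.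
Proof.
move=> fg df.
have [//] : is_diff z g ('d f z).
apply: is_diff_near => [|e e0]; first exact: diff_continuous.
near=> y.
rewrite -(near fg y)// -(nbhs_singleton fg); near: y.
exact: diff_nearP.
Unshelve. all: by end_near. Qed.

End diff_near.

Section C1_strip_theory.
Context {R : realType} {d : nat} (T : R) (T_ge0 : 0 <= T).
Local Notation V := ('rV[R]_d).
Local Notation X := (V * R)%type.
Implicit Types (f g : X -> R) (z w : X).

(** The retraction of space-time onto the strip. Continuity within the strip is
    continuity of [f \o clampt T] on the whole space, which avoids subspace
    topologies. *)
Definition clampt (z : X) : X := (z.1, Num.max 0 (Num.min z.2 T)).

Lemma clampt_strip z : strip T (clampt z).
Proof. by rewrite /strip/= le_max lexx ge_max T_ge0 ge_min lexx orbT. Qed.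

Lemma clampt_id z : strip T z -> clampt z = z.
Proof.
by case: z => x t; rewrite /strip/clampt/= => /andP[t0 tT]; rewrite (min_l tT) (max_r t0).
Qed.

Lemma continuous_clampt : continuous clampt.
Proof.
move=> z.
have c1 : (y.1 @[y --> z] --> z.1) by exact: cvg_fst.
have c2 : (Num.max 0 (Num.min y.2 T) @[y --> z] --> Num.max 0 (Num.min z.2 T)).
  apply: (@continuous_max R X (cst 0) (fun z : X => Num.min z.2 T)); first exact: cvg_cst.
  apply: (@continuous_min R X (fun z : X => z.2) (cst T)); first exact: cvg_snd.
  exact: cvg_cst.
exact: (cvg_pair c1 c2).
Qed.

Lemma within_stripP (W : topologicalType) (f : X -> W) :
  {within strip T, continuous f} <-> continuous (f \o clampt).
Proof.
split=> [/subspace_continuousP cf z|cf].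
  have {}cf := cf _ (clampt_strip z).
  move=> A /cf wA.
  have H := @continuous_clampt z _ wA.
  by apply: (@filterS _ (nbhs z) _ _ _ _ H) => y /= /(_ (clampt_strip y)).
apply: (@subspace_eq_continuous _ _ _ (f \o clampt)).
  by move=> z; rewrite inE => Tz /=; rewrite clampt_id.
exact: continuous_subspaceT.
Qed.

Lemma open_strip_strip z : open_strip T z -> strip T z.
Proof. by move=> /andP[/ltW z0 /ltW zT]; apply/andP. Qed.

Lemma open_open_strip : open (open_strip T : set X).
Proof.
rewrite (_ : open_strip T = (snd @^-1` [set t : R | 0 < t]) `&` (snd @^-1` [set t : R | t < T])).
  apply: openI; apply: open_comp; (try exact: open_gt); (try exact: open_lt);
  by move=> z _; exact: cvg_snd.
by apply/seteqP; split => z /=; rewrite /open_strip/=; [move/andP|move=> [? ?]; apply/andP].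
Qed.

Lemma near_open_strip z : open_strip T z -> \forall y \near z, open_strip T y.
Proof. by move=> Tz; exact: open_nbhs_nbhs (conj open_open_strip Tz). Qed.

Lemma C1_strip_eq (W : normedModType R) (f g : X -> W) :
  (forall z, strip T z -> f z = g z) -> C1_strip T f -> C1_strip T g.
Proof.
move=> fg [cf df Df]; have nfg z : open_strip T z -> \near z, f z = g z.
  by move/near_open_strip; apply: filterS => y /open_strip_strip /fg.
split.
- by apply: subspace_eq_continuous cf => z; rewrite inE => /fg.
- by move=> z Tz; apply: near_eq_diff (df z Tz); exact: nfg.
- move=> w; have [h ch Eh] := Df w; exists h => // z Tz.
  rewrite -Eh//; apply: near_eq_derive; apply: filterS (nfg _ Tz) => y //.
Qed.



Lemma C1_strip_continuous (W : normedModType R) (f : X -> W) :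
  C1_strip T f -> continuous (f \o clampt).
Proof. by move=> [/within_stripP]. Qed.

Lemma C1_stripP (W : normedModType R) (f : X -> W) :
  C1_strip T f <-> [/\ continuous (f \o clampt),
    forall z, open_strip T z -> differentiable f z &
    forall w, exists2 g : X -> W, continuous (g \o clampt) &
      forall z, open_strip T z -> 'D_w f z = g z].
Proof.
by split=> -[/within_stripP cf df Df]; split => // w; have [g /within_stripP cg Eg] := Df w; exists g.
Qed.

Lemma C1_strip_cst (W : normedModType R) (a : W) : C1_strip T (fun _ : X => a).
Proof.
apply/C1_stripP; split=> [|z _|w]; first by move=> z; exact: cvg_cst.
  exact: differentiable_cst.
exists (fun=> 0) => [z|z _]; first exact: cvg_cst.
exact: derive_cst.
Qed.

Lemma C1_stripD (W : normedModType R) (f g : X -> W) :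
  C1_strip T f -> C1_strip T g -> C1_strip T (fun z => f z + g z).
Proof.
move=> /C1_stripP[cf df Df] /C1_stripP[cg dg Dg]; apply/C1_stripP; split.
- by move=> z; apply: cvgD; [exact: cf|exact: cg].
- by move=> z Tz; apply: differentiableD; [exact: df|exact: dg].
- move=> w; have [f' cf' Ef] := Df w; have [g' cg' Eg] := Dg w.
  exists (fun z => f' z + g' z).
    by move=> z; apply: cvgD; [exact: cf'|exact: cg'].
  move=> z Tz; rewrite -Ef// -Eg//.
  by apply: deriveD; apply: diff_derivable; [exact: df|exact: dg].
Qed.

Lemma C1_stripM f g :
  C1_strip T f -> C1_strip T g -> C1_strip T (fun z => f z * g z).
Proof.
move=> /C1_stripP[cf df Df] /C1_stripP[cg dg Dg]; apply/C1_stripP; split.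
- by move=> z; apply: cvgM; [exact: cf|exact: cg].
- by move=> z Tz; apply: differentiableM; [exact: df|exact: dg].
- move=> w; have [f' cf' Ef] := Df w; have [g' cg' Eg] := Dg w.
  exists (fun z => f z * g' z + g z * f' z).
    move=> z; apply: cvgD; apply: cvgM; [exact: cf|exact: cg'|exact: cg|exact: cf'].
  move=> z Tz; rewrite -Ef// -Eg//.
  by rewrite deriveM//; apply: diff_derivable; [exact: df|exact: dg].
Qed.

Lemma C1_stripZ (W : normedModType R) f (e : W) :
  C1_strip T f -> C1_strip T (fun z => f z *: e).
Proof.
move=> /C1_stripP[cf df Df]; apply/C1_stripP; split.
- by move=> z; apply: cvgZr_tmp; exact: cf.
- by move=> z Tz; apply: differentiableZl; exact: df.
- move=> w; have [f' cf' Ef] := Df w.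
  exists (fun z => f' z *: e).
    by move=> z; apply: cvgZr_tmp; exact: cf'.
  move=> z Tz; rewrite -Ef// !deriveE//; [|exact: df|].
    by rewrite diffZl//; exact: df.
  by apply: differentiableZl; exact: df.
Qed.

Lemma C1_stripN (W : normedModType R) (f : X -> W) :
  C1_strip T f -> C1_strip T (fun z => - f z).
Proof.
move=> /C1_stripP[cf df Df]; apply/C1_stripP; split.
- by move=> z; apply: cvgN; exact: cf.
- by move=> z Tz; apply: differentiableN; exact: df.
- move=> w; have [f' cf' Ef] := Df w.
  exists (fun z => - f' z); first by move=> z; apply: cvgN; exact: cf'.
  by move=> z Tz; rewrite -Ef// deriveN//; apply: diff_derivable; exact: df.
Qed.

Lemma C1_stripB (W : normedModType R) (f g : X -> W) :
  C1_strip T f -> C1_strip T g -> C1_strip T (fun z => f z - g z).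
Proof. by move=> Cf Cg; apply: C1_stripD => //; exact: C1_stripN. Qed.

Lemma C1_strip_sum (W : normedModType R) (I : Type) (s : seq I) (F : I -> X -> W) :
  (forall i, C1_strip T (F i)) -> C1_strip T (fun z => \sum_(i <- s) F i z).
Proof.
move=> CF; elim: s => [|i s IH].
  by apply: (C1_strip_eq _ (C1_strip_cst 0)) => z _; rewrite big_nil.
by apply: (C1_strip_eq _ (C1_stripD (CF i) IH)) => z _; rewrite big_cons.
Qed.

Lemma C1_strip_coord (f : X -> V) i :
  C1_strip T f -> C1_strip T (fun z => f z 0 i).
Proof.
move=> /C1_stripP[cf df Df]; apply/C1_stripP; split.
- move=> z; apply: (@continuous_comp _ _ _ (f \o clampt) (fun x : V => x 0 i)).
    exact: cf.
  exact: coord_continuous.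
- move=> z Tz; apply: (@differentiable_comp _ _ _ _ f (fun x : V => x 0 i)).
    exact: df.
  exact: differentiable_coord.
- move=> w; have [f' cf' Ef] := Df w.
  exists (fun z => f' z 0 i).
    move=> z; apply: (@continuous_comp _ _ _ (f' \o clampt) (fun x : V => x 0 i)).
      exact: cf'.
    exact: coord_continuous.
  by move=> z Tz; rewrite -Ef// derive_mx ?mxE//; apply: diff_derivable; exact: df.
Qed.

Lemma C1_strip_vec (f : X -> V) :
  (forall i, C1_strip T (fun z => f z 0 i)) -> C1_strip T f.
Proof.
move=> Cf.
apply: (C1_strip_eq _ (C1_strip_sum (index_enum 'I_d) (fun i => C1_stripZ ('e_i : V) (Cf i)))).
by move=> z _; rewrite [RHS]row_sum_delta.
Qed.

Lemma C1_stripZv f (g : X -> V) :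
  C1_strip T f -> C1_strip T g -> C1_strip T (fun z => f z *: g z).
Proof.
move=> Cf Cg; apply: C1_strip_vec => i.
apply: (C1_strip_eq _ (C1_stripM Cf (C1_strip_coord i Cg))) => z _.
by rewrite mxE.
Qed.

(** The outer function is only required to be C^1 at the values taken, so that
    real powers of positive functions and square roots are covered. *)
Lemma C1_strip_chain (h h' : R -> R) f : C1_strip T f ->
  (forall z, strip T z -> is_derive (f z) (1:R) h (h' (f z)) /\ {for f z, continuous h'}) ->
  C1_strip T (fun z => h (f z)).
Proof.
move=> /C1_stripP[cf df Df] H; apply/C1_stripP; split.
- move=> z; apply: (@continuous_comp _ _ _ (f \o clampt) h); first exact: cf.
  apply: differentiable_continuous; apply/derivable1_diffP.
  by have [[]] := H _ (clampt_strip z).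
- move=> z Tz; apply: (@differentiable_comp _ _ _ _ f h); first exact: df.
  by apply/derivable1_diffP; have [[]] := H _ (open_strip_strip Tz).
- move=> w; have [f' cf' Ef] := Df w.
  exists (fun z => h' (f z) * f' z).
    move=> z; apply: cvgM; last exact: cf'.
    apply: (@continuous_comp _ _ _ (f \o clampt) h'); first exact: cf.
    by have [_] := H _ (clampt_strip z).
  move=> z Tz; rewrite -Ef//.
  have [[dh Eh] _] := H _ (open_strip_strip Tz).
  have dh' : differentiable h (f z) by apply/derivable1_diffP.
  rewrite !deriveE//; [|exact: df|apply: differentiable_comp => //; exact: df].
  rewrite (@diff_comp _ _ _ _ f h)//=; last exact: df.
  by rewrite deriv1E//= derive1E Eh /= mulrC.
Qed.

Lemma derive_chain (h h' : R -> R) f z w : differentiable f z ->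
  is_derive (f z) (1:R) h (h' (f z)) ->
  'D_w (fun z => h (f z)) z = h' (f z) * 'D_w f z.
Proof.
move=> df [dh Eh].
have dh' : differentiable h (f z) by apply/derivable1_diffP.
rewrite !deriveE//; last by apply: differentiable_comp.
rewrite (@diff_comp _ _ _ _ f h)//=.
by rewrite deriv1E//= derive1E Eh /= mulrC.
Qed.

Lemma C1_strip_linear (L : X -> R) : linear L -> continuous L ->
  C1_strip T L /\ (forall z, differentiable L z) /\ forall z w, 'D_w L z = L w.
Proof.
move=> linL cL.
pose LL : {linear X -> R} := HB.pack L (GRing.isLinear.Build _ _ _ _ L linL).
have dL z : differentiable L z by exact: (@linear_differentiable _ _ _ LL).
have DL z w : 'D_w L z = L w.
  rewrite deriveE//; exact: (congr1 (fun h => h w) (@diff_lin _ _ _ LL z cL)).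
split => //; apply/C1_stripP; split => //.
  by move=> z; apply: (@continuous_comp _ _ _ clampt L); [exact: continuous_clampt|exact: cL].
by move=> w; exists (fun=> L w) => // z; exact: cvg_cst.
Qed.

Lemma linear_fst_coord i : linear (fun z : X => z.1 0 i).
Proof. by move=> a x y; rewrite !mxE. Qed.

Lemma continuous_fst_coord i : continuous (fun z : X => z.1 0 i).
Proof.
move=> z; apply: (@continuous_comp _ _ _ (fst : X -> V) (fun x : V => x 0 i)).
  exact: cvg_fst.
exact: coord_continuous.
Qed.

Lemma linear_snd : linear (fun z : X => z.2).
Proof. by []. Qed.

Lemma continuous_snd : continuous (fun z : X => z.2).
Proof. by move=> z; exact: cvg_snd. Qed.

End C1_strip_theory.

Section compute.
Context {R : realType} {d : nat}.
Local Notation V := ('rV[R]_d).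
Local Notation X := (V * R)%type.

(** The derivative in an arbitrary space-time direction in terms of the partial
    derivatives. *)
Lemma derive_expand (W : normedModType R) (f : X -> W) (z w : X) : differentiable f z ->
  'D_w f z = \sum_j w.1 0 j *: dx j f z + w.2 *: dt f z.
Proof.
move=> df.
have Ew : w = \sum_j w.1 0 j *: (('e_j, 0) : X) + w.2 *: ((0, 1) : X).
  case: w => x t /=.
  have E (s : seq 'I_d) : \sum_(j <- s) x 0 j *: (('e_j, 0) : X) =
      (\sum_(j <- s) x 0 j *: 'e_j, 0).
    elim: s => [|j s IH]; first by rewrite !big_nil.
    by rewrite !big_cons IH; congr (_, _) => /=; rewrite addr0; exact: scaler0.
  rewrite E -row_sum_delta; congr (_, _) => /=; first by rewrite scaler0 addr0.
  by rewrite add0r [_ *: _]mulr1.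
rewrite /dx /dt !deriveE//.
under eq_bigr do rewrite deriveE//.
rewrite {1}Ew linearD linearZ linear_sum/=; congr (_ + _).
by apply: eq_bigr => j _; rewrite linearZ.
Qed.

Lemma derive_coord (f : X -> V) z w i : differentiable f z ->
  'D_w (fun z => f z 0 i) z = ('D_w f z) 0 i.
Proof. by move=> df; rewrite derive_mx ?mxE//; exact: diff_derivable. Qed.

Lemma differentiable_coordE (f : X -> V) z i : differentiable f z ->
  differentiable (fun z => f z 0 i) z.
Proof.
move=> df; apply: (@differentiable_comp _ _ _ _ f (fun x : V => x 0 i)) => //.
exact: differentiable_coord.
Qed.

Lemma derive_mul (f g : X -> R) z w : differentiable f z -> differentiable g z ->
  'D_w (fun z => f z * g z) z = f z * 'D_w g z + g z * 'D_w f z.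
Proof. by move=> df dg; rewrite deriveM//; exact: diff_derivable. Qed.

Lemma derive_add (f g : X -> R) z w : differentiable f z -> differentiable g z ->
  'D_w (fun z => f z + g z) z = 'D_w f z + 'D_w g z.
Proof. by move=> df dg; rewrite deriveD//; exact: diff_derivable. Qed.

Lemma derive_sub (f g : X -> R) z w : differentiable f z -> differentiable g z ->
  'D_w (fun z => f z - g z) z = 'D_w f z - 'D_w g z.
Proof. by move=> df dg; rewrite deriveB//; exact: diff_derivable. Qed.

End compute.

(** * Integrability of bounded functions on slabs *)

Lemma bounded_supp_integrable dd (Y : measurableType dd) (R : realType)
    (mu : {measure set Y -> \bar R}) (D S : set Y) (f : Y -> R) (B : R) :
  measurable D -> measurable S -> (mu S < +oo)%E -> measurable_fun D f ->
  (forall x, D x -> `|f x| <= B) -> (forall x, D x -> ~ S x -> f x = 0) ->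
  mu.-integrable D (EFin \o f).
Proof.
move=> mD mS Soo mf fB f0.
have [B0|B0] := leP 0 B; last first.
  have -> : D = set0.
    by rewrite -subset0 => x /fB; rewrite leNgt (lt_le_trans B0).
  exact: integrable_set0.
have i1 : mu.-integrable (D `&` S) (EFin \o f).
  apply: measurable_bounded_integrable; first exact: measurableI.
  - by apply: le_lt_trans Soo; apply: le_measure; rewrite ?inE//; exact: measurableI.
  - by apply: measurable_funS mf.
  - exists B; split; first exact: num_real.
    by move=> M BM x [Dx _]; apply: le_trans (ltW BM); exact: fB.
have i2 : mu.-integrable D ((EFin \o f) \_ S).
  by apply/(integrable_restrict _ _ _).
apply: eq_integrable i2 => //.
  move=> x; rewrite inE => Dx; rewrite /patch; case: ifPn => //.
  by rewrite notin_setE => /(f0 _ Dx) /= ->.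
Qed.

Section integrability.
Context {R : realType} {d : nat} (T : R) (T_ge0 : 0 <= T).
Local Notation V := ('rV[R]_d).
Local Notation X := (V * R)%type.
Local Notation mX := (V * measurableTypeR R)%type.
Implicit Types (f g : X -> R) (z w : X).

Lemma measurable_open_strip (t : R) : measurable (open_strip t : set mX).
Proof. by apply: open_measurable_st; exact: open_open_strip. Qed.

Lemma measurable_strip (t : R) : measurable (strip t : set mX).
Proof.
rewrite (_ : strip t = setT `*` `[0, t]%classic); last first.
  by apply/seteqP; split => z /=; rewrite /strip/= in_itv/=; [|case].
by apply: measurableX => //; exact: measurable_itv.
Qed.

Lemma cont_strip_measurable f (D : set mX) : continuous (f \o clampt T) ->
  measurable D -> D `<=` strip T -> measurable_fun D (f : mX -> R).
Proof.
move=> cf mD DT; apply: (@eq_measurable_fun _ _ _ _ _ (f \o clampt T : mX -> R)).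
  by move=> z; rewrite inE => /DT Tz /=; rewrite clampt_id.
by apply: measurable_funTS; exact: continuous_measurable_st.
Qed.

Lemma cont_strip_bounded f M : continuous (f \o clampt T) ->
  exists2 B, 0 <= B & forall z, strip T z -> `|z.1| <= M -> `|f z| <= B.
Proof.
move=> cf; pose K : set X := [set x : V | `|x| <= `|M|] `*` `[0, T]%classic.
have K0 : K !=set0 by exists (0, 0); split => /=; rewrite ?normr0 ?normr_ge0// in_itv/= lexx.
have cK : compact K.
  apply: compact_setX; last exact: segment_compact.
  apply: bounded_closed_compact.
    by exists `|M|; split; [exact: num_real|move=> a Ma x /= xM; rewrite (le_trans xM)// ltW].
  apply: (@closed_comp _ _ (fun x : V => `|x|) [set r : R | r <= `|M|]).
    by move=> x _; exact: norm_continuous.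
  exact: closed_le.
have cg : {within K, continuous (fun z => `|(f \o clampt T) z|)}.
  apply: continuous_subspaceT => z; apply: cvg_norm; exact: cf.
have [c cinK cmax] := compact_EVT_max K0 cK cg.
exists `|(f \o clampt T) c| => // z Tz zM.
have := cmax z; rewrite inE /= clampt_id//; apply.
split => /=; first by rewrite (le_trans zM)// ler_norm.
by rewrite in_itv/=.
Qed.

Definition slab M : set mX := @cube R d M `*` `[0, T]%classic.

Lemma measurable_slab M : measurable (slab M).
Proof. by apply: measurableX; [exact: measurable_cube|exact: measurable_itv]. Qed.

Lemma slab_fin M : (lebesgue_spacetime (slab M) < +oo)%E.
Proof.
have -> : lebesgue_spacetime (slab M) =
    (lebesgue_rV d (@cube R d M) * lebesgue_measure `[0%R, T]%classic)%E.
  by apply: product_measure1E; [exact: measurable_cube|exact: measurable_itv].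
rewrite lte_mul_pinfty//.
- rewrite ge0_fin_numE//; exact: lam_cube_fin.
- by rewrite lebesgue_measure_itv/=; case: ifP => _; rewrite ?ltry// -EFinD ltry.
Qed.

Lemma notin_slab M z : strip T z -> ~ slab M z -> M < `|z.1|.
Proof.
move=> Tz nS; rewrite ltNge; apply/negP => zM; apply: nS; split => /=; last by rewrite in_itv.
by move=> i /=; rewrite in_itv/= -ler_norml (le_trans _ zM)// norm_coord.
Qed.

Lemma st_integrable f M B (D : set mX) : measurable D -> D `<=` strip T ->
  measurable_fun D (f : mX -> R) ->
  (forall z, D z -> `|f z| <= B) ->
  (forall z, D z -> M < `|z.1| -> f z = 0) ->
  lebesgue_spacetime.-integrable D (EFin \o f).
Proof.
move=> mD DT mf fB f0.
apply: (@bounded_supp_integrable _ _ _ _ D (slab M) f B) => //.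
- exact: measurable_slab.
- exact: slab_fin.
- by move=> z Dz nS; apply: f0 => //; apply: notin_slab => //; exact: DT.
Qed.

Lemma cont_integrable f M (D : set mX) : measurable D -> D `<=` strip T ->
  continuous (f \o clampt T) ->
  (forall z, D z -> M < `|z.1| -> f z = 0) ->
  lebesgue_spacetime.-integrable D (EFin \o f).
Proof.
move=> mD DT cf f0.
have [B B0 fB] := cont_strip_bounded M cf.
apply: (@st_integrable f M B D) => //; first exact: cont_strip_measurable.
move=> z Dz; have [zM|zM] := leP `|z.1| M; first by apply: fB => //; exact: DT.
by rewrite f0// normr0.
Qed.

Lemma measurable_slice f t : measurable_fun (strip T) (f : mX -> R) -> 0 <= t <= T ->
  measurable_fun setT (fun x : V => f (x, t)).
Proof.
move=> mf tT.
apply: (@measurable_comp _ _ _ _ _ _ (strip T) (f : mX -> R) setT (fun x : V => (x, t) : mX)) => //.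
- exact: measurable_strip.
- by move=> _ [x _ <-].
Qed.

Lemma rV_integrable (f : V -> R) M B :
  measurable_fun setT f -> (forall x, `|f x| <= B) ->
  (forall x, M < `|x| -> f x = 0) ->
  (lebesgue_rV d).-integrable setT (EFin \o f).
Proof.
move=> mf fB f0.
apply: (@bounded_supp_integrable _ _ _ _ setT (@cube R d M) f B) => //.
- exact: measurable_cube.
- exact: lam_cube_fin.
- move=> x _ nS; apply: f0; rewrite ltNge; apply/negP => xM; apply: nS => i /=.
  by rewrite in_itv/= -ler_norml (le_trans _ xM)// norm_coord.
Qed.

Lemma cont_slice_integrable f M t : 0 <= t <= T ->
  continuous (f \o clampt T) ->
  (forall z, strip T z -> M < `|z.1| -> f z = 0) ->
  (lebesgue_rV d).-integrable setT (EFin \o (fun x => f (x, t))).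
Proof.
move=> tT cf f0.
have [B B0 fB] := cont_strip_bounded M cf.
apply: (@rV_integrable _ M B).
- apply: measurable_slice => //; apply: cont_strip_measurable => //.
  exact: measurable_strip.
- move=> x; have [xM|xM] := leP `|x| M; first exact: fB.
  by rewrite f0// normr0.
- by move=> x xM; rewrite f0.
Qed.

End integrability.

(** * The divergence theorem for compact support *)

Section lines.
Context {R : realType} {V : normedModType R}.

Lemma is_derive_line (f : V -> R) (w z : V) (s : R) : differentiable f (s *: w + z) ->
  is_derive s (1:R) (fun s => f (s *: w + z)) ('D_w f (s *: w + z)).
Proof.
move=> df; have dv : derivable f (s *: w + z) w by exact: diff_derivable.
have E : (fun h : R => h^-1 *: (f ((h *: (1:R) + s) *: w + z) - f (s *: w + z))) =
    (fun h => h^-1 *: (f (h *: w + (s *: w + z)) - f (s *: w + z))).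
  apply/funext => h; congr (_ *: (f _ - _)).
  by rewrite [h *: 1]mulr1 scalerDl addrA.
apply: DeriveDef; first by rewrite /derivable E.
by rewrite /derive E.
Qed.

Lemma MVT_line (f : V -> R) (w z : V) :
  (forall s, 0 <= s <= 1 -> differentiable f (s *: w + z)) ->
  exists2 s, 0 <= s <= 1 & f (w + z) - f z = 'D_w f (s *: w + z).
Proof.
move=> df.
have [||s s01] := @MVT_segment _ (fun s => f (s *: w + z))
    (fun s => 'D_w f (s *: w + z)) 0 1 ler01.
- move=> s; rewrite in_itv/= => /andP[/ltW s0 /ltW s1].
  by apply: is_derive_line; apply: df; rewrite s0.
- apply: derivable_within_continuous => s; rewrite in_itv/= => s01.
  by have [] := is_derive_line (df _ s01).
rewrite scale1r scale0r add0r subr0 mulr1 => ->; exists s => //.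
Qed.

End lines.

Section divergence.
Context {R : realType} {d : nat} (T : R) (T_ge0 : 0 <= T).
Local Notation V := ('rV[R]_d).
Local Notation X := (V * R)%type.
Local Notation mX := (V * measurableTypeR R)%type.
Implicit Types (f g : X -> R) (z w : X).

Let harm (n : nat) : R := n.+1%:R^-1.

Let harm_gt0 n : 0 < harm n. Proof. by rewrite invr_gt0. Qed.

Let harm_cvg0 : harm n @[n --> \oo] --> 0^'.
Proof.
have h0 : harm n @[n --> \oo] --> (0 : R) by exact: cvg_harmonic.
move=> A [e /= e0 eA].
have H : \forall n \near \oo, ball (0:R) e (harm n) by exact: h0 _ (nbhsx_ballx (0:R) e e0).
suff : \forall n \near \oo, A (harm n) by [].
by apply: filterS H => n ne; apply: eA => //=; rewrite gt_eqF.
Qed.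

Lemma derive_seq f z w : differentiable f z ->
  (fun n : nat => (harm n)^-1 * (f (harm n *: w + z) - f z)) @ \oo --> 'D_w f z.
Proof.
move=> /(@diff_derivable _ _ _ _ _ w) dv.
have : (fun h : R => h^-1 *: (f (h *: w + z) - f z)) @ (0:R)^' --> 'D_w f z by exact: dv.
by move=> H; exact: (cvg_comp _ _ harm_cvg0 H).
Qed.

(** The integral of a difference quotient vanishes by translation invariance;
    bounded differences on a slab allow the passage to the limit. *)
Lemma integral_dx f M t i : 0 <= M -> t <= T -> C1_strip T f ->
  (forall z, strip T z -> M < `|z.1| -> f z = 0) ->
  \int[lebesgue_spacetime]_(z in open_strip t) dx i f z = 0.
Proof.
move=> M0 tT Cf f0.
have [cf df Df] := (C1_stripP T_ge0 _).1 Cf.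
pose e : X := ('e_i, 0).
have [g cg Eg] := Df e.
pose D : set mX := open_strip t.
have DT z : D z -> open_strip T z by rewrite /D/open_strip/= => /andP[-> /lt_le_trans]; exact.
have DsT z : D z -> strip T z by move=> /DT; exact: open_strip_strip.
have mD : measurable D by exact: measurable_open_strip.
have mf : measurable_fun D (f : mX -> R) by exact: (cont_strip_measurable cf).
have intf : lebesgue_spacetime.-integrable D (EFin \o f).
  by apply: (cont_integrable (M := M) T_ge0) => // z /DsT; exact: f0.
have shD s z : D (s *: e + z) = D z by rewrite /D/open_strip/= [s *: 0]mulr0 add0r.
have nei : `|'e_i : V| <= 1.
  apply: normv_le => // j; rewrite mxE; case: eqP => //= _; case: eqP => //= _; by rewrite ?normr1 ?normr0.
pose fh (s : R) z := f (s *: e + z).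
have intE s : (\int[lebesgue_spacetime]_(z in D) (fh s z)%:E = \int[lebesgue_spacetime]_(z in D) (f z)%:E)%E.
  rewrite integral_mkcond [RHS]integral_mkcond.
  rewrite !restrict_EFin.
  have m1 : measurable_fun setT (f \_ D : mX -> R) by apply/measurable_restrict; rewrite ?setTI.
  rewrite -(integral_spacetime_shift (s *: 'e_i) 0 m1).
  apply: eq_integral => z _; congr EFin; rewrite /patch.
  have -> : (z.1 + s *: 'e_i, z.2 + 0) = s *: e + z.
    by apply/esym; case: z => x y; congr (_, _) => /=; rewrite ?addr0 ?(mulr0 s : s *: (0:R) = 0) ?add0r // addrC.
  have -> : (s *: e + z \in D) = (z \in D) by apply/idP/idP; rewrite !inE shD.
  by [].
have far s z : 0 <= s <= 1 -> M + 1 < `|z.1| -> M < `|(s *: e + z).1|.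
  move=> /andP[s0 s1]; rewrite -ltrBrDr => /lt_le_trans; apply.
  rewrite lerBlDr /= -[X in `|X| <= _](addKr (s *: 'e_i)) addrC.
  rewrite (le_trans (ler_normD _ _))// lerD// normrN normrZ ger0_norm//.
  by rewrite -[leRHS]mulr1 ler_pM.
have int_shift s : 0 <= s <= 1 -> lebesgue_spacetime.-integrable D (EFin \o fh s).
  move=> s01.
  have ch : continuous (fh s \o clampt T).
    move=> z; have -> : fh s \o clampt T = (f \o clampt T) \o (fun z => s *: e + z).
      apply/funext => -[x y]; rewrite /fh /clampt /=; congr (f (_, _)) => /=.
      by rewrite (_ : s *: (0:R) = 0) ?add0r//; exact: mulr0.
    apply: continuous_comp; last exact: cf.
    by apply: cvgD; [exact: cvg_cst|exact: cvg_id].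
  apply: (cont_integrable (M := M + 1) T_ge0) => // z Dz zM.
  apply: f0; first by apply: DsT; rewrite shD.
  exact: far.
have [B B0 gB] := cont_strip_bounded T_ge0 (M + 2) cg.
pose F (n : nat) z := (harm n)^-1 * (fh (harm n) z - f z).
have harm1 n : 0 <= harm n <= 1.
  by rewrite (ltW (harm_gt0 n)) /harm invf_le1 ?ltr0n// ler1n.
have intF n : (\int[lebesgue_spacetime]_(z in D) (F n z)%:E = 0)%E.
  under eq_integral do rewrite /F EFinM.
  rewrite integralZl//; last first.
    have iB := integrableB mD (int_shift _ (harm1 n)) intf.
    by apply: eq_integrable iB => // z _; rewrite /= EFinB.
  under eq_integral do rewrite EFinB.
  rewrite integralB//; last exact: (int_shift _ (harm1 n)).
  rewrite intE subee ?mule0//; exact: integrable_fin_num.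
have Fz n z : D z -> ~ slab T (M + 1) z -> F n z = 0.
  move=> Dz nS; have zM := notin_slab (DsT _ Dz) nS.
  rewrite /F /fh f0 ?f0 ?subrr ?mulr0//; [exact: DsT| |apply: DsT|exact: far]; last by rewrite shD.
  by rewrite (le_lt_trans _ zM)// lerDl.
have FB n z : D z -> `|F n z| <= B.
  move=> Dz; have [/andP[h0 h1]] := harm1 n.
  have [zM|zM] := leP `|z.1| (M + 1); last first.
    rewrite /F /fh f0 ?f0 ?subrr ?mulr0 ?normr0//; [exact: DsT| |apply: DsT|exact: far]; last by rewrite shD.
    by rewrite (le_lt_trans _ zM)// lerDl.
  have Ds s : D (s *: (harm n *: e) + z) by rewrite scalerA shD.
  have [s _|s /andP[s0 s1] E] := @MVT_line _ X f (harm n *: e) z.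
    by apply: df; exact: DT (Ds s).
  have dfs := df _ (DT _ (Ds s)).
  rewrite /F /fh E deriveE// linearZ/= -[X in _ * X]/(harm n * _) mulKf; last by rewrite gt_eqF.
  rewrite -deriveE// (Eg _ (DT _ (Ds s))); apply: gB; first exact: DsT.
  rewrite /= (le_trans (ler_normD _ _))// (_ : M + 2 = 1 + (M + 1)); last by ring.
  rewrite lerD// !normrZ !ger0_norm// mulrA -[leRHS]mulr1 ler_pM// ?mulr_ge0//.
  by rewrite -[leRHS]mulr1 ler_pM.
pose G z := (B * \1_(slab T (M + 1)) z)%:E.
have mdx : measurable_fun D (EFin \o dx i f : mX -> \bar R).
  apply/measurable_EFinP; apply: (@eq_measurable_fun _ _ _ _ _ (g : mX -> R)).
    by move=> z; rewrite inE => /DT /Eg.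
  exact: (cont_strip_measurable cg).
have mF n : measurable_fun D (fun z : mX => (F n z)%:E).
  apply/measurable_EFinP; apply: measurable_funM => //.
  apply: measurable_funB => //.
  by have /integrableP[/measurable_EFinP] := int_shift _ (harm1 n).
have iG : lebesgue_spacetime.-integrable D G.
  apply: (@bounded_supp_integrable _ _ _ _ D (slab T (M + 1)) _ B) => //.
  - exact: measurable_slab.
  - exact: slab_fin.
  - apply: measurable_funM => //; apply: measurable_indic; exact: measurable_slab.
  - move=> z _; rewrite indicE; case: (_ \in _); rewrite ?mulr1 ?mulr0 ?ger0_norm ?normr0//.
  - by move=> z _ nz; rewrite indicE memNset ?mulr0.
have FdF z : D z -> (fun n => (F n z)%:E) @ \oo --> (dx i f z)%:E.
  move=> Dz; apply: cvg_EFin; first by apply: nearW.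
  apply: derive_seq; apply: df; exact: DT.
have FG z n : D z -> (`|(F n z)%:E| <= G z)%E.
  move=> Dz; rewrite lee_fin indicE.
  have [zS|zS] := boolP (z \in slab T (M + 1)); first by rewrite mulr1 FB.
  by rewrite Fz ?normr0 ?mulr0//; move/negP : zS; rewrite inE.
have ae1 : {ae lebesgue_spacetime, forall z : mX, D z -> (fun n => (F n z)%:E) @ \oo --> (EFin \o dx i f) z}.
  by apply: aeW => z; exact: FdF.
have ae2 : {ae lebesgue_spacetime, forall (z : mX) n, D z -> (`|(F n z)%:E| <= G z)%E}.
  by apply: aeW => z n; exact: FG.
have [_ _] := @dominated_convergence _ _ _ lebesgue_spacetime D mD
  (fun n z => (F n z)%:E) (EFin \o dx i f) G mF mdx ae1 iG ae2.
under eq_fun do rewrite intF.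
move=> /(cvg_unique _ (cvg_cst _)) E.
by rewrite /Rintegral -/D -E.
Qed.

Lemma FTC_slice f g t x : 0 < t < T -> C1_strip T f -> continuous (g \o clampt T) ->
  (forall z, open_strip T z -> dt f z = g z) ->
  (\int[@lebesgue_measure R]_(s in `]0%R, t[) (g (x, s))%:E = (f (x, t) - f (x, 0))%:E)%E.
Proof.
move=> /andP[t0 tT] Cf cg Eg.
have [cf df _] := (C1_stripP T_ge0 _).1 Cf.
have lineE (h : X -> R) : continuous (h \o clampt T) -> continuous (fun s => (h \o clampt T) (x, s)).
  move=> ch s; apply: (@continuous_comp _ _ _ (fun s => (x, s) : X) (h \o clampt T)); last exact: ch.
  have c1 : (cst x : R -> V) y @[y --> s] --> x by exact: cvg_cst.
  have c2 : y @[y --> s] --> s by exact: cvg_id.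
  exact: (cvg_pair c1 c2).
have cl s : 0 <= s <= t -> clampt T (x, s) = (x, s).
  by move=> /andP[s0 st]; apply: clampt_id; rewrite /strip/= s0 (le_trans st)// ltW.
have mg : measurable_fun `]0, t[%classic (fun s => g (x, s)).
  apply: (@eq_measurable_fun _ _ _ _ _ (fun s => (g \o clampt T) (x, s))).
    by move=> s; rewrite inE/= in_itv/= => /andP[/ltW s0 /ltW st]; rewrite /= cl// s0.
  by apply: measurable_funTS; apply: continuous_measurable_fun; exact: lineE.
rewrite -(integral_itv_bndoo true false); last exact/measurable_EFinP.
transitivity (\int[@lebesgue_measure R]_(s in `[0%R, t]) ((g \o clampt T) (x, s))%:E)%E.
  by apply: eq_integral => s; rewrite inE/= in_itv/= => Es; rewrite cl.
have lin s : s *: ((0, 1) : X) + (x, 0) = (x, s).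
  by congr (_, _) => /=; rewrite ?scaler0 ?add0r ?addr0//; exact: mulr1.
have dF s : 0 < s < t -> is_derive s (1:R) (fun s => (f \o clampt T) (x, s)) ((g \o clampt T) (x, s)).
  move=> /andP[s0 st]; have Os : open_strip T (x, s) by rewrite /open_strip/= s0 (lt_trans st).
  have dl := @is_derive_line _ X f (0, 1) (x, 0) s; rewrite lin in dl.
  have := dl (df _ Os); rewrite -/(dt f (x, s)) Eg// => {}dl.
  rewrite /= cl ?(ltW s0) ?(ltW st)//.
  apply: near_eq_is_derive dl.
  near=> y; rewrite lin cl//; apply/andP; split; apply: ltW; near: y.
    exact: lt_nbhsr.
  exact: lt_nbhsl.
rewrite (@continuous_FTC2 _ (fun s => (g \o clampt T) (x, s)) (fun s => (f \o clampt T) (x, s)))//.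
- by rewrite /= !cl ?lexx ?(ltW t0)// -EFinB.
- by apply: continuous_subspaceT; exact: lineE.
- split.
  + by move=> s; rewrite in_itv/= => /dF[].
  + apply: cvg_at_right_filter; exact: lineE.
  + apply: cvg_at_left_filter; exact: lineE.
- by move=> s; rewrite in_itv/= => /dF[_]; rewrite derive1E => ->.
Unshelve. all: by end_near. Qed.

(** The fundamental theorem of calculus on each vertical line, then Tonelli. *)
Lemma integral_dt f M t : 0 <= M -> 0 < t < T -> C1_strip T f ->
  (forall z, strip T z -> M < `|z.1| -> f z = 0) ->
  \int[lebesgue_spacetime]_(z in open_strip t) dt f z =
  \int[lebesgue_rV d]_x (f (x, t) - f (x, 0)).
Proof.
move=> M0 tT Cf f0; have /andP[t0 tT'] := tT.
have [cf df Df] := (C1_stripP T_ge0 _).1 Cf.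
have [g cg Eg] := Df (0, 1).
pose D : set mX := open_strip t.
have DT z : D z -> open_strip T z by rewrite /D/open_strip/= => /andP[-> /lt_trans]; exact.
have DsT z : D z -> strip T z by move=> /DT; exact: open_strip_strip.
have mD : measurable D by exact: measurable_open_strip.
rewrite /Rintegral; congr fine.
transitivity (\int[lebesgue_spacetime]_(z in D) (g z)%:E)%E.
  by apply: eq_integral => z; rewrite inE => /DT /Eg /= <-.
have g0 z : D z -> M < `|z.1| -> g z = 0.
  move=> Dz zM; rewrite -Eg; last exact: DT.
  rewrite (_ : derive f z (0,1) = derive (cst 0 : X -> R) z (0,1)); first exact: derive_cst.
  apply: near_eq_derive; near=> y.
  apply: f0; near: y.
    by apply: filterS (near_open_strip (DT _ Dz)) => y; exact: open_strip_strip.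
  have : (fun y : X => `|y.1|) @ z --> `|z.1| by apply: cvg_norm; exact: cvg_fst.
  by move=> H; apply: (H [set r | M < r]); exact: lt_nbhsr.
have ig : lebesgue_spacetime.-integrable D (EFin \o g).
  exact: (cont_integrable (M := M) T_ge0).
have iF : ((@lam R d \x @lebesgue_measure R)%E).-integrable setT ((EFin \o g : mX -> \bar R) \_ D).
  by apply/(integrable_mkcond _ mD).1.
rewrite [LHS]integral_mkcond.
have H := integral12_prod_meas1 iF.
transitivity (\int[(@lam R d \x @lebesgue_measure R)%E]_z (((EFin \o g : mX -> \bar R) \_ D) z))%E; first by [].
rewrite -H.
apply: eq_integral => x _; rewrite /fubini_F.
rewrite -(FTC_slice x tT Cf cg Eg) [RHS]integral_mkcond.
apply: eq_integral => s _; rewrite /patch.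
have -> : ((x, s) \in D) = (s \in `]0, t[%classic).
  by apply/idP/idP => /set_mem H0; apply/mem_set; move: H0; rewrite /D/open_strip/= in_itv.
by [].
Unshelve. all: by end_near. Qed.

End divergence.

(** * The relative energy inequality for a comparison field *)

Section algebra.
Context {R : realType} {d : nat}.
Implicit Types (x y : 'I_d -> R) (a b c : R).

Lemma sum_lin2 x y a b :
  \sum_i (a * x i + b * y i) = a * (\sum_i x i) + b * (\sum_i y i).
Proof. by rewrite big_split/= -!mulr_sumr. Qed.

(** The pointwise identity behind the relative energy inequality, with every
    derivative replaced by an independent real number: [f] is the cutoff, [W]
    the comparison velocity, [q] the enthalpy, [p] the pressure of the
    comparison density, and [G] the velocity gradient. The transport equations
    for [q] and [p] are needed where the cutoff is nonzero. *)
Lemma relative_energy_algebra (f ft q qt p pt rh g R1 Rg rh1 rhg : R)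
    (fx W Wt qx px u : 'I_d -> R) (G : 'I_d -> 'I_d -> R) :
  g != 1 -> rhg = rh * rh1 -> p = Rg -> q = g / (g - 1) * R1 ->
  (f != 0 -> qt + \sum_j W j * qx j = - g * R1 * \sum_i G i i /\
    pt + \sum_j W j * px j = - g * Rg * \sum_i G i i) ->
  (ft * (2^-1 * rh * (\sum_i u i * u i) + (g - 1)^-1 * rhg) +
   (2^-1 * rh * (\sum_i u i * u i) + g / (g - 1) * rhg) * (\sum_i fx i * u i)) -
  (\sum_i (f * Wt i + W i * ft) * (rh * u i) +
   \sum_i \sum_j (f * G i j + W i * fx j) * (rh * u i * u j) +
   rhg * \sum_i (f * G i i + W i * fx i)) +
  ((f * (\sum_i W i * Wt i - qt) + (2^-1 * (\sum_i W i * W i) - q) * ft) * rh +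
   \sum_j (f * (\sum_i W i * G i j - qx j) + (2^-1 * (\sum_i W i * W i) - q) * fx j) * (rh * u j)) +
  (f * pt + p * ft) +
  \sum_i (f * (p * G i i + W i * px i) + p * W i * fx i) =
  ft * (2^-1 * rh * (\sum_i (u i - W i) * (u i - W i)) + Rg - g / (g - 1) * rh * R1 + (g - 1)^-1 * rhg) +
  \sum_i fx i * ((2^-1 * rh * (\sum_i (u i - W i) * (u i - W i))) * u i -
     (g / (g - 1) * (R1 - rh1) * rh) * u i + (Rg - rhg) * W i) +
  f * (- rh * (\sum_i (u i - W i) * (Wt i + \sum_j W j * G i j + qx i)) -
       rh * (\sum_i \sum_j (u i - W i) * (u j - W j) * G i j) -
       (g - 1) * (\sum_i G i i) * (Rg - g / (g - 1) * rh * R1 + (g - 1)^-1 * rhg)).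
Proof.
move=> g1 -> -> -> HH.
set uu := \sum_i u i * u i. set WW := \sum_i W i * W i.
set fu := \sum_i fx i * u i. set dv := \sum_i G i i.
pose uW := \sum_i u i * W i. pose fW := \sum_i W i * fx i.
pose Wtu := \sum_i Wt i * u i. pose WtW := \sum_i W i * Wt i.
pose Guu := \sum_i \sum_j G i j * u i * u j.
pose GuW := \sum_i \sum_j G i j * u i * W j.
pose GWu := \sum_i \sum_j G i j * W i * u j.
pose GWW := \sum_i \sum_j G i j * W i * W j.
pose qu := \sum_j qx j * u j. pose qW := \sum_j W j * qx j.
pose pW := \sum_j W j * px j.
have -> : \sum_i (u i - W i) * (u i - W i) = uu - 2 * uW + WW.
  transitivity (\sum_i (1 * (u i * u i) + 1 * (-2 * (u i * W i) + 1 * (W i * W i)))).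
    by apply: eq_bigr => i _; ring.
  rewrite sum_lin2 sum_lin2 -/uu -/uW -/WW; ring.
have -> : \sum_i (f * Wt i + W i * ft) * (rh * u i) = rh * f * Wtu + rh * ft * uW.
  by rewrite -sum_lin2; apply: eq_bigr => i _; ring.
have -> : \sum_i \sum_j (f * G i j + W i * fx j) * (rh * u i * u j) =
    rh * f * Guu + rh * uW * fu.
  transitivity (\sum_i (rh * f * (\sum_j G i j * u i * u j) + rh * (u i * W i * fu))).
    apply: eq_bigr => i _; rewrite mulrA mulr_sumr [_ * fu]mulr_sumr -big_split/=.
    by apply: eq_bigr => j _; ring.
  by rewrite sum_lin2 -mulr_suml -/uW -/Guu; ring.
have -> : \sum_i (f * G i i + W i * fx i) = f * dv + fW.
  by rewrite big_split/= -mulr_sumr.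
set k := 2^-1 * WW - _.
have -> : \sum_j (f * (\sum_i W i * G i j - qx j) + k * fx j) * (rh * u j) =
   rh * f * (GWu - qu) + rh * k * fu.
  rewrite mulrBr.
  have -> : GWu = \sum_j \sum_i G i j * W i * u j by rewrite /GWu exchange_big.
  transitivity (\sum_j (rh * f * ((\sum_i G i j * W i * u j) - qx j * u j) + rh * k * (fx j * u j))).
    apply: eq_bigr => j _.
    have -> : \sum_i G i j * W i * u j = (\sum_i W i * G i j) * u j.
      by rewrite mulr_suml; apply: eq_bigr => i _; ring.
    ring.
  by rewrite sum_lin2 sumrB -/qu -/fu; ring.
have -> : \sum_i (f * (Rg * G i i + W i * px i) + Rg * W i * fx i) =
    f * Rg * dv + f * pW + Rg * fW.
  transitivity (\sum_i (1 * ((f * Rg) * G i i + f * (W i * px i)) + Rg * (W i * fx i))).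
    by apply: eq_bigr => i _; ring.
  by rewrite sum_lin2 sum_lin2 -/dv -/pW -/fW; ring.
set k2 := uu - 2 * uW + WW.
have -> : \sum_i fx i * ((2^-1 * rh * k2) * u i -
     (g / (g - 1) * (R1 - rh1) * rh) * u i + (Rg - rh * rh1) * W i) =
   (2^-1 * rh * k2 - g / (g - 1) * (R1 - rh1) * rh) * fu + (Rg - rh * rh1) * fW.
  by rewrite -sum_lin2; apply: eq_bigr => i _; ring.
have -> : \sum_i (u i - W i) * (Wt i + \sum_j W j * G i j + qx i) =
    Wtu - WtW + GuW - GWW + qu - qW.
  transitivity (\sum_i ((Wt i * u i - W i * Wt i) +
     (\sum_j G i j * u i * W j - \sum_j G i j * W i * W j) + (qx i * u i - W i * qx i))).
    apply: eq_bigr => i _.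
    have -> : \sum_j G i j * u i * W j = u i * \sum_j W j * G i j.
      by rewrite mulr_sumr; apply: eq_bigr => j _; ring.
    have -> : \sum_j G i j * W i * W j = W i * \sum_j W j * G i j.
      by rewrite mulr_sumr; apply: eq_bigr => j _; ring.
    ring.
  by rewrite !big_split/= !sumrN; rewrite -/Wtu -/WtW -/GuW -/GWW -/qu -/qW; ring.
have -> : \sum_i \sum_j (u i - W i) * (u j - W j) * G i j = Guu - GuW - GWu + GWW.
  transitivity (\sum_i ((\sum_j G i j * u i * u j - \sum_j G i j * u i * W j) +
    (- \sum_j G i j * W i * u j + \sum_j G i j * W i * W j))).
    apply: eq_bigr => i _; rewrite -!sumrN -!big_split/=.
    by apply: eq_bigr => j _; ring.
  by rewrite !big_split/= !sumrN -/Guu -/GuW -/GWu -/GWW; ring.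
rewrite -/WtW /k /k2; move: g1; rewrite -subr_eq0 => g1.
have [-> |f0] := eqVneq f 0; first by field.
have [] := HH f0; rewrite -/qW -/pW -/dv => Hq Hp.
have -> : qt = - g * R1 * dv - qW by rewrite -Hq; ring.
have -> : pt = - g * Rg * dv - pW by rewrite -Hp; ring.
field.
done.
Qed.

End algebra.

Section euclid.
Context {R : realType} {d : nat}.
Implicit Types u w : 'rV[R]_d.

Lemma dotv_ge0 u : 0 <= dotv u u.
Proof. by apply: sumr_ge0 => i _; rewrite -expr2 sqr_ge0. Qed.

Lemma sqr_enorm u : enorm u ^+ 2 = dotv u u.
Proof. by rewrite sqr_sqrtr// dotv_ge0. Qed.

Lemma enorm_ge0 u : 0 <= enorm u. Proof. exact: sqrtr_ge0. Qed.

Lemma dotvBB u w : dotv (u - w) (u - w) = \sum_i (u 0 i - w 0 i) * (u 0 i - w 0 i).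
Proof. by apply: eq_bigr => i _; rewrite !mxE. Qed.

End euclid.

Section pointwise.
Context {R : realType} {d : nat}.
Local Notation V := ('rV[R]_d).
Local Notation X := (V * R)%type.
Implicit Types (z w : X).

(** Material acceleration plus enthalpy gradient: it vanishes for a velocity
    that solves the momentum equation in the fluid. *)
Definition accel (W : X -> V) (Q : X -> R) z (i : 'I_d) : R :=
  (dt W z) 0 i + \sum_j W z 0 j * (dx j W z) 0 i + dx i Q z.

(** The relative energy of two fluids with equal velocities: the Bregman
    distance of the convex function rh^g / (g - 1). *)
Definition potential_energy (g r rh : R) : R :=
  r `^ g - g / (g - 1) * rh * r `^ (g - 1) + (g - 1)^-1 * rh `^ g.

(** The part of the relative energy balance in which the derivatives fall on the
    comparison field. *)
Definition dissipation (g : R) (r : X -> R) (W : X -> V) (Q : X -> R) (rh : X -> R)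
    (u : X -> V) z : R :=
  - rh z * (\sum_i (u z 0 i - W z 0 i) * accel W Q z i) -
  rh z * (\sum_i \sum_j (u z 0 i - W z 0 i) * (u z 0 j - W z 0 j) * (dx j W z) 0 i) -
  (g - 1) * divx W z * potential_energy g (r z) (rh z).

Lemma relative_energyE g r (W : V) rh (u : V) :
  relative_energy g r W rh u =
  2^-1 * rh * (\sum_i (u 0 i - W 0 i) * (u 0 i - W 0 i)) + potential_energy g r rh :> R.
Proof. by rewrite /relative_energy sqr_enorm dotvBB /potential_energy !addrA. Qed.

Lemma derive_scale_coord (f : X -> R) (W : X -> V) z w i :
  differentiable f z -> differentiable W z -> differentiable (fun z => f z *: W z) z ->
  ('D_w (fun z => f z *: W z) z) 0 i = f z * ('D_w W z) 0 i + W z 0 i * 'D_w f z.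
Proof.
move=> df dW dfW; rewrite -(derive_coord w i dfW).
have -> : (fun z : X => (f z *: W z) 0 i) = (fun z => f z * W z 0 i).
  by apply/funext => y; rewrite mxE.
by rewrite derive_mul ?derive_coord//; exact: differentiable_coordE.
Qed.

Lemma differentiable_dotv (W : X -> V) z : differentiable W z ->
  differentiable (fun z => dotv (W z) (W z)) z.
Proof.
move=> dW; rewrite (_ : (fun _ => _) = \sum_(i < d) (fun z => W z 0 i * W z 0 i)).
  by apply: differentiable_sum => i; apply: differentiableM; exact: differentiable_coordE.
by apply/funext => y; rewrite /dotv fct_sumE.
Qed.

Lemma derive_dotv (W : X -> V) z w : differentiable W z ->
  'D_w (fun z => dotv (W z) (W z)) z = 2 * \sum_i W z 0 i * ('D_w W z) 0 i.
Proof.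
move=> dW; rewrite (_ : (fun _ => _) = \sum_(i < d) (fun z => W z 0 i * W z 0 i)); last first.
  by apply/funext => y; rewrite /dotv fct_sumE.
have dWi i := differentiable_coordE i dW.
rewrite derive_sum; last first.
  by move=> i; apply: diff_derivable; apply: differentiableM.
rewrite mulr_sumr; apply: eq_bigr => i _.
by rewrite derive_mul// derive_coord//; ring.
Qed.

Lemma derive_scalar2 (f : X -> R) (W : X -> V) (Q : X -> R) z w :
  differentiable f z -> differentiable W z -> differentiable Q z ->
  'D_w (fun z => f z * (2^-1 * dotv (W z) (W z) - Q z)) z =
  f z * (\sum_i W z 0 i * ('D_w W z) 0 i - 'D_w Q z) +
  (2^-1 * dotv (W z) (W z) - Q z) * 'D_w f z.
Proof.
move=> df dW dQ.
have dd := differentiable_dotv dW.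
have d1 : differentiable (fun z => 2^-1 * dotv (W z) (W z)) z.
  exact: (@differentiableM _ _ (cst 2^-1) _ z (differentiable_cst _ _) dd).
rewrite derive_mul//; last exact: differentiableB.
rewrite derive_sub// (@derive_mul _ _ (cst 2^-1))//.
by rewrite derive_cst derive_dotv//; congr (_ + _); congr (_ * _); congr (_ - _); rewrite /cst/= mulr0 addr0 mulrA mulVf ?mul1r ?pnatr_eq0.
Qed.

(** Adding the derivatives of [phi P] and [phi P W] changes no integral, up to
    boundary terms, and completes the energy, momentum and mass integrands to
    the relative energy and its flux. *)
Lemma integrand_identity (g : R) (phi r P Q rh : X -> R) (W u : X -> V) z :
  1 < g -> 0 <= rh z ->
  differentiable phi z -> differentiable W z -> differentiable Q z -> differentiable P z ->
  differentiable (fun z => phi z *: W z) z ->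
  P z = r z `^ g -> Q z = g / (g - 1) * r z `^ (g - 1) ->
  (phi z != 0 ->
    dt Q z + \sum_j W z 0 j * dx j Q z = - g * r z `^ (g - 1) * divx W z /\
    dt P z + \sum_j W z 0 j * dx j P z = - g * r z `^ g * divx W z) ->
  energy_integrand g phi rh u z -
  momentum_integrand g (fun z => phi z *: W z) rh u z +
  mass_integrand (fun z => phi z * (2^-1 * dotv (W z) (W z) - Q z)) rh u z +
  dt (fun z => phi z * P z) z +
  \sum_i dx i (fun z => phi z * (P z * W z 0 i)) z =
  dt phi z * relative_energy g (r z) (W z) (rh z) (u z) +
  dotv (grad phi z) (relative_flux g (r z) (W z) (rh z) (u z)) +
  phi z * dissipation g r W Q rh u z.
Proof.
move=> g1 rh0 dphi dW dQ dP dphiW EP EQ HPQ.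
have dWi i := differentiable_coordE i dW.
have Erh : rh z `^ g = rh z * rh z `^ (g - 1) by rewrite mulr_powRB1// (lt_trans ltr01).
have gn1 : g != 1 by rewrite gt_eqF.
have := @relative_energy_algebra R d (phi z) (dt phi z) (Q z) (dt Q z) (P z) (dt P z)
  (rh z) g (r z `^ (g - 1)) (r z `^ g) (rh z `^ (g - 1)) (rh z `^ g)
  (fun i => dx i phi z) (fun i => W z 0 i) (fun i => (dt W z) 0 i)
  (fun i => dx i Q z) (fun i => dx i P z) (fun i => u z 0 i)
  (fun i j => (dx j W z) 0 i) gn1 Erh EP EQ HPQ.
move=> E.
have flux0 i : relative_flux g (r z) (W z) (rh z) (u z) 0 i =
    (2^-1 * rh z * (\sum_i (u z 0 i - W z 0 i) * (u z 0 i - W z 0 i))) * u z 0 i -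
    (g / (g - 1) * (r z `^ (g - 1) - rh z `^ (g - 1)) * rh z) * u z 0 i +
    (r z `^ g - rh z `^ g) * W z 0 i.
  by rewrite /relative_flux sqr_enorm dotvBB !mxE.
transitivity (dt phi z * (2^-1 * rh z * (\sum_i (u z 0 i - W z 0 i) * (u z 0 i - W z 0 i)) +
    r z `^ g - g / (g - 1) * rh z * r z `^ (g - 1) + (g - 1)^-1 * rh z `^ g) +
  \sum_i dx i phi z * ((2^-1 * rh z * (\sum_i (u z 0 i - W z 0 i) * (u z 0 i - W z 0 i))) * u z 0 i -
    (g / (g - 1) * (r z `^ (g - 1) - rh z `^ (g - 1)) * rh z) * u z 0 i +
    (r z `^ g - rh z `^ g) * W z 0 i) + phi z * dissipation g r W Q rh u z); last first.
  congr (_ * _ + _ + _).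
    by rewrite relative_energyE /potential_energy !addrA.
  by apply: eq_bigr => i _; rewrite flux0 mxE.
rewrite -[X in _ = _ + X]/(phi z * (- rh z * (\sum_i (u z 0 i - W z 0 i) * ((dt W z) 0 i + \sum_j W z 0 j * (dx j W z) 0 i + dx i Q z)) -
  rh z * (\sum_i \sum_j (u z 0 i - W z 0 i) * (u z 0 j - W z 0 j) * (dx j W z) 0 i) -
  (g - 1) * (\sum_i (dx i W z) 0 i) * (r z `^ g - g / (g - 1) * rh z * r z `^ (g - 1) + (g - 1)^-1 * rh z `^ g))).
rewrite -E; clear E.
congr (_ - _ + _ + _ + _).
- rewrite /energy_integrand /energy /dotv; congr (_ + _ * _).
  by apply: eq_bigr => i _; rewrite mxE.
- rewrite /momentum_integrand /dotv /divx; congr (_ + _ + _ * _).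
  + by apply: eq_bigr => i _; rewrite /dt derive_scale_coord// !mxE.
  + by apply: eq_bigr => i _; apply: eq_bigr => j _; rewrite /dx derive_scale_coord.
  + by apply: eq_bigr => i _; rewrite /dx derive_scale_coord.
- rewrite /mass_integrand /dotv /dt /dx; congr (_ * _ + _).
    by rewrite derive_scalar2.
  by apply: eq_bigr => j _; rewrite !mxE /dx derive_scalar2.
- by rewrite /dt derive_mul.
- apply: eq_bigr => i _; rewrite /dx derive_mul//; last exact: differentiableM.
  by rewrite derive_mul// derive_coord//; ring.
Qed.

End pointwise.

Section integrated.
Context {R : realType} {d : nat} (T : R) (T_ge0 : 0 <= T).
Local Notation V := ('rV[R]_d).
Local Notation X := (V * R)%type.
Local Notation mX := (V * measurableTypeR R)%type.

Lemma derive_zero_near (f : X -> R) z w : (\near z, f z = 0) -> 'D_w f z = 0.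
Proof.
move=> fz; rewrite (_ : derive f z w = derive (cst 0 : X -> R) z w); first exact: derive_cst.
exact: near_eq_derive.
Qed.

Lemma derive_support (f : X -> R) M z w :
  (forall z, strip T z -> M < `|z.1| -> f z = 0) ->
  open_strip T z -> M < `|z.1| -> 'D_w f z = 0.
Proof.
move=> f0 Tz zM; apply: derive_zero_near; near=> y.
apply: f0; near: y.
  by apply: filterS (near_open_strip Tz) => y; exact: open_strip_strip.
have : (fun y : X => `|y.1|) @ z --> `|z.1| by apply: cvg_norm; exact: cvg_fst.
by move=> H; apply: (H [set r | M < r]); exact: lt_nbhsr.
Unshelve. all: by end_near. Qed.

Lemma integrable_derive (f : X -> R) M w t : C1_strip T f -> t <= T ->
  (forall z, strip T z -> M < `|z.1| -> f z = 0) ->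
  lebesgue_spacetime.-integrable (open_strip t : set mX) (EFin \o (fun z => 'D_w f z)).
Proof.
move=> /(C1_stripP T_ge0)[_ _ Df] tT f0; have [h ch Eh] := Df w.
have DT z : (open_strip t) z -> open_strip T z by rewrite /open_strip/= => /andP[-> /lt_le_trans]; exact.
have mD : measurable (open_strip t : set mX) by exact: measurable_open_strip.
have ih : lebesgue_spacetime.-integrable (open_strip t : set mX) (EFin \o h).
  apply: (cont_integrable (M := M) T_ge0) => //.
    by move=> z /DT; exact: open_strip_strip.
  by move=> z /DT Tz zM; rewrite -Eh// (derive_support w f0).
by apply: eq_integrable ih => // z; rewrite inE => /DT Tz /=; rewrite Eh.
Qed.

Lemma RintegralDD (dd : measure_display) (Y : measurableType dd)
    (mu : {measure set Y -> \bar R}) (D : set Y) (f g : Y -> R) : measurable D ->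
  mu.-integrable D (EFin \o f) -> mu.-integrable D (EFin \o g) ->
  mu.-integrable D (EFin \o (fun x => f x + g x)) /\
  \int[mu]_(x in D) (f x + g x) = \int[mu]_(x in D) f x + \int[mu]_(x in D) g x.
Proof.
move=> mD fi gi; split; last exact: RintegralD.
by apply: eq_integrable (integrableD mD fi gi) => // x _; rewrite /= EFinD.
Qed.

Lemma RintegralBB (dd : measure_display) (Y : measurableType dd)
    (mu : {measure set Y -> \bar R}) (D : set Y) (f g : Y -> R) : measurable D ->
  mu.-integrable D (EFin \o f) -> mu.-integrable D (EFin \o g) ->
  mu.-integrable D (EFin \o (fun x => f x - g x)) /\
  \int[mu]_(x in D) (f x - g x) = \int[mu]_(x in D) f x - \int[mu]_(x in D) g x.
Proof.
move=> mD fi gi; split; last exact: RintegralB.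
by apply: eq_integrable (integrableB mD fi gi) => // x _; rewrite /= EFinB.
Qed.

Lemma Rintegral_sum0 (dd : measure_display) (Y : measurableType dd)
    (mu : {measure set Y -> \bar R}) (D : set Y) (I : Type) (s : seq I) (f : I -> Y -> R) :
  measurable D ->
  (forall i, mu.-integrable D (EFin \o f i) /\ \int[mu]_(x in D) f i x = 0) ->
  mu.-integrable D (EFin \o (fun x => \sum_(i <- s) f i x)) /\
  \int[mu]_(x in D) (\sum_(i <- s) f i x) = 0.
Proof.
move=> mD H; elim: s => [|i s [IH1 IH2]].
  have -> : (fun x : Y => \sum_(i <- [::]) f i x) = cst 0.
    by apply/funext => x; rewrite big_nil.
  split; first exact: integrable0.
  by rewrite /Rintegral integral0.
have -> : (fun x : Y => \sum_(i <- i :: s) f i x) = (fun x => f i x + \sum_(i <- s) f i x).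
  by apply/funext => x; rewrite big_cons.
have [Hi Hi0] := H i; have [E1 E2] := RintegralDD mD Hi IH1.
by split => //; rewrite E2 Hi0 IH2 addr0.
Qed.

Lemma boundary_identity (g f r Q P rh : R) (W u : V) :
  1 < g -> P = r `^ g -> Q = g / (g - 1) * r `^ (g - 1) ->
  f * energy g rh u - dotv (f *: W) (rh *: u) +
  f * (2^-1 * dotv W W - Q) * rh + f * P = f * relative_energy g r W rh u.
Proof.
move=> g1 -> ->; rewrite relative_energyE /potential_energy /energy.
have -> : dotv (f *: W) (rh *: u) = f * rh * dotv W u.
  by rewrite /dotv mulr_sumr; apply: eq_bigr => i _; rewrite !mxE; ring.
have -> : \sum_i (u 0 i - W 0 i) * (u 0 i - W 0 i) = dotv u u - 2 * dotv W u + dotv W W.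
  rewrite /dotv mulr_sumr -sumrB -big_split/=.
  by apply: eq_bigr => i _; ring.
have : g - 1 != 0 by rewrite subr_eq0 gt_eqF.
by move=> ?; field.
Qed.

(** The combination of the energy inequality with the momentum and mass
    equations. The comparison field [W] need not solve the momentum equation;
    the defect is kept in [dissipation]. The integrand is replaced by a version
    [G] because the algebraic identity needs [0 <= rh], which holds only almost
    everywhere. *)
Lemma relative_energy_ineq (g t M : R) (phi r P Q rh : X -> R) (W u : X -> V)
    (rho0 : V -> R) (u0 : V -> V) :
  1 < g -> 0 <= M -> 0 < t < T ->
  C1_strip T phi -> C1_strip T W -> C1_strip T P -> C1_strip T Q ->
  (forall z, strip T z -> M < `|z.1| -> phi z = 0) ->
  (forall z, strip T z -> P z = r z `^ g /\ Q z = g / (g - 1) * r z `^ (g - 1)) ->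
  (forall z, open_strip t z -> phi z != 0 ->
    dt Q z + \sum_j W z 0 j * dx j Q z = - g * r z `^ (g - 1) * divx W z /\
    dt P z + \sum_j W z 0 j * dx j P z = - g * r z `^ g * divx W z) ->
  {ae lebesgue_spacetime, forall z, open_strip T z -> 0 <= rh z} ->
  weak_mass t (fun z => phi z * (2^-1 * dotv (W z) (W z) - Q z)) rh u rho0 ->
  weak_momentum g t (fun z => phi z *: W z) rh u rho0 u0 ->
  local_energy_ineq g t phi rh u rho0 u0 ->
  let F z := dt phi z * relative_energy g (r z) (W z) (rh z) (u z) +
    dotv (grad phi z) (relative_flux g (r z) (W z) (rh z) (u z)) +
    phi z * dissipation g r W Q rh u z in
  let A x := phi (x, t) * relative_energy g (r (x, t)) (W (x, t)) (rh (x, t)) (u (x, t)) -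
    phi (x, 0) * relative_energy g (r (x, 0)) (W (x, 0)) (rho0 x) (u0 x) in
  exists G : X -> R, [/\ lebesgue_spacetime.-integrable (open_strip t) (EFin \o G),
    {ae lebesgue_spacetime, forall z, open_strip t z -> G z = F z},
    (lebesgue_rV d).-integrable setT (EFin \o A) &
    \int[lebesgue_rV d]_x A x <= \int[lebesgue_spacetime]_(z in open_strip t) G z].
Proof.
move=> g1 M0 /andP[t0 tT] Cphi CW CP CQ phi0 PQ tr rh0 [im1 im2 im3] [iv1 iv2 iv3] [ie1 ie2 ie3 ie4] F A.
have tT' : 0 < t < T by rewrite t0.
pose D : set mX := open_strip t.
have DT z : D z -> open_strip T z by rewrite /D/open_strip/= => /andP[-> /lt_trans]; exact.
have mD : measurable D by exact: measurable_open_strip.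
have CphiP : C1_strip T (fun z => phi z * P z) by exact: C1_stripM.
have CphiPW i : C1_strip T (fun z => phi z * (P z * W z 0 i)).
  by apply: C1_stripM => //; apply: C1_stripM => //; exact: C1_strip_coord.
have sP z : strip T z -> M < `|z.1| -> phi z * P z = 0.
  by move=> Tz zM; rewrite phi0// mul0r.
have sPW i z : strip T z -> M < `|z.1| -> phi z * (P z * W z 0 i) = 0.
  by move=> Tz zM; rewrite phi0// mul0r.
pose psi z := phi z * (2^-1 * dotv (W z) (W z) - Q z).
pose zeta z := phi z *: W z.
pose G z := energy_integrand g phi rh u z - momentum_integrand g zeta rh u z +
  mass_integrand psi rh u z + dt (fun z => phi z * P z) z +
  \sum_i dx i (fun z => phi z * (P z * W z 0 i)) z.
have [j1 E1] := RintegralBB mD ie3 iv1.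
have [j2 E2] := RintegralDD mD j1 im1.
have iphiP := integrable_derive (0, 1) CphiP (ltW tT) sP.
have [j3 E3] := RintegralDD mD j2 iphiP.
have H4 i : lebesgue_spacetime.-integrable D (EFin \o dx i (fun z => phi z * (P z * W z 0 i))) /\
    \int[lebesgue_spacetime]_(z in D) dx i (fun z => phi z * (P z * W z 0 i)) z = 0.
  split; first exact: (integrable_derive ('e_i, 0) (CphiPW i) (ltW tT) (sPW i)).
  by apply: (integral_dx T_ge0 (M := M)) => //; [exact: ltW|exact: sPW].
have [j4 E4] := @Rintegral_sum0 _ _ lebesgue_spacetime D _ (index_enum 'I_d)
  (fun i z => dx i (fun z => phi z * (P z * W z 0 i)) z) mD H4.
have [j5 E5] := RintegralDD mD j3 j4.
pose Etau := energy_slice g (fun x => phi (x, t)) (fun x => rh (x, t)) (fun x => u (x, t)).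
pose E0 := energy_slice g (fun x => phi (x, 0)) rho0 u0.
pose mb := momentum_boundary t zeta rh u rho0 u0.
pose qb := mass_boundary t psi rh rho0.
pose PP x := phi (x, t) * P (x, t) - phi (x, 0) * P (x, 0).
have ts x : strip T ((x, t) : X) by rewrite /strip/= (ltW t0) ltW.
have t0s x : strip T ((x, 0) : X) by rewrite /strip/= lexx.
have AE x : A x = Etau x - E0 x + mb x - qb x + PP x.
  have [EPt EQt] := PQ _ (ts x); have [EP0 EQ0] := PQ _ (t0s x).
  rewrite /A -(boundary_identity _ _ _ _ g1 EPt EQt) -(boundary_identity _ _ _ _ g1 EP0 EQ0).
  rewrite /Etau /E0 /mb /qb /PP /energy_slice /momentum_boundary /mass_boundary /psi /zeta.
  ring.
have iPP t' : 0 <= t' <= T -> (lebesgue_rV d).-integrable setT (EFin \o (fun x => phi (x, t') * P (x, t'))).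
  move=> t'T; apply: (cont_slice_integrable (f := fun z => phi z * P z) (M := M) T_ge0 t'T) => //.
  exact: C1_strip_continuous.
have [k1 F1] := RintegralBB measurableT ie1 ie2.
have [k2 F2] := RintegralDD measurableT k1 iv2.
have [k3 F3] := RintegralBB measurableT k2 im2.
have [k4 F4] := RintegralBB measurableT (iPP t (ts 0)) (iPP 0 (t0s 0)).
have [k5' F5] := RintegralDD measurableT k3 k4.
have k5 : (lebesgue_rV d).-integrable setT (EFin \o A).
  by apply: eq_integrable k5' => // x _; rewrite /= AE.
exists G; split.
- exact: j5.
- apply: ae_imp rh0 => z rh0 Dz; have Tz := DT _ Dz.
  have [_ dphi _] := Cphi; have [_ dW _] := CW; have [_ dQ _] := CQ; have [_ dP _] := CP.
  have [_ dz _] := C1_stripZv T_ge0 Cphi CW.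
  have [EP EQ] := PQ _ (open_strip_strip Tz).
  by apply: integrand_identity => //; auto.
- exact: k5.
have E6 := integral_dt T_ge0 M0 tT' CphiP sP.
have -> : \int[lebesgue_rV d]_x A x = \int[lebesgue_rV d]_x (Etau x - E0 x + mb x - qb x + PP x).
  by apply: eq_Rintegral => x _; rewrite AE.
rewrite F5 F3 F2 F1 E5 E4 E3 E2 E1 /dt -/D.
move: im3 iv3 ie4 E6; rewrite -/psi -/zeta -/Etau -/E0 -/mb -/qb -/PP -/D /dt.
set a1 := Rintegral _ _ _; set a2 := Rintegral _ _ _; set a3 := Rintegral _ _ _.
set a4 := Rintegral _ _ _; set a5 := Rintegral _ _ _; set a6 := Rintegral _ _ _.
set a7 := Rintegral _ _ _; set a8 := Rintegral _ _ _; set a9 := Rintegral _ _ _.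
clearbody a1 a2 a3 a4 a5 a6 a7 a8 a9 => h1 h2 h3 h4.
by clear -h1 h2 h3 h4; lra.
Qed.

End integrated.

(** * Real powers of nonnegative C^1 functions *)

Section powers.
Context {R : realType}.
Implicit Types (p q x y : R).

(** The power of the positive part: unlike the real power it is C^1 on the whole
    line for every exponent above 1. *)
Definition ppow p x : R := Num.max x 0 `^ p.

Lemma ppow_ge0 p x : 0 <= x -> ppow p x = x `^ p.
Proof. by move=> x0; rewrite /ppow max_l. Qed.

Lemma ppow_le0 p x : 0 < p -> x <= 0 -> ppow p x = 0.
Proof. by move=> p0 x0; rewrite /ppow max_r// powR0// gt_eqF. Qed.

Lemma ppow_small p e : 0 < p -> 0 < e -> \forall y \near (0:R), ppow p y <= e.
Proof.
move=> p0 e0; have d0 : 0 < e `^ p^-1 by rewrite powR_gt0.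
near=> y; have [y0|y0] := leP y 0; first by rewrite ppow_le0// ltW.
rewrite ppow_ge0 ?(ltW y0)//.
have ye : y <= e `^ p^-1 by apply: ltW; near: y; exact: lt_nbhsl.
rewrite (le_trans (ge0_ler_powR (ltW p0) _ _ ye)) ?nnegrE ?(ltW y0) ?powR_ge0//.
by rewrite -powRrM mulVf ?gt_eqF// powRr1// ltW.
Unshelve. all: by end_near. Qed.

Lemma is_derive0_small (f : R -> R) x :
  (forall e, 0 < e -> \forall y \near x, `|f y - f x| <= e * `|y - x|) ->
  is_derive x (1:R) f 0.
Proof.
move=> H.
have C : (fun h : R => h^-1 *: (f (h *: (1:R) + x) - f x)) @ (0:R)^' --> (0:R).
  apply/cvgrPdist_le => e e0; have := H e e0.
  rewrite (near_shift 0 x) subr0 /= => He.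
  near=> h; have h0 : 0 < `|h|.
    by rewrite normr_gt0; near: h; exact: nbhs_dnbhs_neq.
  rewrite sub0r normrN normrM normfV ler_pdivrMl// mulrC.
  rewrite [h *: 1]mulr1.
  have : `|f (h + x) - f x| <= e * `|h + x - x|.
    by near: h; apply: nbhs_dnbhs; exact: He.
  by rewrite addrK.
apply: DeriveDef; first by apply/cvg_ex; exists 0.
by rewrite /derive; apply: cvg_lim.
Unshelve. all: by end_near. Qed.

Lemma is_derive_ppow p x : 1 < p -> is_derive x (1:R) (ppow p) (p * ppow (p - 1) x).
Proof.
move=> p1; have p0 : 0 < p by rewrite (lt_trans _ p1).
have p10 : 0 < p - 1 by rewrite subr_gt0.
have [x0|x0|x0] := ltgtP x 0.
- rewrite ppow_le0 ?(ltW x0)// mulr0.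
  apply: is_derive0_small => e e0; near=> y.
  have y0 : y < 0 by near: y; exact: lt_nbhsl.
  by rewrite !ppow_le0 ?(ltW x0) ?(ltW y0)// subrr normr0 mulr_ge0// ltW.
- rewrite ppow_ge0 ?(ltW x0)//.
  apply: near_eq_is_derive (is_derive1_powR p x0).
  near=> y; rewrite ppow_ge0//; apply: ltW; near: y; exact: lt_nbhsr.
- rewrite x0 ppow_le0// mulr0.
  apply: is_derive0_small => e e0; rewrite (ppow_le0 p0)//.
  near=> y; rewrite !subr0.
  have [y0|y0] := leP y 0; first by rewrite ppow_le0// normr0 mulr_ge0// ltW.
  rewrite ppow_ge0 ?(ltW y0)// -mulr_powRB1 ?(ltW y0)//.
  rewrite normrM mulrC ler_wpM2r//.
  rewrite ger0_norm ?powR_ge0// -ppow_ge0 ?(ltW y0)//.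
  near: y; exact: ppow_small.
Unshelve. all: by end_near. Qed.

Lemma continuous_ppow p : 0 < p -> continuous (ppow p).
Proof.
move=> p0 x; have [x0|x0] := leP x 0; last first.
  have c : {for x, continuous (fun y : R => y `^ p)}.
    apply: differentiable_continuous; apply/derivable1_diffP.
    by have [] := is_derive1_powR p x0.
  rewrite /continuous_at ppow_ge0 ?(ltW x0)//.
  apply: cvg_trans c; apply: near_eq_cvg; near=> y.
  by rewrite ppow_ge0//; apply: ltW; near: y; exact: lt_nbhsr.
apply/cvgrPdist_le => e e0; rewrite ppow_le0//.
move: x0; rewrite le_eqVlt => /predU1P[->|x0].
  near=> y; rewrite sub0r normrN ger0_norm ?powR_ge0//; near: y.
  exact: ppow_small.
near=> y; rewrite ppow_le0 ?subrr ?normr0 ?(ltW e0)//.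
apply: ltW; near: y; exact: lt_nbhsl.
Unshelve. all: by end_near. Qed.

End powers.

Section powers_strip.
Context {R : realType} {d : nat} (T : R) (T_ge0 : 0 <= T).
Local Notation V := ('rV[R]_d).
Local Notation X := (V * R)%type.

Lemma C1_strip_powR (r : X -> R) p : C1_strip T r -> (forall z, strip T z -> 0 <= r z) ->
  (1 <= p \/ forall z, strip T z -> 0 < r z) ->
  C1_strip T (fun z => r z `^ p) /\
  forall z w, open_strip T z ->
    'D_w (fun z => r z `^ p) z = p * r z `^ (p - 1) * 'D_w r z.
Proof.
move=> Cr r0 H.
have [_ dr _] := Cr.
have [p1|p1|p1] := ltgtP 1 p; last first.
- have E z : strip T z -> r z = r z `^ p by move=> /r0 ?; rewrite -p1 powRr1.
  split; first by apply: (C1_strip_eq _ Cr) => z Tz; exact: E.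
  move=> z w Tz; rewrite -p1 subrr powRr0 !mul1r; apply: near_eq_derive.
  by apply: filterS (near_open_strip Tz) => y /open_strip_strip /E; rewrite -p1.
- have {H} H z : strip T z -> 0 < r z.
    by case: H => [|]; [rewrite leNgt p1|exact].
  split.
    apply: (C1_strip_chain (h := fun y => y `^ p) (h' := fun y => p * y `^ (p - 1)) T_ge0 Cr) => z /H rz.
    split; first exact: is_derive1_powR.
    apply: cvgM; first exact: cvg_cst.
    have c : {for r z, continuous (fun y : R => y `^ (p - 1))}.
      apply: differentiable_continuous; apply/derivable1_diffP.
      by have [] := is_derive1_powR (p - 1) rz.
    exact: c.
  move=> z w Tz; apply: (derive_chain (h := fun y => y `^ p) (h' := fun y => p * y `^ (p - 1))); first exact: dr.
  by apply: is_derive1_powR; apply: H; exact: open_strip_strip.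
- have E z : strip T z -> ppow p (r z) = r z `^ p by move=> /r0; exact: ppow_ge0.
  split.
    apply: (C1_strip_eq E).
    apply: (C1_strip_chain (h' := fun y => p * ppow (p - 1) y) T_ge0 Cr) => z _.
    split; first exact: is_derive_ppow.
    apply: cvgM; first exact: cvg_cst.
    by apply: continuous_ppow; rewrite subr_gt0.
  move=> z w Tz.
  rewrite -(ppow_ge0 (p - 1) (r0 _ (open_strip_strip Tz))).
  have H1 := is_derive_ppow (r z) p1.
  have H2 := derive_chain (h := ppow p) (h' := fun y => p * ppow (p - 1) y) w (dr _ Tz) H1.
  rewrite -[RHS]H2.
  apply: near_eq_derive.
  by apply: filterS (near_open_strip Tz) => y /open_strip_strip /E ->.
Qed.

Lemma derive_ge0_right (f : X -> R) z w : differentiable f z ->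
  (\forall s \near (0:R)^'+, f z <= f (s *: w + z)) -> 0 <= 'D_w f z.
Proof.
move=> df H; have dv : derivable f z w by exact: diff_derivable.
have C : (fun h : R => h^-1 *: (f (h *: w + z) - f z)) @ (0:R)^'+ --> 'D_w f z.
  by apply: cvg_dnbhs_at_right; exact: dv.
apply: (cvgr_to_ge C); near=> h.
apply: mulr_ge0; first by rewrite invr_ge0; apply: ltW; near: h; exact: nbhs_right_gt.
by rewrite subr_ge0; near: h.
Unshelve. all: by end_near. Qed.

Lemma derive_le0_right (f : X -> R) z w : differentiable f z ->
  (\forall s \near (0:R)^'+, f (s *: w + z) <= f z) -> 'D_w f z <= 0.
Proof.
move=> df H; rewrite -oppr_ge0 -deriveN; last exact: diff_derivable.
apply: derive_ge0_right; first exact: differentiableN.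
by apply: filterS H => s; rewrite lerN2.
Qed.

Lemma cvg_line (z w : X) : (fun s : R => s *: w + z) @ (0:R)^'+ --> z.
Proof.
apply: cvg_at_right_filter.
have : (fun s : R => s *: w + z) s @[s --> (0:R)] --> (0:R) *: w + z.
  by apply: cvgD; [apply: cvgZr_tmp; exact: cvg_id|exact: cvg_cst].
by rewrite scale0r add0r.
Qed.

(** An interior zero of a nonnegative function is a minimum. This is why the
    mass equation holds in the vacuum for every velocity field. *)
Lemma derive_at_min (r : X -> R) z w : (forall z, strip T z -> 0 <= r z) ->
  differentiable r z -> open_strip T z -> r z = 0 -> 'D_w r z = 0.
Proof.
move=> r0 dr Tz rz.
have H v : 0 <= 'D_v r z.
  apply: derive_ge0_right => //; rewrite rz.
  have N : nbhs z [set y | 0 <= r y].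
    by apply: filterS (near_open_strip Tz) => y /open_strip_strip /r0.
  exact: (@cvg_line z v _ N).
have := H (- w); rewrite !deriveE// linearN oppr_ge0 -deriveE// => H1.
by apply/eqP; rewrite eq_le H1 H.
Qed.

End powers_strip.

(** * Potential energy, Euclidean norm, equations of the fluid *)

Section scalar_facts.
Context {R : realType}.

(** The mean value theorem down to the left end point 0, where the real power
    need not be differentiable. *)
Lemma powR_MVT (g x y : R) : 1 < g -> 0 <= x -> x < y ->
  exists2 c, x < c < y & y `^ g - x `^ g = g * c `^ (g - 1) * (y - x).
Proof.
move=> g1 x0 xy.
have [||c] := @MVT _ (ppow g) (fun c => g * ppow (g - 1) c) x y xy.
- by move=> c _; exact: is_derive_ppow.
- apply: continuous_subspaceT; apply: continuous_ppow; exact: lt_trans g1.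
rewrite in_itv/= => /andP[xc cy] E; exists c; first by rewrite xc.
have c0 : 0 <= c by rewrite (le_trans x0)// ltW.
by move: E; rewrite !ppow_ge0// (le_trans c0)// ltW.
Qed.

(** Strict convexity of the power [g > 1], by the mean value theorem. *)
Lemma potential_energy_gt0 (g r rh : R) : 1 < g -> 0 <= r -> 0 <= rh -> r != rh ->
  0 < potential_energy g r rh.
Proof.
move=> g1 r0 rh0 rrh.
have g10 : 0 < g - 1 by rewrite subr_gt0.
have g0 : 0 < g by rewrite (lt_trans _ g1).
have Er : r `^ g = r * r `^ (g - 1) by rewrite mulr_powRB1.
have k0 : 0 < g / (g - 1) by rewrite divr_gt0.
have gn : g - 1 != 0 by rewrite gt_eqF.
have [lt|lt|e] := ltgtP r rh; last by rewrite e eqxx in rrh.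
- have [c /andP[rc _] E] := powR_MVT g1 r0 lt.
  have -> : potential_energy g r rh = g / (g - 1) * (c `^ (g - 1) - r `^ (g - 1)) * (rh - r).
    have {}E : rh `^ g = r `^ g + g * c `^ (g - 1) * (rh - r) by rewrite -E; ring.
    by rewrite /potential_energy E Er; field.
  have H : r `^ (g - 1) < c `^ (g - 1).
    by apply: (gt0_ltr_powR g10); rewrite ?nnegrE// (le_trans r0)// ltW.
  by apply: mulr_gt0; [apply: mulr_gt0 => //|]; rewrite subr_gt0.
- have [c /andP[rc cr] E] := powR_MVT g1 rh0 lt.
  have -> : potential_energy g r rh = g / (g - 1) * (r `^ (g - 1) - c `^ (g - 1)) * (r - rh).
    have {}E : rh `^ g = r `^ g - g * c `^ (g - 1) * (r - rh) by rewrite -E; ring.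
    by rewrite /potential_energy E Er; field.
  have H : c `^ (g - 1) < r `^ (g - 1).
    by apply: (gt0_ltr_powR g10); rewrite ?nnegrE// (le_trans rh0)// ltW.
  by apply: mulr_gt0; [apply: mulr_gt0 => //|]; rewrite subr_gt0.
Qed.

Lemma potential_energy_diag (g r : R) : 1 < g -> 0 <= r -> potential_energy g r r = 0.
Proof.
move=> g1 r0; have Er : r * r `^ (g - 1) = r `^ g.
  by rewrite mulr_powRB1// (lt_trans _ g1).
have gn : g - 1 != 0 by rewrite gt_eqF// subr_gt0.
by rewrite /potential_energy -mulrA Er; field.
Qed.

Lemma potential_energy_ge0 (g r rh : R) : 1 < g -> 0 <= r -> 0 <= rh ->
  0 <= potential_energy g r rh.
Proof.
move=> g1 r0 rh0; have [->|ne] := eqVneq r rh; first by rewrite potential_energy_diag.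
exact: ltW (potential_energy_gt0 _ _ _ ne).
Qed.

End scalar_facts.

Section enorm_facts.
Context {R : realType} {d : nat}.
Implicit Types u w : 'rV[R]_d.

Lemma dotvC u w : dotv u w = dotv w u.
Proof. by apply: eq_bigr => i _; rewrite mulrC. Qed.

Lemma dotvD (a b : R) u w y : dotv (a *: u + b *: w) y = a * dotv u y + b * dotv w y.
Proof. by rewrite /dotv -sum_lin2; apply: eq_bigr => i _; rewrite !mxE; ring. Qed.

Lemma dotv_eq0 u : dotv u u = 0 -> u = 0.
Proof.
move=> /eqP; rewrite psumr_eq0; last by move=> i _; rewrite -expr2 sqr_ge0.
move=> /allP u0; apply/rowP => i; rewrite mxE.
by have := u0 i; rewrite mem_index_enum => /(_ isT)/=; rewrite -expr2 sqrf_eq0 => /eqP.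
Qed.

Lemma dotv0l u : dotv 0 u = 0.
Proof. by rewrite /dotv big1// => i _; rewrite mxE mul0r. Qed.

(** The squared norm of [dotv w w *: u - dotv u w *: w] is nonnegative. *)
Lemma cauchy_schwarz u w : `|dotv u w| <= enorm u * enorm w.
Proof.
rewrite -sqrtrM ?dotv_ge0// -sqrtr_sqr ler_sqrt ?mulr_ge0 ?dotv_ge0//.
have [c0|c0] := eqVneq (dotv w w) 0.
  by rewrite (dotv_eq0 c0) (dotvC u) !dotv0l expr0n mulr0.
have cp : 0 < dotv w w by rewrite lt_neqAle eq_sym c0 dotv_ge0.
have := dotv_ge0 (dotv w w *: u + (- dotv u w) *: w).
rewrite dotvD (dotvC u) dotvD (dotvC w (_ + _)) dotvD (dotvC w u).
have -> : dotv w w * (dotv w w * dotv u u + - dotv u w * dotv u w) +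
   - dotv u w * (dotv w w * dotv u w + - dotv u w * dotv w w) =
   dotv w w * (dotv u u * dotv w w - dotv u w ^+ 2) by ring.
by rewrite pmulr_rge0// subr_ge0.
Qed.

Lemma enormZ (a : R) u : enorm (a *: u) = `|a| * enorm u.
Proof.
rewrite /enorm -sqrtr_sqr -sqrtrM ?sqr_ge0//; congr Num.sqrt.
by rewrite /dotv mulr_sumr; apply: eq_bigr => i _; rewrite !mxE; ring.
Qed.

Lemma enormD u w : enorm (u + w) <= enorm u + enorm w.
Proof.
rewrite -[leRHS]ger0_norm ?addr_ge0 ?enorm_ge0// -sqrtr_sqr ler_sqrt ?sqr_ge0//.
rewrite sqrrD !sqr_enorm.
have -> : dotv (u + w) (u + w) = dotv u u + dotv u w *+ 2 + dotv w w.
  by rewrite /dotv -sumrMnl -!big_split/=; apply: eq_bigr => i _; rewrite !mxE; ring.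
rewrite lerD2r lerD2l lerMn2r/= (le_trans (ler_norm _))//.
exact: cauchy_schwarz.
Qed.

Lemma coord_le_enorm u i : `|u 0 i| <= enorm u.
Proof.
rewrite -sqrtr_sqr ler_sqrt ?dotv_ge0// /dotv (bigD1 i)//= -expr2 lerDl.
by apply: sumr_ge0 => j _; rewrite -expr2 sqr_ge0.
Qed.

Lemma norm_le_enorm u : `|u| <= enorm u.
Proof. by apply: normv_le => [|i]; [exact: enorm_ge0|exact: coord_le_enorm]. Qed.

Lemma convex_enorm (s v : R) u w : 0 <= s <= 1 -> enorm u <= v -> enorm w <= v ->
  enorm (u + s *: (w - u)) <= v.
Proof.
move=> /andP[s0 s1] uv wv.
have -> : u + s *: (w - u) = (1 - s) *: u + s *: w.
  by apply/rowP => i; rewrite !mxE; ring.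
rewrite (le_trans (enormD _ _))// !enormZ (ger0_norm s0) ger0_norm ?subr_ge0//.
rewrite (_ : v = (1 - s) * v + s * v); last by ring.
by rewrite lerD// ler_wpM2l// subr_ge0.
Qed.

End enorm_facts.

Section euler_facts.
Context {R : realType} {d : nat} (T : R) (T_ge0 : 0 <= T).
Local Notation V := ('rV[R]_d).
Local Notation X := (V * R)%type.
Variables (g : R) (r : X -> R) (U : X -> V).
Hypotheses (g1 : 1 < g) (S : C1_solution g T r U).
Hypothesis vac : 2 <= g \/ forall z, strip T z -> 0 < r z.

Let Q z := g / (g - 1) * r z `^ (g - 1).

Let P z := r z `^ g.

Let Cr : C1_strip T r. Proof. by have [] := S. Qed.
Let CU : C1_strip T U. Proof. by have [] := S. Qed.
Let r0 : forall z, strip T z -> 0 <= r z. Proof. by have [] := S. Qed.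

Lemma pressure_C1 : C1_strip T P /\ forall z w, open_strip T z ->
  'D_w P z = g * r z `^ (g - 1) * 'D_w r z.
Proof. by apply: C1_strip_powR => //; left; exact: ltW. Qed.

(** In the presence of vacuum the enthalpy inherits the regularity of the
    density when the exponent [g - 1] is at least 1; this is where the case
    distinction on the adiabatic exponent enters. *)
Lemma enthalpy_C1 : C1_strip T Q /\ forall z w, open_strip T z ->
  'D_w Q z = g * r z `^ (g - 1 - 1) * 'D_w r z.
Proof.
have [C D] : C1_strip T (fun z => r z `^ (g - 1)) /\ forall z w, open_strip T z ->
    'D_w (fun z => r z `^ (g - 1)) z = (g - 1) * r z `^ (g - 1 - 1) * 'D_w r z.
  apply: C1_strip_powR => //; case: vac => [g2|]; [left|by right].
  by rewrite lerBrDr (_ : 1 + 1 = 2)//; ring.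
split; first by apply: C1_stripM => //; exact: C1_strip_cst.
move=> z w Tz; have [_ dC _] := C.
rewrite /Q (@derive_mul _ _ (cst (g / (g - 1))))//; last exact: dC.
rewrite derive_cst mulr0 addr0 D// /cst/=.
have : g - 1 != 0 by rewrite gt_eqF// subr_gt0.
by move=> gn; field.
Qed.

Lemma density_transport z : open_strip T z ->
  dt r z + \sum_j U z 0 j * dx j r z = - (r z * divx U z).
Proof.
move=> Tz; have [_ dr _] := Cr; have [_ dU _] := CU.
have [_ drU _] := C1_stripZv T_ge0 Cr CU.
have := strong_mass S Tz; rewrite /divx.
under eq_bigr do rewrite /dx (derive_scale_coord _ _ (dr _ Tz) (dU _ Tz) (drU _ Tz)).
rewrite big_split/= -mulr_sumr => E.
by apply/eqP; rewrite -subr_eq0 opprK -addrA [X in _ + X]addrC E.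
Qed.

(** The momentum equation minus velocity times mass equation is the density
    times the acceleration; in the fluid the density can be cancelled. *)
Lemma fluid_accel z i : open_strip T z -> r z != 0 -> accel U Q z i = 0.
Proof.
move=> Tz rz; have [_ dr _] := Cr; have [_ dU _] := CU.
have CrU := C1_stripZv T_ge0 Cr CU.
have [_ drU _] := CrU.
have CrUj j := C1_stripM T_ge0 Cr (C1_strip_coord T_ge0 j CU).
have dd j : differentiable (fun y => r y * U y 0 j) z by have [_ + _] := CrUj j; exact.
have ddd j : differentiable (fun y => (r y * U y 0 j) *: U y) z.
  by have [_ + _] := C1_stripZv T_ge0 (CrUj j) CU; exact.
have := congr1 (fun u : V => u 0 i) (strong_momentum S Tz).
rewrite !mxE summxE.
rewrite /dt (derive_scale_coord _ _ (dr _ Tz) (dU _ Tz) (drU _ Tz)).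
under eq_bigr do rewrite /dx (derive_scale_coord _ _ (dd _) (dU _ Tz) (ddd _)).
have [_ DP] := pressure_C1; have [_ DQ] := enthalpy_C1.
rewrite big_split/= -mulr_sumr.
have Ediv : \sum_j 'D_('e_j, 0) (fun y : X => r y * U y 0 j) z = divx (fun y => r y *: U y) z.
  rewrite /divx /dx; apply: eq_bigr => j _.
  rewrite -derive_coord; last exact: drU.
  by rewrite (_ : (fun y : X => _) = (fun y => (r y *: U y) 0 j))//; apply/funext => y; rewrite mxE.
rewrite Ediv => E.
have E2 := strong_mass S Tz.
have Q1 : dx i Q z * r z = dx i (fun y => r y `^ g) z.
  rewrite /dx DQ// -/P DP// -(mulr_powRB1 (p := g - 1)) ?subr_gt0//; first ring.
  by apply: r0; exact: open_strip_strip.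
have -> : accel U Q z i = (r z)^-1 * (r z * 'D_(0, 1) U z 0 i +
   \sum_j r z * U z 0 j * 'D_('e_j, 0) U z 0 i + dx i (fun y => r y `^ g) z).
  rewrite -Q1 /accel /dt /dx.
  have -> : \sum_j r z * U z 0 j * 'D_('e_j, 0) U z 0 i =
     r z * \sum_j U z 0 j * 'D_('e_j, 0) U z 0 i.
    by rewrite mulr_sumr; apply: eq_bigr => j _; rewrite mulrA.
  by field.
apply/eqP; rewrite mulf_eq0; apply/orP; right; apply/eqP.
move: E E2; rewrite /dt; set a1 := r z * _; set a2 := \sum_j _; set a3 := divx _ _.
set a4 := dx i _ _; set a5 := 'D_(0, 1) r z => E E2.
have -> : a1 + a2 + a4 = - (U z 0 i * (a5 + a3)) + (a1 + U z 0 i * a5 + (a2 + U z 0 i * a3) + a4) by ring.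
by rewrite E2 mulr0 oppr0 add0r E.
Qed.

(** Pressure and enthalpy are functions of the density alone, so their transport
    equations follow from the mass equation for [(r, W)]. *)
Lemma comparison_transport (W : X -> V) z : open_strip T z ->
  dt r z + \sum_j W z 0 j * dx j r z = - (r z * divx W z) ->
  dt Q z + \sum_j W z 0 j * dx j Q z = - g * r z `^ (g - 1) * divx W z /\
  dt P z + \sum_j W z 0 j * dx j P z = - g * r z `^ g * divx W z.
Proof.
move=> Tz E; have [_ DP] := pressure_C1; have [_ DQ] := enthalpy_C1.
have rz := r0 (open_strip_strip Tz).
split.
  rewrite /dt DQ// /dx.
  transitivity (g * r z `^ (g - 1 - 1) * (dt r z + \sum_j W z 0 j * dx j r z)).
    rewrite mulrDr mulr_sumr; congr (_ + _); apply: eq_bigr => j _.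
    by rewrite DQ// /dx; ring.
  by rewrite E -[in RHS](mulr_powRB1 (p := g - 1)) ?subr_gt0//; ring.
rewrite /dt DP// /dx.
transitivity (g * r z `^ (g - 1) * (dt r z + \sum_j W z 0 j * dx j r z)).
  rewrite mulrDr mulr_sumr; congr (_ + _); apply: eq_bigr => j _.
  by rewrite DP// /dx; ring.
by rewrite E -[in RHS](mulr_powRB1 (p := g))// ?(lt_trans _ g1)//; ring.
Qed.

End euler_facts.

(** * A cutoff adapted to the speed of propagation *)

Section exp_time.
Context {R : realType} {d : nat} (T : R) (T_ge0 : 0 <= T).
Local Notation X := ('rV[R]_d * R)%type.

Lemma time_C1 z v : [/\ C1_strip T (fun z : X => z.2), differentiable (fun z : X => z.2) z &
   'D_v (fun z : X => z.2) z = v.2].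
Proof.
by have [? [? ?]] := C1_strip_linear T_ge0 (@linear_snd R d) (@continuous_snd R d).
Qed.

Lemma exp_time_C1 (K : R) : C1_strip T (fun z : X => expR (K * z.2)).
Proof.
have CC : C1_strip T (fun z : X => K * z.2).
  by apply: C1_stripM => //; [exact: C1_strip_cst|have [] := time_C1 0 0].
apply: (C1_strip_chain (h := expR) (h' := expR) T_ge0 CC) => z _.
by split; [exact: is_derive_expR|exact: continuous_expR].
Qed.

Lemma derive_exp_time (K : R) z v : differentiable (fun z : X => expR (K * z.2)) z /\
  'D_v (fun z : X => expR (K * z.2)) z = K * v.2 * expR (K * z.2).
Proof.
have [_ d2 D2] := time_C1 z v.
have d1 : differentiable (fun z : X => K * z.2) z.
  exact: (@differentiableM _ _ (cst K) _ z (differentiable_cst _ _) d2).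
split.
  apply: (@differentiable_comp _ _ _ _ (fun z : X => K * z.2) expR) => //.
  by apply/derivable1_diffP; exact: derivable_expR.
rewrite (derive_chain (h := expR) (h' := expR) v d1)//.
by rewrite (@derive_mul _ _ (cst K))// derive_cst mulr0 addr0 D2 /cst /= mulrC.
Qed.

End exp_time.

Section cutoff.
Context {R : realType} {d : nat} (T : R) (T_ge0 : 0 <= T).
Local Notation V := ('rV[R]_d).
Local Notation X := (V * R)%type.
Variables (K C eta w N : R).
Hypotheses (C_ge0 : 0 <= C) (w_gt0 : 0 < w).

(** A smooth approximation of the Euclidean norm from above, within distance
    [w]. *)
Definition smooth_norm (x : V) : R := Num.sqrt (dotv x x + w ^+ 2).

Lemma smooth_norm_gt0 x : 0 < smooth_norm x.
Proof. by rewrite sqrtr_gt0 ltr_wpDl ?dotv_ge0// exprn_gt0. Qed.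

Lemma enorm_le_smooth x : enorm x <= smooth_norm x.
Proof. by rewrite ler_sqrt ?lerDl ?sqr_ge0// addr_ge0 ?dotv_ge0 ?sqr_ge0. Qed.

Lemma smooth_le_enorm x : smooth_norm x <= enorm x + w.
Proof.
rewrite -[leRHS]ger0_norm ?addr_ge0 ?enorm_ge0 ?(ltW w_gt0)//.
rewrite -sqrtr_sqr ler_sqrt ?sqr_ge0// sqrrD sqr_enorm -addrA lerD2l lerDr.
by rewrite mulrn_wge0// mulr_ge0 ?enorm_ge0 ?ltW.
Qed.

Let sn (z : X) : R := smooth_norm z.1.

Lemma smooth_norm_C1 : C1_strip T sn /\
  forall z v, differentiable sn z /\ 'D_v sn z = (sn z)^-1 * \sum_i z.1 0 i * v.1 0 i.
Proof.
pose q (z : X) := \sum_i z.1 0 i * z.1 0 i + w ^+ 2.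
have cl i := @linear_fst_coord R d i.
have [l1 l2] : (forall i, C1_strip T (fun z : X => z.1 0 i)) /\
    forall i z v, differentiable (fun z : X => z.1 0 i) z /\ 'D_v (fun z : X => z.1 0 i) z = v.1 0 i.
  split=> [i|i z v];
    by have [? [? ?]] := C1_strip_linear T_ge0 (@linear_fst_coord R d i) (@continuous_fst_coord R d i).
have Cq : C1_strip T q.
  apply: (C1_stripD T_ge0); last exact: C1_strip_cst.
  apply: (C1_strip_sum T_ge0 _ (F := fun i (z : X) => z.1 0 i * z.1 0 i)) => i; exact: C1_stripM.
have qE : q = (fun z => (\sum_(i < d) (fun z : X => z.1 0 i * z.1 0 i)) z + w ^+ 2).
  by apply/funext => z; rewrite /q fct_sumE.
have dsum z : differentiable (\sum_(i < d) (fun z : X => z.1 0 i * z.1 0 i)) z.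
  by apply: differentiable_sum => i; apply: differentiableM; exact: (l2 i z z).1.
have dq z v : differentiable q z /\ 'D_v q z = 2 * \sum_i z.1 0 i * v.1 0 i.
  have d2 : differentiable (cst (w ^+ 2) : X -> R) z by exact: differentiable_cst.
  split; first by rewrite qE; exact: (differentiableD (dsum z) d2).
  rewrite qE (@derive_add _ _ _ (cst (w ^+ 2)))// derive_cst addr0.
  rewrite derive_sum; last first.
    by move=> i; apply: diff_derivable; apply: differentiableM; exact: (l2 i z z).1.
  rewrite mulr_sumr; apply: eq_bigr => i _.
  have [d1 e1] := l2 i z v.
  by rewrite derive_mul// e1; ring.
have q0 z : 0 < q z by rewrite ltr_wpDl ?exprn_gt0// dotv_ge0.
have dsq z : is_derive (q z) (1:R) Num.sqrt (2 * Num.sqrt (q z))^-1 by exact: is_derive1_sqrt.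
split.
  apply: (C1_strip_chain (h := Num.sqrt) (h' := fun y => (2 * Num.sqrt y)^-1) T_ge0 Cq) => z _.
  split; first exact: dsq.
  apply: cvgV; first by rewrite mulf_neq0// gt_eqF// sqrtr_gt0.
  apply: cvgM; first exact: cvg_cst.
  exact: sqrt_continuous.
move=> z v; have [dqz Eqz] := dq z v.
split.
  apply: (@differentiable_comp _ _ _ _ q Num.sqrt) => //.
  by apply/derivable1_diffP; have [] := dsq z.
rewrite (derive_chain (h := Num.sqrt) (h' := fun y => (2 * Num.sqrt y)^-1) v dqz (dsq z)) Eqz.
rewrite -/(sn z) invfM mulrACA mulVf ?mul1r//.
Qed.

Let a (z : X) := sn z - C * z.2 - (eta + w).
Let b (z : X) := N - sn z - C * z.2.

(** The squares of the positive parts make the function C^1; it lives between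
    the growing ball of radius about [eta + C t] and the shrinking ball of
    radius [N - C t]. The exponential factor provides damping at the rate [K].
    *)
Definition cutoff (z : X) : R := expR (- K * z.2) * (ppow 2 (a z) * ppow 2 (b z)).

Let lin_add (f : X -> R) (c1 c2 : R) z v : differentiable f z ->
  differentiable (fun z => f z + (c1 * z.2 + c2)) z /\
  'D_v (fun z => f z + (c1 * z.2 + c2)) z = 'D_v f z + c1 * v.2.
Proof.
move=> df; have [_ d2 D2] := time_C1 T_ge0 z v.
have d1 : differentiable (fun z : X => c1 * z.2) z.
  exact: (@differentiableM _ _ (cst c1) _ z (differentiable_cst _ _) d2).
have d3 : differentiable (fun z : X => c1 * z.2 + c2) z.
  exact: (@differentiableD _ _ _ _ (cst c2) z d1 (differentiable_cst _ _)).
split; first exact: differentiableD.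
rewrite derive_add//; congr (_ + _).
rewrite (@derive_add _ _ _ (cst c2))// derive_cst addr0.
by rewrite (@derive_mul _ _ (cst c1))// derive_cst mulr0 addr0 D2.
Qed.

Let aE : a = (fun z => sn z + ((- C) * z.2 + - (eta + w))).
Proof. by apply/funext => z; rewrite /a; ring. Qed.

Let bE : b = (fun z => (fun z => - sn z) z + ((- C) * z.2 + N)).
Proof. by apply/funext => z; rewrite /b; ring. Qed.

Let aD z v : differentiable a z /\ 'D_v a z = (sn z)^-1 * (\sum_i z.1 0 i * v.1 0 i) - C * v.2.
Proof.
have [_ /(_ z v) [ds Ds]] := smooth_norm_C1.
rewrite aE; have [? ->] := lin_add (- C) (- (eta + w)) v ds; split => //.
by rewrite Ds mulNr.
Qed.

Let bD z v : differentiable b z /\ 'D_v b z = - ((sn z)^-1 * (\sum_i z.1 0 i * v.1 0 i)) - C * v.2.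
Proof.
have [_ /(_ z v) [ds Ds]] := smooth_norm_C1.
have dns : differentiable (fun z => - sn z) z by exact: differentiableN.
rewrite bE; have [? ->] := lin_add (- C) N v dns; split => //.
rewrite deriveN; last exact: diff_derivable.
by rewrite Ds mulNr.
Qed.

Let hD (f : X -> R) z v : differentiable f z ->
  differentiable (fun z => ppow 2 (f z)) z /\
  'D_v (fun z => ppow 2 (f z)) z = 2 * ppow 1 (f z) * 'D_v f z.
Proof.
move=> df; have H := is_derive_ppow (f z) (ltr1n R 2).
have E1 : (2 - 1 : R) = 1 by ring.
rewrite E1 in H; split.
  apply: (@differentiable_comp _ _ _ _ f (ppow 2)) => //.
  by apply/derivable1_diffP; have [] := H.
exact: (derive_chain (h := ppow 2) (h' := fun y => 2 * ppow 1 y) v df H).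
Qed.

Lemma derive_cutoff z v : differentiable cutoff z /\
  'D_v cutoff z = - K * v.2 * cutoff z +
   expR (- K * z.2) * (2 * ppow 1 (a z) * ppow 2 (b z) *
     ((sn z)^-1 * (\sum_i z.1 0 i * v.1 0 i) - C * v.2) +
   ppow 2 (a z) * (2 * ppow 1 (b z)) *
     (- ((sn z)^-1 * (\sum_i z.1 0 i * v.1 0 i)) - C * v.2)).
Proof.
have [da Da] := aD z v; have [db Db] := bD z v; have [de De] := derive_exp_time T_ge0 (- K) z v.
have [dha Dha] := hD v da; have [dhb Dhb] := hD v db.
have dab := differentiableM dha dhb.
split; first exact: differentiableM.
rewrite /cutoff derive_mul// derive_mul// De Dha Dhb Da Db; ring.
Qed.

Lemma cutoff_C1 : C1_strip T cutoff.
Proof.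
have [Cs _] := smooth_norm_C1.
have Ct : C1_strip T (fun z : X => z.2) by have [] := time_C1 T_ge0 (d := d) 0 0.
have Cch f : C1_strip T f -> C1_strip T (fun z => ppow 2 (f z)).
  move=> Cf; apply: (C1_strip_chain (h' := fun y => 2 * ppow (2 - 1) y) T_ge0 Cf) => z _.
  split; first by apply: is_derive_ppow; rewrite ltr1n.
  apply: cvgM; first exact: cvg_cst.
  by apply: continuous_ppow; rewrite subr_gt0 ltr1n.
have CC (c : R) : C1_strip T (fun z : X => c * z.2).
  by apply: C1_stripM => //; exact: C1_strip_cst.
have CL (c k : R) : C1_strip T (fun z : X => c * z.2 + k).
  by apply: (C1_stripD T_ge0) => //; exact: C1_strip_cst.
apply: (C1_stripM T_ge0); first exact: exp_time_C1.
apply: (C1_stripM T_ge0); apply: Cch.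
  rewrite aE; exact: (C1_stripD T_ge0 Cs).
rewrite bE; exact: (C1_stripD T_ge0 (C1_stripN T_ge0 Cs)).
Qed.

Lemma cutoff_ge0 z : 0 <= cutoff z.
Proof. by rewrite mulr_ge0 ?expR_ge0// mulr_ge0 ?powR_ge0. Qed.

Lemma cutoff_neq0 z : cutoff z != 0 <-> eta + w + C * z.2 < sn z < N - C * z.2.
Proof.
have h0 x : ppow 2 x != 0 <-> 0 < x :> R.
  split=> [|x0]; first by apply: contra_neqT; rewrite -leNgt => x0; rewrite ppow_le0.
  by rewrite ppow_ge0 ?ltW// gt_eqF// powR_gt0.
rewrite /cutoff mulf_eq0 gt_eqF ?expR_gt0//= mulf_eq0 negb_or.
split=> [/andP[/h0 a0 /h0 b0]|/andP[a0 b0]].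
  by move: a0 b0; rewrite /a /b => a0 b0; apply/andP; split; lra.
by apply/andP; split; apply/h0; rewrite /a /b; lra.
Qed.

Lemma cutoff_support z : strip T z -> N < `|z.1| -> cutoff z = 0.
Proof.
move=> /andP[z0 zT] zN; apply/eqP/contraT => /cutoff_neq0/andP[_].
move=> H; have : `|z.1| <= sn z by rewrite (le_trans (norm_le_enorm _))// enorm_le_smooth.
have : 0 <= C * z.2 by rewrite mulr_ge0.
by move: H zN; rewrite /sn; lra.
Qed.

Lemma cutoff_C1c : C1c_strip T cutoff.
Proof.
split; first exact: cutoff_C1.
exists ([set x : V | `|x| <= `|N|] `*` `[0, T]%classic).
  apply: compact_setX; last exact: segment_compact.
  apply: bounded_closed_compact.
    by exists `|N|; split; [exact: num_real|move=> y Ny x /= xN; rewrite (le_trans xN)// ltW].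
  apply: (@closed_comp _ _ (fun x : V => `|x|) [set r : R | r <= `|N|]).
    by move=> x _; exact: norm_continuous.
  exact: closed_le.
move=> z Tz nz; apply: cutoff_support => //.
rewrite ltNge; apply/negP => zN; apply: nz; split => /=; last by rewrite in_itv.
by rewrite (le_trans zN)// ler_norm.
Qed.

(** Both boundaries of the support move into the support at speed [C], which is
    at least the ratio of flux to energy, and the gradient of [smooth_norm] has
    length at most 1. The damping makes Gronwall's lemma superfluous. *)
Lemma cutoff_transport z (A : R) (B : V) : 0 <= A -> enorm B <= C * A ->
  dt cutoff z * A + dotv (grad cutoff z) B <= - K * cutoff z * A.
Proof.
move=> A0 BA.
pose Xa := 2 * ppow 1 (a z) * ppow 2 (b z).
pose Xb := ppow 2 (a z) * (2 * ppow 1 (b z)).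
pose e := expR (- K * z.2).
have Xa0 : 0 <= Xa by rewrite !mulr_ge0 ?powR_ge0.
have Xb0 : 0 <= Xb by rewrite !mulr_ge0 ?powR_ge0.
have e0 : 0 <= e by exact: expR_ge0.
have s0 : 0 < sn z by exact: smooth_norm_gt0.
have Et : dt cutoff z = - K * cutoff z - C * (e * (Xa + Xb)).
  rewrite /dt (derive_cutoff z (0, 1)).2 /= big1; last by move=> i _; rewrite mxE mulr0.
  by rewrite -/Xa -/Xb -/e; ring.
have Ex i : dx i cutoff z = e * (Xa - Xb) * (sn z)^-1 * z.1 0 i.
  rewrite /dx (derive_cutoff z ('e_i, 0)).2 /=.
  have -> : \sum_j z.1 0 j * ('e_i : V) 0 j = z.1 0 i.
    rewrite (bigD1 i)//= big1 ?addr0; first by rewrite mxE !eqxx mulr1.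
    by move=> j ji; rewrite mxE eqxx (negPf ji) mulr0.
  by rewrite -/Xa -/Xb -/e; ring.
have -> : dotv (grad cutoff z) B = e * (Xa - Xb) * ((sn z)^-1 * dotv z.1 B).
  rewrite /dotv !mulr_sumr; apply: eq_bigr => i _; rewrite mxE Ex; ring.
have H : `|(sn z)^-1 * dotv z.1 B| <= C * A.
  rewrite normrM gtr0_norm ?invr_gt0// ler_pdivrMl//.
  rewrite (le_trans (cauchy_schwarz _ _))// ler_pM ?enorm_ge0//.
  exact: enorm_le_smooth.
move: H; rewrite ler_norml Et; set y := _^-1 * _ => /andP[y1 y2].
have : e * (Xa - Xb) * y <= e * (Xa + Xb) * (C * A).
  rewrite -!mulrA ler_wpM2l//.
  have h1 : Xa * y <= Xa * (C * A) by rewrite ler_wpM2l.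
  have h2 : Xb * (- y) <= Xb * (C * A) by rewrite ler_wpM2l// lerNl.
  by rewrite mulrBl mulrDl; lra.
by move=> h; lra.
Qed.

End cutoff.

(** * Gradient bounds, pull-backs, a maximum principle *)

Section bounds.
Context {R : realType} {d : nat} (T : R) (T_ge0 : 0 <= T).
Local Notation V := ('rV[R]_d).
Local Notation X := (V * R)%type.

(** Derivatives of a C^1 function extend continuously to the closed strip, hence
    are bounded on compact sets. *)
Lemma derive_bounded (f : X -> R) w M : C1_strip T f ->
  exists2 L, 0 <= L & forall z, open_strip T z -> `|z.1| <= M -> `|'D_w f z| <= L.
Proof.
move=> /(C1_stripP T_ge0)[_ _ /(_ w)[g cg Eg]].
have [L L0 LP] := cont_strip_bounded T_ge0 M cg.
by exists L => // z Tz zM; rewrite Eg//; apply: LP => //; exact: open_strip_strip.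
Qed.

Lemma slice_lipschitz (f : X -> R) M L s : 0 < s < T -> 0 <= L -> C1_strip T f ->
  (forall j z, open_strip T z -> `|z.1| <= M -> `|dx j f z| <= L) ->
  forall x y : V, `|x| <= M -> `|y| <= M ->
  `|f (x, s) - f (y, s)| <= d%:R * L * `|x - y|.
Proof.
move=> sT L0 Cf H x y xM yM.
have [_ df _] := Cf.
have E (a : R) : a *: ((x - y, 0) : X) + (y, s) = (a *: x + (1 - a) *: y, s).
  congr (_, _) => /=; first by apply/rowP => k; rewrite !mxE; ring.
  by rewrite (_ : a *: (0 : R) = 0) ?add0r//; exact: mulr0.
have O (a : R) : open_strip T (a *: ((x - y, 0) : X) + (y, s)) by rewrite E.
have [a _|a /andP[a0 a1]] := @MVT_line _ X f (x - y, 0) (y, s); first exact: df.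
rewrite -{1}(scale1r ((x - y, 0) : X)) E scale1r subrr scale0r addr0 => ->.
rewrite derive_expand; last exact: df.
rewrite /= scale0r addr0 (le_trans (ler_norm_sum _ _ _))//.
have -> : d%:R * L * `|x - y| = \sum_(j < d) L * `|x - y|.
  by rewrite sumr_const card_ord -mulrA mulr_natl.
apply: ler_sum => j _; rewrite normrM mulrC ler_pM//; last exact: norm_coord.
apply: H; first exact: O.
rewrite E /= (le_trans (ler_normD _ _))// !normrZ !ger0_norm ?subr_ge0//.
rewrite (_ : M = a * M + (1 - a) * M); last by ring.
by rewrite lerD// ler_wpM2l// subr_ge0.
Qed.

(** If the derivative of [r] were large compared with [e + K r] then, by uniform
    continuity of the derivative, [r] would become negative at distance [h =
    K^-1]. *)
Lemma gradient_nonneg (r : X -> R) i M e : C1_strip T r -> (forall z, strip T z -> 0 <= r z) ->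
  0 < e -> exists2 K, 0 <= K & forall z, open_strip T z -> `|z.1| <= M ->
    `|dx i r z| <= e + K * r z.
Proof.
move=> Cr r0 e0.
have [cr dr Dr] := (C1_stripP T_ge0 _).1 Cr.
have [g cg Eg] := Dr ('e_i, 0).
pose v : X := ('e_i, 0).
have [h h0 hP] : exists2 h : R, 0 < h & forall z s, strip T z -> `|z.1| <= M -> `|s| <= h ->
    `|g (s *: v + z) - g z| <= e.
  pose G := g \o clampt T.
  pose K : set X := [set x : V | `|x| <= `|M|] `*` `[0, T]%classic.
  have cK : compact K.
    apply: compact_setX; last exact: segment_compact.
    apply: bounded_closed_compact.
      by exists `|M|; split; [exact: num_real|move=> y Ny x /= xN; rewrite (le_trans xN)// ltW].
    apply: (@closed_comp _ _ (fun x : V => `|x|) [set r : R | r <= `|M|]).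
      by move=> x _; exact: norm_continuous.
    exact: closed_le.
  have := (compact_near_coveringP K).1 cK R (nbhs (0:R)) (fun s z => `|G (s *: v + z) - G z| <= e) _.
  case.
    move=> z _.
    have c1 : {for (z, (0:R)), continuous (G \o (fun zs : X * R => zs.2 *: v + zs.1))}.
      apply: continuous_comp; last exact: cg.
      apply: cvgD; last exact: cvg_fst.
      by apply: cvgZr_tmp; exact: cvg_snd.
    have c2 : {for (z, (0:R)), continuous (G \o (fun zs : X * R => zs.1))}.
      by apply: continuous_comp; [exact: cvg_fst|exact: cg].
    have c : (fun zs : X * R => G (zs.2 *: v + zs.1) - G zs.1) @ (z, (0:R)) --> G ((0:R) *: v + z) - G z.
      exact: (cvgB c1 c2).
    rewrite scale0r add0r subrr in c.
    have := (cvgr0Pnorm_le _).1 c e e0.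
    by apply; exact: nbhs_filter.
  move=> h /= h0 hP; exists (h / 2); first by rewrite divr_gt0.
  move=> z s Tz zM sh.
  have Os : strip T (s *: v + z).
    by move: Tz; rewrite /strip/= (_ : s *: (0:R) = 0) ?add0r//; exact: mulr0.
  have := hP s _ z; rewrite /G/= !clampt_id//; apply.
    by rewrite sub0r normrN (le_lt_trans sh)// ltr_pdivrMr// ltr_pMr// ltr1n.
  split => /=; first by rewrite (le_trans zM)// ler_norm.
  by rewrite in_itv.
exists h^-1; first by rewrite invr_ge0 ltW.
move=> z Tz zM.
have shz s : (s *: v + z).2 = z.2 by rewrite /= [s *: _]mulr0 add0r.
have Os s : open_strip T (s *: v + z) by rewrite /open_strip /mkset shz.
(* Step against the sign of the derivative, so that r decreases. *)
pose sg : R := - Num.sg (g z).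
have sg1 : `|sg| <= 1 by rewrite normrN normr_sg; case: (_ != _).
have [a _|a /andP[a0 a1]] := @MVT_line _ X r ((h * sg) *: v) z.
  by rewrite scalerA; apply: dr.
rewrite scalerA deriveE; last by apply: dr.
rewrite linearZ/= -deriveE; last by apply: dr.
rewrite Eg//; set p := g _ => E.
have pz : `|p - g z| <= e.
  apply: hP => //; first exact: open_strip_strip.
  rewrite normrM ger0_norm// normrM gtr0_norm// -[leRHS]mulr1 mulrCA ler_pM ?mulr_ge0 ?(ltW h0)//.
  by rewrite -[leRHS]mulr1 ler_pM.
have rp : 0 <= r ((h * sg) *: v + z) by apply: r0; exact: open_strip_strip.
have {E} E : r ((h * sg) *: v + z) = r z + h * sg * p.
  have -> : h * sg * p = r ((h * sg) *: v + z) - r z by rewrite E.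
  by ring.
rewrite /dx Eg// -/v.
have H : h * (- (sg * p)) <= r z by move: rp; rewrite E; lra.
have H2 : - (sg * p) <= h^-1 * r z by rewrite ler_pdivlMl.
have H3 : `|g z| - e <= - (sg * p).
  rewrite (_ : `|g z| = - (sg * g z)); last by rewrite mulNr opprK mulrC normrEsg mulrC.
  have : `|sg * (p - g z)| <= e by rewrite normrM -[e]mul1r ler_pM.
  by rewrite ler_norml mulrBr; lra.
by lra.
Qed.

End bounds.

Section pullback.
Context {R : realType} {d : nat} (T : R) (T_ge0 : 0 <= T).
Local Notation V := ('rV[R]_d).
Local Notation X := (V * R)%type.

(** The point at time [s] on the line through [z] with velocity [W z]: for the
    solution of the Burgers equation this is the foot of the characteristic. *)
Definition foot (s : R) (W : X -> V) (z : X) : X := (z.1 - (z.2 - s) *: W z, s).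

Variables (s : R) (W : X -> V).
Hypotheses (sT : 0 < s < T) (CW : C1_strip T W).

Let foot_open z : open_strip T (foot s W z). Proof. by []. Qed.

Let footE : foot s W = (fun z => (z.1 - (z.2 - s) *: W z, s)). Proof. by []. Qed.

Let C1 : C1_strip T (fun z : X => z.1 - (z.2 - s) *: W z).
Proof.
have Ct : C1_strip T (fun z : X => z.2 - s).
  have [? _] := C1_strip_linear T_ge0 (@linear_snd R d) (@continuous_snd R d).
  by apply: (C1_stripB T_ge0) => //; exact: C1_strip_cst.
apply: (C1_stripB T_ge0); last exact: C1_stripZv.
apply: (C1_strip_vec T_ge0) => i.
by have [? _] := C1_strip_linear T_ge0 (@linear_fst_coord R d i) (@continuous_fst_coord R d i).
Qed.

Let differentiable_foot z : open_strip T z -> differentiable (foot s W) z.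
Proof.
move=> Tz; have [_ dC _] := C1.
by apply: differentiable_pair; [exact: dC|exact: differentiable_cst].
Qed.

Let derive_foot z w : open_strip T z ->
  'D_w (fun z : X => z.1 - (z.2 - s) *: W z) z =
  w.1 - w.2 *: W z - (z.2 - s) *: 'D_w W z.
Proof.
move=> Tz; have [_ dC _] := C1; have [_ dW _] := CW.
have Ct : C1_strip T (fun z : X => z.2 - s).
  have [? _] := C1_strip_linear T_ge0 (@linear_snd R d) (@continuous_snd R d).
  by apply: (C1_stripB T_ge0) => //; exact: C1_strip_cst.
have [_ d2 D2] : [/\ C1_strip T (fun z : X => z.2), differentiable (fun z : X => z.2) z &
   'D_w (fun z : X => z.2) z = w.2].
  by have [? [? ?]] := C1_strip_linear T_ge0 (@linear_snd R d) (@continuous_snd R d).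
apply/rowP => i; rewrite -derive_coord; last exact: dC.
have [_ d1 D1] : [/\ C1_strip T (fun z : X => z.1 0 i), differentiable (fun z : X => z.1 0 i) z &
   'D_w (fun z : X => z.1 0 i) z = w.1 0 i].
  by have [? [? ?]] := C1_strip_linear T_ge0 (@linear_fst_coord R d i) (@continuous_fst_coord R d i).
have -> : (fun z : X => (z.1 - (z.2 - s) *: W z) 0 i) = (fun z => z.1 0 i - (z.2 - s) * W z 0 i).
  by apply/funext => y; rewrite !mxE.
have [_ dt2 _] := Ct; have dWi := differentiable_coordE i (dW _ Tz).
rewrite derive_sub//; last by apply: differentiableM => //; exact: dt2.
rewrite D1 derive_mul//; last exact: dt2.
rewrite (@derive_sub _ _ _ (cst s))//.
rewrite D2 derive_cst subr0 derive_coord; last exact: dW.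
by rewrite !mxE; ring.
Qed.

Lemma pullback_derive (f : X -> R) z w : C1_strip T f -> open_strip T z ->
  'D_w (fun z => f (foot s W z)) z = \sum_j dx j f (foot s W z) *
    (w.1 0 j - w.2 * W z 0 j - (z.2 - s) * ('D_w W z) 0 j).
Proof.
move=> [_ df _] Tz; have dY := differentiable_foot Tz.
have dfY := df _ (foot_open z).
have E : 'D_w (fun z => f (foot s W z)) z = 'D_('D_w (foot s W) z) f (foot s W z).
  rewrite deriveE; last exact: differentiable_comp.
  rewrite (@diff_comp _ _ _ _ (foot s W) f)//= deriveE//.
  by rewrite deriveE.
have [_ dC _] := C1.
have EY : 'D_w (foot s W) z = ('D_w (fun z : X => z.1 - (z.2 - s) *: W z) z, 0).
  rewrite (deriveE _ dY) (deriveE _ (dC _ Tz)).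
  rewrite footE diff_pair; [|exact: dC|exact: differentiable_cst].
  by rewrite diff_cst.
rewrite E EY derive_expand//= scale0r addr0 derive_foot//.
by apply: eq_bigr => j _; rewrite !mxE; exact: mulrC.
Qed.

Lemma pullback_C1 (f : X -> R) : C1_strip T f -> C1_strip T (fun z => f (foot s W z)).
Proof.
move=> Cf; have [cf df Df] := (C1_stripP T_ge0 _).1 Cf.
have cC := C1_strip_continuous T_ge0 C1.
have cW := C1_strip_continuous T_ge0 CW.
have cfoot : continuous (foot s W \o clampt T).
  move=> z; have c2 : (cst s : X -> R) y @[y --> z] --> s by exact: cvg_cst.
  exact: (cvg_pair (cC z) c2).
have cpull (g : X -> R) : continuous (g \o clampt T) -> continuous ((fun z => g (foot s W z)) \o clampt T).
  move=> cg; have -> : (fun z => g (foot s W z)) \o clampt T = (g \o clampt T) \o (foot s W \o clampt T).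
    by apply/funext => z; rewrite /= (clampt_id (open_strip_strip (foot_open (clampt T z)))).
  by move=> z; apply: continuous_comp; [exact: cfoot|exact: cg].
apply/(C1_stripP T_ge0); split.
- exact: cpull.
- by move=> z Tz; apply: differentiable_comp; [exact: differentiable_foot|exact: df].
- move=> w.
  have /choice[g gP] : forall j, exists g : X -> R, continuous (g \o clampt T) /\
      forall z, open_strip T z -> dx j f z = g z.
    by move=> j; have [g cg Eg] := Df ('e_j, 0); exists g.
  have [_ _ DW] := (C1_stripP T_ge0 _).1 CW.
  have [W' cW' EW'] := DW w.
  exists (fun z => \sum_j g j (foot s W z) *
    (w.1 0 j - w.2 * W z 0 j - (z.2 - s) * W' z 0 j)); last first.
    move=> z Tz; rewrite pullback_derive// -EW'//.
    by apply: eq_bigr => j _; rewrite (gP j).2.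
  have coordc (h : X -> V) j : continuous (h \o clampt T) -> continuous ((fun z => h z 0 j) \o clampt T).
    move=> ch z; apply: (@continuous_comp _ _ _ (h \o clampt T) (fun x : V => x 0 j)); first exact: ch.
    exact: coord_continuous.
  have cterm j : continuous ((fun z => g j (foot s W z) *
     (w.1 0 j - w.2 * W z 0 j - (z.2 - s) * W' z 0 j)) \o clampt T).
    move=> z; apply: cvgM; first exact: (cpull _ (gP j).1).
    apply: cvgB.
      apply: cvgB; first exact: cvg_cst.
      by apply: cvgM; [exact: cvg_cst|exact: (coordc _ j cW)].
    apply: cvgM; last exact: (coordc _ j cW').
    apply: cvgB; last exact: cvg_cst.
    by apply: (@continuous_comp _ _ _ (clampt T) snd); [exact: continuous_clampt|exact: cvg_snd].
  have : forall s0 : seq 'I_d, continuous ((fun z => \sum_(j <- s0) g j (foot s W z) *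
     (w.1 0 j - w.2 * W z 0 j - (z.2 - s) * W' z 0 j)) \o clampt T).
    elim=> [|j s0 IH] z.
      rewrite (_ : _ \o _ = cst 0); first exact: cvg_cst.
      by apply/funext => y /=; rewrite big_nil.
    rewrite (_ : _ \o _ = (fun y => (fun z => g j (foot s W z) *
     (w.1 0 j - w.2 * W z 0 j - (z.2 - s) * W' z 0 j)) (clampt T y) +
     (fun z => \sum_(j <- s0) g j (foot s W z) *
     (w.1 0 j - w.2 * W z 0 j - (z.2 - s) * W' z 0 j)) (clampt T y))).
      by apply: cvgD; [exact: cterm|exact: IH].
    by apply/funext => y /=; rewrite big_cons.
  exact.
Qed.

End pullback.

Section maximum_principle.
Context {R : realType} {d : nat} (T : R) (T_ge0 : 0 <= T).
Local Notation V := ('rV[R]_d).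
Local Notation X := (V * R)%type.

(** On the compact truncated cone whose lateral boundary moves outwards at speed
    [v >= |U|], the characteristics through a point stay in the cone for a short
    time afterwards. At a positive maximum before time [s] the derivative along
    [(U, 1)] would therefore be nonpositive. *)
Lemma maximum_principle (Th : X -> R) (U : X -> V) (N v s0 s : R) :
  0 < s0 -> s < T -> 0 <= N -> 0 <= v ->
  continuous (Th \o clampt T) ->
  (forall z, open_strip T z -> differentiable Th z) ->
  (forall z, open_strip T z -> `|U z| <= v) ->
  (forall x, `|x| <= N + v * s -> Th (x, s) <= 0) ->
  (forall z, s0 <= z.2 < s -> `|z.1| <= N + v * z.2 -> 0 < Th z -> 0 < 'D_(U z, 1) Th z) ->
  forall z, s0 <= z.2 <= s -> `|z.1| <= N + v * z.2 -> Th z <= 0.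
Proof.
move=> s00 sT N0 v0 cTh dTh Uv Ts H z0 z0t z0N.
rewrite leNgt; apply/negP => z0p.
pose G : set X := ([set x : V | `|x| <= N + v * s] `*` `[s0, s]%classic) `&`
  [set z : X | `|z.1| <= N + v * z.2].
have cG : compact G.
  apply: compact_closedI; last first.
    rewrite (_ : [set _ | _] = (fun z : X => `|z.1| - v * z.2) @^-1` [set r | r <= N]).
      apply: closed_comp; last exact: closed_le.
      move=> z _; apply: cvgB; first by apply: cvg_norm; exact: cvg_fst.
      by apply: cvgM; [exact: cvg_cst|exact: cvg_snd].
    by apply/seteqP; split => z /=; rewrite lerBlDr.
  apply: compact_setX; last exact: segment_compact.
  apply: bounded_closed_compact.
    by exists (N + v * s); split; [exact: num_real|move=> a Ma x /= xM; rewrite (le_trans xM)// ltW].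
  apply: (@closed_comp _ _ (fun x : V => `|x|) [set r : R | r <= N + v * s]).
    by move=> x _; exact: norm_continuous.
  exact: closed_le.
have GE z : G z <-> s0 <= z.2 <= s /\ `|z.1| <= N + v * z.2.
  split=> [[[/= zN]]|[zs zN]]; first by rewrite in_itv.
  split=> //=; split=> /=; last by rewrite in_itv.
  by rewrite (le_trans zN)// lerD2l ler_wpM2l//; case/andP: zs.
have G0 : G z0 by apply/GE.
have [c cG' cmax] := compact_EVT_max (ex_intro _ z0 G0) cG (continuous_subspaceT cTh).
have /GE[/andP[c0 cs] cN] := set_mem cG'.
have Gstrip z : G z -> open_strip T z.
  by move=> /GE[/andP[a b] _]; rewrite /open_strip/= (lt_le_trans s00 a) (le_lt_trans b).
have cmx z : G z -> Th z <= Th c.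
  move=> Gz; have := cmax z (mem_set Gz); rewrite /= !clampt_id//; apply: open_strip_strip; apply: Gstrip => //.
  exact: set_mem.
have cp : 0 < Th c by rewrite (lt_le_trans z0p)// cmx.
have [ces|cls] := eqVneq c.2 s.
  have := Ts c.1; rewrite -ces -surjective_pairing => /(_ cN); rewrite leNgt cp//.
have {cls} cls : c.2 < s by rewrite lt_neqAle cls.
have := H c; rewrite c0 cls => /(_ isT cN cp); rewrite ltNge => /negP; apply.
have Oc := Gstrip _ (set_mem cG').
apply: derive_le0_right; first exact: dTh.
near=> h.
have h0 : 0 < h by near: h; exact: nbhs_right_gt.
have hs : h <= s - c.2 by apply: ltW; near: h; apply: nbhs_right_lt; rewrite subr_gt0.
apply: cmx; apply/GE; rewrite /= [h *: 1]mulr1; split.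
  by apply/andP; split; lra.
rewrite (le_trans (ler_normD _ _))// normrZ gtr0_norm//.
have := Uv _ Oc => Uc; have : h * `|U c| <= h * v by rewrite ler_wpM2l// ltW.
by rewrite mulrDr; lra.
Unshelve. all: by end_near. Qed.

End maximum_principle.

(** * The strong velocity at the edge of the vacuum *)

Section vacuum_edge.
Context {R : realType} {d : nat} (T : R) (T_gt0 : 0 < T).
Local Notation V := ('rV[R]_d).
Local Notation X := (V * R)%type.
Variables (g v : R) (r : X -> R) (U : X -> V).
Hypotheses (g1 : 1 < g) (S : C1_solution g T r U).
Hypothesis vac : 2 <= g \/ forall z, strip T z -> 0 < r z.
Hypothesis Uv : forall z, open_strip T z -> `|U z| <= v.

Let Q z := g / (g - 1) * r z `^ (g - 1).

Let T_ge0 : 0 <= T. Proof. exact: ltW. Qed.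
Let Cr : C1_strip T r. Proof. by have [] := S. Qed.
Let CU : C1_strip T U. Proof. by have [] := S. Qed.
Let r0 : forall z, strip T z -> 0 <= r z. Proof. by have [] := S. Qed.

(** Uniform constants for the finitely many coordinates: the sum of the
    individual ones. *)
Lemma sup_family (A : Type) (P : A -> Prop) (h : 'I_d -> R -> A -> Prop) :
  (forall j K K' z, K <= K' -> P z -> h j K z -> h j K' z) ->
  (forall j, exists2 K, 0 <= K & forall z, P z -> h j K z) ->
  exists2 K, 0 <= K & forall j z, P z -> h j K z.
Proof.
move=> mono H; have /choice[K KP] : forall j, exists K, 0 <= K /\ forall z, P z -> h j K z.
  by move=> j; have [K ? ?] := H j; exists K.
exists (\sum_j K j); first by apply: sumr_ge0 => j _; exact: (KP j).1.
move=> j z Pz; apply: (mono j (K j)) => //; last exact: (KP j).2.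
by rewrite (bigD1 j)//= lerDl; apply: sumr_ge0 => k _; exact: (KP k).1.
Qed.

(** For [2 <= g] the enthalpy is a C^1 function of the density; if the density
    is positive everywhere, a bound on compact sets is enough. In both cases the
    estimate of [gradient_nonneg] passes to the enthalpy. *)
Lemma enthalpy_gradient M e : 0 < e -> exists2 K, 0 <= K &
  forall j z, open_strip T z /\ `|z.1| <= M -> `|dx j Q z| <= e + K * r z.
Proof.
move=> e0.
have [B B0 BP] : exists2 B, 0 <= B & forall z, strip T z -> `|z.1| <= M -> `|g * r z `^ (g - 1 - 1)| <= B.
  have g0 : 0 <= g by rewrite ltW// (lt_trans _ g1).
  case: vac => [g2|rp].
    have [B B0 BP] := cont_strip_bounded T_ge0 M (C1_strip_continuous T_ge0 Cr).
    exists (g * B `^ (g - 1 - 1)); first by rewrite mulr_ge0 ?powR_ge0.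
    move=> z Tz zM; rewrite ger0_norm ?mulr_ge0 ?powR_ge0// ler_wpM2l//.
    have := BP _ Tz zM; rewrite ger0_norm ?r0// => rB.
    by apply: ge0_ler_powR => //; rewrite ?nnegrE ?r0//; lra.
  have [C _] := C1_strip_powR (p := g - 1 - 1) T_ge0 Cr r0 (or_intror rp).
  have C2 : C1_strip T (fun z => g * r z `^ (g - 1 - 1)).
    by apply: C1_stripM => //; exact: C1_strip_cst.
  exact: (cont_strip_bounded T_ge0 M (C1_strip_continuous T_ge0 C2)).
have [_ DQ] := enthalpy_C1 T_ge0 g1 S vac.
apply: (sup_family (h := fun j K z => `|dx j Q z| <= e + K * r z)).
  move=> j K K' z KK [Tz _] h; rewrite (le_trans h)// lerD2l ler_wpM2r//.
  by apply: r0; exact: open_strip_strip.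
move=> j.
have eB : 0 < e / (B + 1) by rewrite divr_gt0// ltr_wpDl.
have [K K0 KP] := gradient_nonneg T_ge0 j M Cr r0 eB.
exists (B * K); first by rewrite mulr_ge0.
move=> z [Tz zM]; rewrite /dx DQ// normrM.
have rz := r0 (open_strip_strip Tz).
apply: (@le_trans _ _ (B * (e / (B + 1) + K * r z))).
  by apply: ler_pM => //; [apply: BP => //; exact: open_strip_strip|exact: KP].
rewrite -[B * K * _]mulrA mulrDr lerD2r mulrCA ger_pMr// ler_pdivrMr ?ltr_wpDl//.
by rewrite mul1r lerDl.
Qed.

Lemma jacobian_bound M : exists2 L, 0 <= L &
  forall j z, open_strip T z /\ `|z.1| <= M -> forall i, `|(dx j U z) 0 i| <= L.
Proof.
apply: (sup_family (h := fun j K z => forall i, `|(dx j U z) 0 i| <= K)).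
  by move=> j K K' z KK _ h i; rewrite (le_trans (h i)).
move=> j.
have [K K0 KP] : exists2 K, 0 <= K & forall i z, open_strip T z /\ `|z.1| <= M -> `|(dx j U z) 0 i| <= K.
  apply: (sup_family (h := fun i K z => `|(dx j U z) 0 i| <= K)).
    by move=> i K K' z KK _ h; rewrite (le_trans h).
  move=> i; have [L L0 LP] := derive_bounded T_ge0 ('e_j, 0) M (C1_strip_coord T_ge0 i CU).
  exists L => // z [Tz zM]; have [_ dU _] := CU.
  by rewrite /dx -derive_coord; [exact: LP|exact: dU].
by exists K => // z Pz i; exact: KP.
Qed.

Let acc z j : open_strip T z -> r z != 0 -> 'D_(U z, 1) U z 0 j = - dx j Q z.
Proof.
move=> Tz rz; have [_ dU _] := CU.
have := fluid_accel T_ge0 g1 S vac j Tz rz; rewrite /accel => E.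
rewrite derive_expand; last exact: dU.
rewrite mxE summxE.
under eq_bigr do rewrite mxE.
apply: (addIr (dx j Q z)); rewrite addNr -[RHS]E; congr (_ + _).
by rewrite scale1r; exact: addrC.
Qed.

(** The derivative of y (E G - c y) along the flow, when E grows at rate k + 1,
    G at rate at least - b y, and |D| <= k y: the last two are the rates found
    for the defect and for the density in [characteristic_defect]. *)
Lemma barrier_increasing (E G F D y a b c k : R) :
  0 <= E -> 0 < y -> 0 <= c -> E * b <= c -> - (a + b * y) <= F -> `|D| <= k * y ->
  0 < E * G - c * y ->
  0 < y * (E * (F + a) + G * ((k + 1) * E) - (c * D + y * 0)) + (E * G - c * y) * D.
Proof.
move=> E0 y0 c0 Eb Fab; rewrite ler_norml => /andP[D1 D2] Y0.
have h1 : - (E * b * y) <= E * (F + a) by rewrite -mulrA -mulrN ler_wpM2l//; lra.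
have h2 : E * b * y <= c * y by rewrite ler_wpM2r// ltW.
have h3 : c * y <= c * ((k + 1) * y - D) by rewrite ler_wpM2l//; lra.
have h4 : 0 < (E * G - c * y) * (D + (k + 1) * y) by rewrite mulr_gt0//; lra.
have h5 : 0 <= y * (c * ((k + 1) * y - D) + E * (F + a)) by apply: mulr_ge0; [exact: ltW|lra].
lra.
Qed.

(** The defect [f = U - U \o foot] vanishes at time [s], and its derivative
    along the flow is O(grad Q), hence at most [e' + K' r] in the fluid. The
    function Th = r (E (+-f - c1 e' (s - t)) - C2 r), where E is exponential in
    time, is a barrier: its derivative along the flow is positive where Th > 0,
    so Th <= 0 by the maximum principle. The factor [r] confines the argument to
    the fluid, the only place where the acceleration is known. *)
Lemma characteristic_defect s N e : 0 < s < T -> 0 <= N -> 0 <= v -> 0 < e ->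
  exists2 K, 0 <= K & forall i z, open_strip T z /\ z.2 <= s /\ `|z.1| <= N /\ r z != 0 ->
    `|U z 0 i - U (foot s U z) 0 i| <= e + K * r z.
Proof.
move=> sT N0 v0 e0; have /andP[s0 sT'] := sT.
pose M := N + 2 * (v * T).
have [L L0 LP] := jacobian_bound M.
pose c1 := 1 + T * L * d%:R.
have c10 : 0 < c1 by rewrite ltr_pwDl// !mulr_ge0.
(* The linear barrier c1 e' (s - t) is at most e. *)
pose e' := e / (c1 * T).
have e'0 : 0 < e' by rewrite divr_gt0// mulr_gt0.
have [K' K'0 KP'] := enthalpy_gradient M e'0.
pose K := L * d%:R + 1.
have K0 : 0 <= K by rewrite addr_ge0// mulr_ge0.
(* The weight C2 of the density in the barrier outweighs the growth of the exponential factor on the whole time interval. *)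
pose C2 := expR (K * T) * c1 * K'.
have C20 : 0 <= C2 by rewrite !mulr_ge0 ?expR_ge0// ltW.
exists C2 => // i z [Tz [zs [zN rz]]].
pose f z := U z 0 i - U (foot s U z) 0 i.
have CUi := C1_strip_coord T_ge0 i CU.
have Cf : C1_strip T f.
  by apply: C1_stripB => //; exact: (pullback_C1 T_ge0 sT CU CUi).
have [_ dU _] := CU; have [_ dr _] := Cr; have [_ df _] := Cf.
have vT0 : 0 <= v * T by rewrite mulr_ge0.
have inM y : open_strip T y -> y.2 <= s -> `|y.1| <= N + v * y.2 ->
    `|y.1| <= M /\ `|(foot s U y).1| <= M.
  move=> Ty ys yN.
  have y0 : 0 <= y.2 by case/andP: (Ty) => /ltW.
  have h1 : v * y.2 <= v * T by rewrite ler_wpM2l// (le_trans ys)// ltW.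
  split; first by rewrite /M; lra.
  rewrite /foot/= (le_trans (ler_normB _ _))// normrZ.
  have h2 : `|y.2 - s| * `|U y| <= T * v.
    rewrite ler_pM ?Uv// distrC ger0_norm ?subr_ge0//; lra.
  by rewrite /M; lra.
have Dfb y : open_strip T y -> y.2 <= s -> `|y.1| <= N + v * y.2 -> r y != 0 ->
    `|'D_(U y, 1) f y| <= c1 * (e' + K' * r y).
  move=> Ty ys yN ry; have [yM fM] := inM _ Ty ys yN.
  have q j := KP' j y (conj Ty yM).
  have q0 : 0 <= e' + K' * r y.
    by rewrite addr_ge0 ?(ltW e'0)// mulr_ge0// r0//; exact: open_strip_strip.
  rewrite /f derive_sub; [|apply: differentiable_coordE; exact: dU|]; last first.
    by have [_ + _] := pullback_C1 T_ge0 sT CU CUi; exact.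
  rewrite (pullback_derive T_ge0 sT CU _ CUi Ty) derive_coord; last exact: dU.
  rewrite acc//.
  under eq_bigr do rewrite /= mul1r subrr sub0r acc// -mulrN opprK.
  rewrite (le_trans (ler_normB _ _))// normrN /c1 mulrDl mul1r lerD//.
  rewrite (le_trans (ler_norm_sum _ _ _))//.
  have -> : T * L * d%:R * (e' + K' * r y) = \sum_(j < d) L * (T * (e' + K' * r y)).
    by rewrite sumr_const card_ord -mulr_natr; ring.
  apply: ler_sum => j _; rewrite normrM ler_pM//.
    have Of : open_strip T (foot s U y) by [].
    rewrite /dx derive_coord; last exact: dU.
    exact: LP.
  rewrite normrM ler_pM// distrC ger0_norm ?subr_ge0//.
  by case/andP: (Ty) => ? _; lra.
have Drb y : open_strip T y -> y.2 <= s -> `|y.1| <= N + v * y.2 ->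
    `|'D_(U y, 1) r y| <= L * d%:R * r y.
  move=> Ty ys yN; have [yM _] := inM _ Ty ys yN.
  rewrite derive_expand; last exact: dr.
  rewrite /= scale1r addrC.
  have := density_transport T_ge0 S Ty.
  rewrite (_ : \sum_(j < d) U y 0 j *: dx j r y = \sum_j U y 0 j * dx j r y)// => ->.
  have ry := r0 (open_strip_strip Ty).
  rewrite normrN normrM ger0_norm// mulrC ler_wpM2r//.
  rewrite (le_trans (ler_norm_sum _ _ _))//.
  have -> : L * d%:R = \sum_(j < d) L by rewrite sumr_const card_ord mulr_natr.
  by apply: ler_sum => j _; exact: LP.
have key (sg : R) : `|sg| <= 1 -> sg * f z <= e + C2 * r z.
  move=> sg1.
  pose G1 y := sg * f y - c1 * e' * (s - y.2).
  pose Th y := r y * (expR (K * y.2) * G1 y - C2 * r y).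
  have Ct : C1_strip T (fun y : X => y.2) by have [] := time_C1 T_ge0 (d := d) 0 0.
  have Ccst (a : R) : C1_strip T (fun _ : X => a) by exact: C1_strip_cst.
  have CE := exp_time_C1 T_ge0 (d := d) K.
  have CG1 : C1_strip T G1.
    by apply: (C1_stripB T_ge0); apply: C1_stripM => //; exact: C1_stripB.
  have CEG : C1_strip T (fun y => expR (K * y.2) * G1 y) by exact: C1_stripM.
  have CCr : C1_strip T (fun y => C2 * r y) by exact: C1_stripM.
  have CY : C1_strip T (fun y => expR (K * y.2) * G1 y - C2 * r y) by exact: C1_stripB.
  have CTh : C1_strip T Th by exact: C1_stripM.
  have [_ dTh _] := CTh.
  have Ez : Th z <= 0.
    have z20 : 0 < z.2 by case/andP: Tz.
    apply: (@maximum_principle _ _ T Th U N v z.2 s) => //.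
    - exact: C1_strip_continuous.
    - move=> x _; rewrite /Th /G1 subrr mulr0 subr0 /f /foot/= subrr scale0r subr0 subrr !mulr0 sub0r.
      have rx : 0 <= r (x, s) by apply: r0; rewrite /strip/=; apply/andP; split; lra.
      by rewrite mulrN oppr_le0; apply: mulr_ge0 => //; exact: mulr_ge0.
    - move=> y /andP[y0 ys] yN Thp.
      have Ty : open_strip T y by rewrite /open_strip/=; apply/andP; split; lra.
      have ry0 := r0 (open_strip_strip Ty).
      have ry : r y != 0 by apply: contraTneq Thp => ry; rewrite /Th ry mul0r ltxx.
      have ryp : 0 < r y by rewrite lt_neqAle eq_sym ry.
      have Yp : 0 < expR (K * y.2) * G1 y - C2 * r y by rewrite -(pmulr_rgt0 _ ryp).
      have [_ dG1 _] := CG1; have [_ dY _] := CY; have [_ dEG _] := CEG; have [_ dCr _] := CCr.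
      have [dE DE] := derive_exp_time T_ge0 (d := d) K y (U y, 1).
      have [_ dt2 Dt2] := time_C1 T_ge0 y (U y, 1).
      have DG1 : 'D_(U y, 1) G1 y = sg * 'D_(U y, 1) f y + c1 * e'.
        have d1 : differentiable (fun y => sg * f y) y.
          exact: (@differentiableM _ _ (cst sg) _ y (differentiable_cst _ _) (df _ Ty)).
        have d2 : differentiable (fun y : X => s - y.2) y.
          exact: (@differentiableB _ _ _ (cst s) _ y (differentiable_cst _ _) dt2).
        have d3 : differentiable (fun y : X => c1 * e' * (s - y.2)) y.
          exact: (@differentiableM _ _ (cst (c1 * e')) _ y (differentiable_cst _ _) d2).
        rewrite /G1 derive_sub// (@derive_mul _ _ (cst sg))//; last exact: df.
        rewrite (@derive_mul _ _ (cst (c1 * e')))//.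
        rewrite (@derive_sub _ _ (cst s))// !derive_cst Dt2 /cst/=; ring.
      rewrite /Th derive_mul//; [|exact: dr|exact: dY].
      rewrite derive_sub//; [|exact: dEG|exact: dCr].
      rewrite derive_mul//; last exact: dG1.
      rewrite (@derive_mul _ _ (cst C2))//; last exact: dr.
      rewrite derive_cst DE DG1 /cst/= mulr1.
      have := Drb _ Ty (ltW ys) yN; have := Dfb _ Ty (ltW ys) yN ry.
      set Dr := 'D_(_) r y; set Df := 'D_(_) f y => hDf hDr.
      have ET : expR (K * y.2) * (c1 * K') <= C2.
        rewrite /C2 -mulrA ler_wpM2r ?mulr_ge0 ?(ltW c10)// ler_expR ler_wpM2l//.
        by apply: ltW; exact: lt_trans ys sT'.
      apply: (barrier_increasing (k := L * d%:R) (b := c1 * K')) => //.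
      have : `|sg * Df| <= c1 * e' + c1 * K' * r y.
        by rewrite normrM -[leRHS]mul1r -[c1 * K' * _]mulrA -mulrDr ler_pM.
      by rewrite ler_norml => /andP[].
    - by rewrite lexx.
    - rewrite (le_trans zN)// lerDl mulr_ge0// ltW//.
  have rz0 : 0 < r z by rewrite lt_neqAle eq_sym rz r0//; exact: open_strip_strip.
  move: Ez; rewrite /Th pmulr_rle0// subr_le0 => Ez.
  have E1 : 1 <= expR (K * z.2).
    by rewrite -expR0 ler_expR mulr_ge0// ltW//; case/andP: Tz.
  have ce : c1 * e' * (s - z.2) <= e.
    have -> : c1 * e' = e / T by rewrite /e'; field; rewrite !gt_eqF.
    rewrite -mulrA ger_pMr// ler_pdivrMl// mulr1; case/andP: Tz => ? _; lra.
  have [G0|G0] := leP 0 (G1 z); last first.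
    have : 0 <= C2 * r z by rewrite mulr_ge0// ltW.
    by move: G0; rewrite /G1; lra.
  have : G1 z <= expR (K * z.2) * G1 z by rewrite ler_peMl.
  by move: Ez; rewrite /G1; lra.
rewrite ler_norml; apply/andP; split.
  by rewrite lerNl -mulN1r; apply: key; rewrite normrN normr1.
by rewrite -[leLHS]mul1r; apply: key; rewrite normr1.
Qed.

End vacuum_edge.

(** * Null sets in space-time *)

Section null_sets.
Context {R : realType} {d : nat} (T : R) (T_ge0 : 0 <= T).
Local Notation V := ('rV[R]_d).
Local Notation X := (V * R)%type.
Local Notation mX := (V * measurableTypeR R)%type.

(** The converse of [ae_slices] needs the exceptional set to be measurable. *)
Lemma ae_unslice (B : set mX) : measurable B ->
  {ae @lebesgue_measure R, forall t : R, lebesgue_rV d (ysection B t) = 0%E} ->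
  lebesgue_spacetime B = 0%E.
Proof.
move=> mB B0.
have mG := @measurable_fun_ysection _ _ _ (measurableTypeR R) R (@lam R d) B mB.
have -> : lebesgue_spacetime B = (\int[@lebesgue_measure R]_t `|(@lam R d \o ysection B) t|)%E.
  have -> : lebesgue_spacetime B =
    (\int[(@lam R d \x @lebesgue_measure R)%E]_z (\1_B z)%:E)%E.
    by rewrite integral_indic// setIT.
  rewrite fubini_tonelli2//; last by apply/measurable_EFinP.
  rewrite -/(fubini_G _ _) indic_fubini_tonelli_GE//.
  by apply: eq_integral => t _; rewrite gee0_abs//.
apply/(ae_eq_integral_abs (@lebesgue_measure R) measurableT mG).
by apply: ae_imp B0 => t + _.
Qed.

Let box (a : R) : set mX := @cube R d a `*` `[- a, a]%classic.

Let measurable_box' a : measurable (box a).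
Proof. by apply: measurableX; [exact: measurable_cube|exact: measurable_itv]. Qed.

Let box_fin a : (lebesgue_spacetime (box a) < +oo)%E.
Proof.
have -> : lebesgue_spacetime (box a) =
    (lebesgue_rV d (@cube R d a) * lebesgue_measure `[(- a)%R, a]%classic)%E.
  by apply: product_measure1E; [exact: measurable_cube|exact: measurable_itv].
rewrite lte_mul_pinfty//.
- rewrite ge0_fin_numE//; exact: lam_cube_fin.
- by rewrite lebesgue_measure_itv/=; case: ifP => _; rewrite ?ltry// -EFinD ltry.
Qed.

Let harm (n : nat) : R := n.+1%:R^-1.

Let harm_inj n m : harm n = harm m -> n = m.
Proof. by move/invr_inj/eqP; rewrite eqr_nat => /eqP[]. Qed.

Let harm01 n : 0 <= harm n <= 1.
Proof. by rewrite invr_ge0 ler0n invf_le1 ?ltr0n// ler1n. Qed.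

(** Infinitely many disjoint translates of the same bounded set fit into a
    larger bounded set only if the set is null. *)
Lemma disjoint_translates (B : set mX) (w : X) (a : R) (k : nat) : measurable B -> B `<=` box a ->
  (forall n m z, (k <= n)%N -> (k <= m)%N -> n != m -> B z -> ~ B (z + (harm n - harm m) *: w)) ->
  lebesgue_spacetime B = 0%E.
Proof.
move=> mB Ba H.
pose sh (n : nat) : mX -> mX := fun z => (z.1 + - (harm (k + n) *: w.1), z.2 + - (harm (k + n) * w.2)).
pose B_ n : set mX := sh n @^-1` B.
have mB_ n : measurable (B_ n).
  rewrite /B_ -[X in measurable X]setTI.
  exact: (@measurable_shift_prod R d).
have EB n : lebesgue_spacetime (B_ n) = lebesgue_spacetime B by exact: spacetime_shift.
have tB : trivIset setT B_.
  apply/trivIsetP => n m _ _ nm; rewrite -subset0 => z [Bn Bm].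
  apply: (H (k + n)%N (k + m)%N _ _ _ _ Bn); rewrite ?leq_addr// ?eqn_add2l//.
  move: Bm; rewrite /B_ /sh /=; congr B; congr (_, _) => /=.
    by rewrite -addrA; congr (_ + _); apply/rowP => i; rewrite !mxE; ring.
  rewrite -[_ *: w.2]/(_ * w.2); ring.
have sB n : B_ n `<=` box (a + `|w|).
  move=> z /Ba [/= z1 z2]; have [h0 h1] := andP (harm01 (k + n)).
  have hw (y : R) : `|y| <= `|w| -> `|harm (k + n) * y| <= `|w|.
    by move=> yw; rewrite normrM ger0_norm// -[leRHS]mul1r ler_pM.
  split=> [i|] /=; rewrite in_itv/=.
    have := z1 i; rewrite /= in_itv/= !mxE.
    have : `|w.1 0 i| <= `|w|.
      by rewrite (le_trans (norm_coord _ _))// [leRHS]/Num.norm/= le_max lexx.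
    by move/hw; rewrite ler_norml => /andP[? ?] /andP[? ?]; apply/andP; split; lra.
  move: z2; rewrite in_itv/=.
  have : `|w.2| <= `|w| by rewrite [leRHS]/Num.norm/= le_max lexx orbT.
  by move/hw; rewrite ler_norml => /andP[? ?] /andP[? ?]; apply/andP; split; lra.
have Bfin : lebesgue_spacetime B \is a fin_num.
  rewrite ge0_fin_numE//; apply: le_lt_trans (box_fin a).
  by apply: le_measure; rewrite ?inE.
have le n : (n%:R%:E * lebesgue_spacetime B <= lebesgue_spacetime (box (a + `|w|)))%E.
  have -> : (n%:R%:E * lebesgue_spacetime B = lebesgue_spacetime (\big[setU/set0]_(i < n) B_ i))%E.
    rewrite measure_bigsetU//.
    transitivity (\sum_(i < n) lebesgue_spacetime B)%E; last by apply: eq_bigr => i _; rewrite -[LHS](EB i).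
    by rewrite -(fineK Bfin) sumEFin sumr_const card_ord -EFinM mulr_natl.
  apply: le_measure; rewrite ?inE//; first exact: bigsetU_measurable.
  by move=> z; rewrite -bigcup_mkord => -[i _]; exact: sB.
have xfin : lebesgue_spacetime (box (a + `|w|)) \is a fin_num by rewrite ge0_fin_numE// box_fin.
apply/eqP; rewrite eq_le measure_ge0 andbT -(fineK Bfin) lee_fin.
rewrite leNgt; apply/negP => b0.
pose n := (Num.truncn (fine (lebesgue_spacetime (box (a + `|w|))) / fine (lebesgue_spacetime B))).+1.
have := le n; rewrite -(fineK Bfin) -(fineK xfin) -EFinM lee_fin leNgt => /negP; apply.
by rewrite -ltr_pdivrMr// truncnS_gt.
Qed.

(** At a zero of [f] with nonzero derivative along [w], the function has no
    other zero nearby on the line of direction [w]. The set of such points is a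
    countable union of sets [B k] whose small translates along [w] are disjoint
    from them. *)
Lemma null_critical (f : X -> R) (w : X) : C1_strip T f ->
  {ae lebesgue_spacetime, forall z, open_strip T z -> f z = 0 -> 'D_w f z = 0}.
Proof.
move=> Cf; have [cf df _] := (C1_stripP T_ge0 _).1 Cf.
pose F := f \o clampt T.
pose B (k : nat) : set mX := (open_strip T `&` (F @^-1` [set 0])) `&` (box k%:R `&`
  \bigcap_(n in [set n | (k <= n)%N]) \bigcap_(m in [set m | (k <= m)%N /\ n != m])
   ((fun z : mX => F (z + (harm n - harm m) *: w)) @^-1` (~` [set 0]))).
have mB k : measurable (B k).
  apply: measurableI.
    apply: measurableI; first exact: measurable_open_strip.
    apply: closed_measurable_st; apply: preimage_closed => //.
  apply: measurableI; first exact: measurable_box'.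
  apply: bigcap_measurable; first by exists k => /=.
  move=> n _; apply: bigcap_measurable; first by exists (n + k).+1 => /=; split; rewrite ?neq_ltn ?ltnS ?leq_addr // leqW // leq_addl.
  move=> m _; apply: open_measurable_st; apply: (@open_comp X R).
    move=> y _; apply: (@continuous_comp X X R (fun z : X => z + (harm n - harm m) *: w) F); last exact: cf.
    exact: (continuousD (@cvg_id _ (nbhs y)) (cvg_cst _)).
  exact: closed_openC.
have B0 k : lebesgue_spacetime (B k) = 0%E.
  apply: (disjoint_translates (mB k) (w := w) (a := k%:R) (k := k)).
    by move=> z [_ []].
  move=> n m z kn km nm [_ [_ Bz]] [[_ +] _].
  by have := Bz n kn m (conj km nm).
have Bn : (lebesgue_spacetime).-negligible (\bigcup_k B k).
  by apply: negligible_bigcup => k; exists (B k); split.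
apply: (negligibleS _ Bn).
move=> z /= nP.
have [Tz [fz Dz]] : open_strip T z /\ f z = 0 /\ 'D_w f z <> 0.
  apply: contrapT => H; apply: nP => Tz fz; apply: contrapT => Dz; exact: H.
have dv : derivable f z w by exact/diff_derivable/df.
have nz : \forall h \near 0^', F (z + h *: w) != 0.
  have n0 := cvgr_neq0 _ dv (introN eqP Dz).
  have nT : \forall h \near 0^', open_strip T (z + h *: w).
    have c0 : (fun h : R => z + h *: w) @ 0^' --> z.
      apply: cvg_trans (_ : (fun h : R => z + h *: w) @ nbhs 0 --> z).
        by apply: cvg_app; exact: nbhs_dnbhs.
      rewrite -[X in _ --> X]addr0 -(scale0r w).
      apply: cvgD; first exact: cvg_cst.
      by apply: cvgZr_tmp; exact: cvg_id.
    exact: c0 (near_open_strip Tz).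
  near=> h.
  have -> : F (z + h *: w) = f (h *: w + z).
    rewrite /F/= clampt_id; first by rewrite addrC.
    by apply: open_strip_strip; near: h; exact: nT.
  have : h^-1 *: (f (h *: w + z) - f z) != 0 by near: h; exact: n0.
  by rewrite fz subr0; apply: contraNN => /eqP ->; rewrite scaler0.
have [e /= e0 He] := nz.
pose k := (Num.truncn (Num.max `|z| e^-1)).+1.
have kz : `|z| <= k%:R.
  by apply: le_trans (ltW (truncnS_gt _)); rewrite le_max lexx.
have ke n : (k <= n)%N -> 0 < harm n < e.
  move=> kn; rewrite invr_gt0 ltr0n/= -[ltRHS]invrK ltf_pV2 ?posrE ?invr_gt0 ?ltr0n//.
  apply: lt_le_trans (_ : k%:R <= _); last by rewrite ler_nat ltnW.
  by apply: le_lt_trans (truncnS_gt _); rewrite le_max lexx orbT.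
exists k => //; split; first by split=> //=; rewrite /F/= clampt_id//; exact: open_strip_strip.
split.
  split=> [i|] /=; rewrite in_itv/= -ler_norml; apply: le_trans kz.
    by rewrite (le_trans (norm_coord _ _))// [leRHS]/Num.norm/= le_max lexx.
  by rewrite [leRHS]/Num.norm/= le_max lexx orbT.
move=> n kn m [km nm] /=; apply/eqP; apply: He => /=.
  have /andP[? ?] := ke _ kn; have /andP[? ?] := ke _ km.
  by rewrite sub0r normrN ltr_norml; apply/andP; split; lra.
by rewrite subr_eq0; apply: contra nm => /eqP/harm_inj ->.
Unshelve. all: by end_near. Qed.

End null_sets.

(** * Gluing two velocity fields *)

Section threshold_function.
Context {R : realType}.

(** Equal to 1 on the negative axis, of class C^1, and tending to 0 on the
    positive axis when [c] tends to 0. *)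
Definition threshold (c x : R) : R := c / (c + ppow 2 x).

Definition dthreshold (c x : R) : R := - (c * (2 * ppow 1 x) / (c + ppow 2 x) ^+ 2).

Lemma threshold_den (c x : R) : 0 < c -> 0 < c + ppow 2 x.
Proof. by move=> c0; rewrite ltr_pwDl// powR_ge0. Qed.

Lemma threshold01 (c x : R) : 0 < c -> 0 <= threshold c x <= 1.
Proof.
move=> c0; have q0 := threshold_den x c0.
rewrite /threshold divr_ge0 ?(ltW c0) ?(ltW q0)//= ler_pdivrMr// mul1r lerDl powR_ge0//.
Qed.

Lemma threshold_le0 (c x : R) : 0 < c -> x <= 0 -> threshold c x = 1.
Proof. by move=> c0 x0; rewrite /threshold ppow_le0// addr0 divff// gt_eqF. Qed.

Lemma is_derive_threshold (c x : R) : 0 < c ->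
  is_derive x (1:R) (threshold c) (dthreshold c x).
Proof.
move=> c0; have q0 := threshold_den x c0.
have d2 : is_derive x (1:R) (ppow 2) (2 * ppow 1 x).
  have := @is_derive_ppow R 2 x; rewrite (_ : 2 - 1 = 1)//; last by ring.
  by apply; rewrite ltr1n.
have d3 : is_derive x (1:R) (cst c \+ ppow 2) (0 + 2 * ppow 1 x) by exact: is_deriveD.
have qn0 : (cst c \+ ppow 2) x != 0 by rewrite /= gt_eqF.
have [dq Dq] := d3.
have d4 : is_derive x (1:R) (fun y => ((cst c \+ ppow 2) y)^-1)
    (- (c + ppow 2 x) ^- 2 *: (2 * ppow 1 x)).
  apply: DeriveDef; first exact: derivableV.
  by rewrite deriveV// Dq add0r.
have [dv Dv] := d4.
apply: DeriveDef; first exact: (derivableM (derivable_cst c x 1) dv).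
rewrite [LHS](deriveM (derivable_cst c x 1) dv) derive_cst scaler0 addr0 Dv.
rewrite /dthreshold -[_ *: _]/(c * (_ * _)) mulNr mulrN; congr (- _).
ring.
Qed.

Lemma continuous_dthreshold (c : R) : 0 < c -> continuous (dthreshold c).
Proof.
move=> c0 x; apply: cvgN; apply: cvgM.
  apply: cvgM; first exact: cvg_cst.
  apply: cvgM; first exact: cvg_cst.
  exact: continuous_ppow.
apply: cvgV; first by rewrite gt_eqF// exprn_gt0// threshold_den.
have : {for x, continuous (fun x : R => c + ppow 2 x)}.
  by apply: cvgD; [exact: cvg_cst|exact: continuous_ppow].
move=> cc; exact: (cvgM cc cc).
Qed.

(** The exponent 4 makes the threshold vary on the scale e^2, so that its
    derivative has order e^-2 there; the factor [a], at most [x + e ^+ 2],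
    compensates this, and the product is bounded by a multiple of the threshold,
    uniformly in [e]. *)
Lemma dthreshold_bound (e x a : R) : 0 < e -> `|a| <= x + e ^+ 2 ->
  `|dthreshold (e ^+ 4) x * (2 * a)| <= 8 * threshold (e ^+ 4) x.
Proof.
move=> e0 ax; have c0 : 0 < e ^+ 4 by exact: exprn_gt0.
have [x0|x0] := leP x 0.
  rewrite /dthreshold (ppow_le0 (p := 1))// !mulr0 mul0r oppr0 mul0r normr0.
  by rewrite mulr_ge0//; have /andP[] := threshold01 x c0.
have q0 := threshold_den x c0.
have E1 : ppow 1 x = x by rewrite ppow_ge0 ?ltW// powRr1 ?ltW.
have E2 : ppow 2 x = x ^+ 2 by rewrite ppow_ge0 ?ltW// powR_mulrn// ltW.
rewrite /dthreshold /threshold; rewrite E2 in q0 *; rewrite E1.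
rewrite normrM normrN (ger0_norm (x := _ / _)); last first.
  by rewrite divr_ge0 ?sqr_ge0// !mulr_ge0// ltW.
rewrite normrM ger0_norm// expr2 -/(GRing.inv _).
have -> : e ^+ 4 * (2 * x) / ((e ^+ 4 + x ^+ 2) * (e ^+ 4 + x ^+ 2)) * (2 * `|a|) =
  (e ^+ 4 / (e ^+ 4 + x ^+ 2)) * (4 * x * `|a| / (e ^+ 4 + x ^+ 2)).
  by field; rewrite gt_eqF.
rewrite [leRHS]mulrC; apply: ler_wpM2l; first by rewrite divr_ge0// ltW.
rewrite ler_pdivrMr//.
have e2 : e ^+ 4 = (e ^+ 2) ^+ 2 by rewrite -exprM.
rewrite e2; set E := e ^+ 2 in ax *.
have := sqr_ge0 (x - E); have : x * `|a| <= x * (x + E) by rewrite ler_pM2l.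
have := sqr_ge0 x; have := sqr_ge0 E; rewrite sqrrB !expr2 mulrDr; lra.
Qed.

Lemma norm_mul_le (x y m : R) : x ^+ 2 <= m -> y ^+ 2 <= m -> `|x * y| <= m.
Proof.
have := sqr_ge0 (x - y); have := sqr_ge0 (x + y).
by rewrite sqrrB sqrrD ler_norml => *; apply/andP; split; lra.
Qed.

End threshold_function.

Section threshold_field.
Context {R : realType} {d : nat} (T : R) (T_ge0 : 0 <= T).
Local Notation V := ('rV[R]_d).
Local Notation X := (V * R)%type.
Variables (r : X -> R) (U W : X -> V) (M e : R).
Hypotheses (Cr : C1_strip T r) (r0 : forall z, strip T z -> 0 <= r z).
Hypotheses (CU : C1_strip T U) (CW : C1_strip T W) (e0 : 0 < e).

Let D z := U z - W z.

Let p z := dotv (D z) (D z) - (M * r z + e ^+ 2).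

Let th z := threshold (e ^+ 4) (p z).

(** Equal to [U] where |U - W|^2 <= M r + e^2, and close to [W] where |U - W|^2
    is much larger. *)
Definition blend (z : X) : V := W z + th z *: (U z - W z).

Let c0 : 0 < e ^+ 4. Proof. exact: exprn_gt0. Qed.

Let CD : C1_strip T D. Proof. exact: C1_stripB. Qed.

Let Cp : C1_strip T p.
Proof.
apply: (C1_stripB T_ge0).
  by apply: (C1_strip_sum T_ge0 _ (F := fun i z => D z 0 i * D z 0 i)) => i; apply: (C1_stripM T_ge0); exact: C1_strip_coord.
apply: (C1_stripD T_ge0); last exact: C1_strip_cst.
by apply: (C1_stripM T_ge0) => //; exact: C1_strip_cst.
Qed.

Let Cth : C1_strip T th.
Proof.
apply: (C1_strip_chain (h := threshold (e ^+ 4)) (h' := dthreshold (e ^+ 4)) T_ge0 Cp) => z _.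
by split; [exact: is_derive_threshold|exact: continuous_dthreshold].
Qed.

Lemma blend_C1 : C1_strip T blend.
Proof. by apply: (C1_stripD T_ge0) => //; exact: C1_stripZv. Qed.

Lemma blend_enorm v z : enorm (U z) <= v -> enorm (W z) <= v -> enorm (blend z) <= v.
Proof. by move=> Uv Wv; apply: convex_enorm => //; exact: threshold01. Qed.

Lemma blend_id z : dotv (U z - W z) (U z - W z) <= M * r z + e ^+ 2 -> blend z = U z.
Proof.
move=> pz; rewrite /blend /th threshold_le0 ?scale1r ?subrKC// /p subr_le0//.
Qed.

Lemma blend_near z : open_strip T z ->
  dotv (U z - W z) (U z - W z) < M * r z + e ^+ 2 -> \forall y \near z, blend y = U y.
Proof.
move=> Tz pz; have [_ dp _] := Cp.
have pz0 : p z < 0 by rewrite subr_lt0.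
have pc : p y @[y --> z] --> p z := differentiable_continuous (dp _ Tz).
near=> y; apply: blend_id; rewrite -subr_le0 -/(p y); apply: ltW; near: y.
exact: cvgr_lt pc _ pz0.
Unshelve. all: by end_near. Qed.

Lemma blend_vacuum z i : r z = 0 ->
  `|blend z 0 i - W z 0 i| <= threshold (e ^+ 4) (dotv (D z) (D z) - e ^+ 2) * `|D z 0 i|.
Proof.
move=> rz; rewrite /blend !mxE [X in `|X|]addrC addKr normrM /th /p rz mulr0 add0r.
rewrite ger0_norm //.
by have /andP[] := threshold01 (dotv (D z) (D z) - e ^+ 2) c0.
Qed.

(** In the vacuum the gradient of [r] vanishes, so only the derivative of |U -
    W|^2 differentiates the threshold; the factor |U - W|^2 gained in this way
    is absorbed by [dthreshold_bound]. No inverse power of [e] appears. *)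
Lemma blend_vacuum_derive z w i : open_strip T z -> r z = 0 ->
  `|('D_w blend z) 0 i - ('D_w W z) 0 i| <=
  9 * threshold (e ^+ 4) (dotv (D z) (D z) - e ^+ 2) * \sum_j `|('D_w D z) 0 j|.
Proof.
move=> Tz rz; have [_ dr _] := Cr; have [_ dD _] := CD; have [_ dp _] := Cp.
have [_ dW _] := CW; have [_ dth _] := Cth; have [_ db _] := blend_C1.
have Dr := derive_at_min w r0 (dr _ Tz) Tz rz.
have dDi := differentiable_coordE i (dD _ Tz).
have Dp : 'D_w p z = 2 * \sum_j D z 0 j * ('D_w D z) 0 j.
  rewrite derive_sub.
  - rewrite derive_dotv; last exact: dD.
    have dMr : differentiable (fun z => M * r z) z.
      exact: (@differentiableM _ _ (cst M) _ z (differentiable_cst _ _) (dr _ Tz)).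
    rewrite (@derive_add _ _ _ (cst (e ^+ 2)))// derive_cst addr0.
    rewrite (@derive_mul _ _ (cst M))//; last exact: dr.
    by rewrite derive_cst mulr0 addr0 Dr mulr0 subr0.
  - by apply: differentiable_dotv; exact: dD.
  - have dMr : differentiable (fun z => M * r z) z.
      exact: (@differentiableM _ _ (cst M) _ z (differentiable_cst _ _) (dr _ Tz)).
    exact: (@differentiableD _ _ _ _ (cst _) z dMr (differentiable_cst _ _)).
have Db : ('D_w blend z) 0 i = ('D_w W z) 0 i + (th z * ('D_w D z) 0 i + D z 0 i * 'D_w th z).
  rewrite -derive_coord; last exact: db.
  have -> : (fun z => blend z 0 i) = (fun z => W z 0 i + th z * D z 0 i).
    by apply/funext => y; rewrite /blend /D !mxE.
  have dWi := differentiable_coordE i (dW _ Tz); have dthz := dth _ Tz.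
  rewrite (derive_add _ dWi (differentiableM dthz dDi)) (derive_mul _ dthz dDi).
  by rewrite (derive_coord _ _ (dD _ Tz)) (derive_coord _ _ (dW _ Tz)).
rewrite Db addrC addKr.
have -> : 'D_w th z = dthreshold (e ^+ 4) (p z) * 'D_w p z.
  exact: (derive_chain (h' := dthreshold (e ^+ 4)) w (dp _ Tz) (is_derive_threshold _ c0)).
have Ep : p z = dotv (D z) (D z) - e ^+ 2 by rewrite /p rz mulr0 add0r.
rewrite /th Dp Ep; set q := dotv _ _ - _; set S := \sum_j `|_|.
have /andP[t0 t1] := threshold01 q c0.
have Si : `|('D_w D z) 0 i| <= S.
  by rewrite /S (bigD1 i)//= lerDl sumr_ge0.
apply: le_trans (ler_normD _ _) _.
rewrite (_ : 9 * _ * S = threshold (e ^+ 4) q * S + 8 * threshold (e ^+ 4) q * S); last by ring.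
apply: lerD.
  by rewrite normrM ger0_norm// ler_wpM2l.
have -> : D z 0 i * (dthreshold (e ^+ 4) q * (2 * \sum_j D z 0 j * ('D_w D z) 0 j)) =
  \sum_j (dthreshold (e ^+ 4) q * (2 * (D z 0 i * D z 0 j))) * ('D_w D z) 0 j.
  by rewrite !mulr_sumr; apply: eq_bigr => j _; ring.
apply: le_trans (ler_norm_sum _ _ _) _.
rewrite mulr_sumr; apply: ler_sum => j _; rewrite normrM ler_wpM2r//.
apply: dthreshold_bound => //; rewrite subrK.
have h k : (D z 0 k) ^+ 2 <= dotv (D z) (D z).
  by rewrite -sqr_enorm -real_normK ?num_real// ler_pXn2r ?nnegrE ?enorm_ge0// coord_le_enorm.
exact: norm_mul_le.
Qed.

End threshold_field.

(** * Picard iterates for the Burgers equation *)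

Section iterates.
Context {R : realType} {d : nat} (T : R) (T_gt0 : 0 < T).
Local Notation V := ('rV[R]_d).
Local Notation X := (V * R)%type.
Variables (g v : R) (r : X -> R) (U : X -> V).
Hypotheses (g1 : 1 < g) (S : C1_solution g T r U).
Hypothesis vac : 2 <= g \/ forall z, strip T z -> 0 < r z.
Hypothesis v0 : 0 <= v.
Hypothesis Uv : forall z, strip T z -> enorm (U z) <= v.
Variables (N L t : R).
Hypotheses (N0 : 0 <= N) (L0 : 0 <= L) (tT : 0 < t < T).
Hypothesis UL : forall j z, open_strip T z /\ `|z.1| <= N + v * T ->
  forall i, `|(dx j U z) 0 i| <= L.

Let T_ge0 : 0 <= T. Proof. exact: ltW. Qed.
Let Cr : C1_strip T r. Proof. by have [] := S. Qed.
Let CU : C1_strip T U. Proof. by have [] := S. Qed.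
Let r0 : forall z, strip T z -> 0 <= r z. Proof. by have [] := S. Qed.

(** Picard iteration for the solution of the Burgers equation that has the
    velocity [U] at time [t]. *)
Fixpoint iterate (n : nat) : X -> V :=
  if n is m.+1 then fun z => U (foot t (iterate m) z) else U.

Local Notation W := iterate.

Lemma foot_strip (Y : X -> V) z : open_strip T (foot t Y z).
Proof. exact: tT. Qed.

Lemma iterate_C1 n : C1_strip T (W n).
Proof.
elim: n => [//|n IH] /=; apply: (C1_strip_vec T_ge0) => i.
apply: (pullback_C1 T_ge0 tT IH (f := fun z => U z 0 i)); exact: C1_strip_coord.
Qed.

Lemma iterate_enorm n z : strip T z -> enorm (W n z) <= v.
Proof.
by case: n => [|n] Tz /=; apply: Uv => //; apply: open_strip_strip; exact: foot_strip.
Qed.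

Lemma iterate_norm n z : strip T z -> `|W n z| <= v.
Proof. by move=> Tz; apply: le_trans (norm_le_enorm _) _; exact: iterate_enorm. Qed.

Lemma foot_norm n z : strip T z -> `|z.1| <= N -> `|(foot t (W n) z).1| <= N + v * T.
Proof.
move=> Tz zN; rewrite /foot/=; apply: le_trans (ler_normB _ _) _.
apply: lerD => //; rewrite normrZ mulrC; apply: ler_pM => //; first exact: iterate_norm.
have /andP[? ?] := tT; have /andP[? ?] := Tz.
by rewrite ler_norml; apply/andP; split; lra.
Qed.

Let Ulip (i : 'I_d) (x y : V) : `|x| <= N + v * T -> `|y| <= N + v * T ->
  `|U (x, t) 0 i - U (y, t) 0 i| <= d%:R * L * `|x - y|.
Proof.
move=> xN yN.
have H j z : open_strip T z -> `|z.1| <= N + v * T -> `|dx j (fun z => U z 0 i) z| <= L.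
  move=> Tz zM; rewrite /dx derive_coord; first exact: UL.
  by have [_ dU _] := CU; exact: dU.
exact: (slice_lipschitz tT L0 (C1_strip_coord T_ge0 i CU) H xN yN).
Qed.

Lemma foot_lipschitz n m z : strip T z -> `|z.1| <= N ->
  `|U (foot t (W n) z) - U (foot t (W m) z)| <= d%:R * L * (`|z.2 - t| * `|W n z - W m z|).
Proof.
move=> Tz zN; apply: normv_le => [|i]; first by rewrite !mulr_ge0.
rewrite !mxE; apply: le_trans (Ulip _ (foot_norm n Tz zN) (foot_norm m Tz zN)) _.
rewrite -normrZ distrC ler_wpM2l ?mulr_ge0//.
have -> : z.1 - (z.2 - t) *: W m z - (z.1 - (z.2 - t) *: W n z) = (z.2 - t) *: (W n z - W m z).
  by apply/rowP => j; rewrite !mxE; ring.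
by [].
Qed.

(** The estimate for the first iterate is [characteristic_defect]; Lipschitz
    continuity of [U] at time [t] propagates it to the later ones. *)
Lemma iterate_fluid n e : 0 < e -> exists2 K, 0 <= K & forall z,
  open_strip T z /\ z.2 <= t /\ `|z.1| <= N /\ r z != 0 -> `|W n z - U z| <= e + K * r z.
Proof.
elim: n e => [|n IH] e e0.
  exists 0 => // z _; rewrite subrr normr0 mul0r addr0; exact: ltW.
pose c := d%:R * L * T.
have c0 : 0 <= c by rewrite !mulr_ge0.
have c1 : 0 < 2 * (c + 1) by lra.
have e1 : 0 < e / (2 * (c + 1)) by rewrite divr_gt0.
have e2 : 0 < e / 2 by rewrite divr_gt0.
have Uv' z : open_strip T z -> `|U z| <= v.
  by move=> Tz; apply: le_trans (norm_le_enorm _) _; apply: Uv; exact: open_strip_strip.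
have [K1 K10 H1] := IH _ e1.
have [K2 K20 H2] := characteristic_defect T_gt0 g1 S vac Uv' tT N0 v0 e2.
exists (c * K1 + K2); first by rewrite addr_ge0// mulr_ge0.
move=> z Hz; have [Tz [zt [zN rz]]] := Hz; have sz := open_strip_strip Tz.
have rz0 := r0 sz.
have -> : W n.+1 z - U z = (U (foot t (W n) z) - U (foot t (W 0) z)) + (U (foot t U z) - U z).
  by rewrite addrA subrK.
apply: le_trans (ler_normD _ _) _.
have A1 : `|U (foot t (W n) z) - U (foot t (W 0) z)| <= c * (e / (2 * (c + 1)) + K1 * r z).
  apply: le_trans (foot_lipschitz _ _ sz zN) _.
  rewrite /c -[leRHS]mulrA ler_wpM2l ?mulr_ge0//; apply: ler_pM => //; last exact: H1.
  have /andP[? ?] := tT; have /andP[? ?] := sz.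
  by rewrite ler_norml; apply/andP; split; lra.
have A2 : `|U (foot t U z) - U z| <= e / 2 + K2 * r z.
  apply: normv_le => [|i]; first by rewrite addr_ge0 ?mulr_ge0// ltW.
  by rewrite !mxE distrC; exact: H2.
apply: le_trans (lerD A1 A2) _.
have A3 : c * (e / (2 * (c + 1))) <= e / 2.
  rewrite mulrA ler_pdivrMr// (_ : e / 2 * _ = e * (c + 1)); last by field.
  by rewrite mulrDr mulr1 [c * e]mulrC lerDl ltW.
rewrite [c * (_ + _)]mulrDr [in leRHS]mulrDl -[c * K1 * r z]mulrA.
apply: le_trans (_ : (e / 2 + c * (K1 * r z)) + (e / 2 + K2 * r z) <= _); first by rewrite 2!lerD2r.
by rewrite addrACA -splitr.
Qed.

Section close.
Variable z : X.
Hypotheses (Tz : open_strip T z) (zN : `|z.1| <= N) (zt : `|z.2 - t| * L * d%:R <= 2^-1).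

Let sz : strip T z. Proof. exact: open_strip_strip. Qed.

(** The length of the time interval is chosen so that the iteration contracts by
    the factor 1/2. *)
Lemma iterate_contraction n : `|W n.+1 z - W n z| <= 2 * v * 2^-1 ^+ n.
Proof.
elim: n => [|n IH].
  rewrite expr0 mulr1; apply: le_trans (ler_normB _ _) _.
  rewrite mulr2n mulrDl mul1r; apply: lerD; exact: iterate_norm.
have E : W n.+2 z - W n.+1 z = U (foot t (W n.+1) z) - U (foot t (W n) z) by [].
rewrite E; apply: le_trans (foot_lipschitz n.+1 n sz zN) _.
rewrite (_ : d%:R * L * _ = (`|z.2 - t| * L * d%:R) * `|W n.+1 z - W n z|); last by ring.
by rewrite exprS mulrCA; apply: ler_pM => //; rewrite !mulr_ge0.
Qed.

Lemma iterate_derive n w i : ('D_w (W n.+1) z) 0 i = \sum_j (dx j U (foot t (W n) z)) 0 i *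
  (w.1 0 j - w.2 * W n z 0 j - (z.2 - t) * ('D_w (W n) z) 0 j).
Proof.
have [_ dW _] := iterate_C1 n.+1; have [_ dU _] := CU.
rewrite -derive_coord; last exact: dW.
rewrite (pullback_derive T_ge0 tT (iterate_C1 n) w (f := fun z => U z 0 i))//.
  by apply: eq_bigr => j _; rewrite /dx derive_coord//; apply: dU; exact: foot_strip.
exact: C1_strip_coord.
Qed.

Let J0 n j i : `|(dx j U (foot t (W n) z)) 0 i| <= L.
Proof. by apply: UL; split; [exact: foot_strip|exact: foot_norm]. Qed.

Let sumJ n i (y : 'I_d -> R) B : (forall j, `|y j| <= B) -> 0 <= B ->
  `|\sum_j (dx j U (foot t (W n) z)) 0 i * ((z.2 - t) * y j)| <= 2^-1 * B.
Proof.
move=> yB B0; apply: le_trans (ler_norm_sum _ _ _) _.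
apply: le_trans (_ : \sum_(j < d) (L * (`|z.2 - t| * B)) <= _).
  apply: ler_sum => j _; rewrite !normrM; apply: ler_pM => //.
  by apply: ler_pM.
rewrite sumr_const card_ord -[leLHS]mulr_natl.
rewrite (_ : d%:R * (L * _) = `|z.2 - t| * L * d%:R * B); last by ring.
by apply: ler_wpM2r.
Qed.

Lemma iterate_jacobian n k i : `|(dx k (W n) z) 0 i| <= 2 * L.
Proof.
elim: n i => [|n IH] i.
  have : `|(dx k U z) 0 i| <= L.
    by apply: UL; split => //; rewrite (le_trans zN)// lerDl mulr_ge0.
  by move=> h; rewrite (le_trans h)// ler_peMl// ler1n.
pose J j := (dx j U (foot t (W n) z)) 0 i.
have -> : (dx k (W n.+1) z) 0 i = J k - \sum_j J j * ((z.2 - t) * (dx k (W n) z) 0 j).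
  rewrite /dx iterate_derive.
  have -> : J k = \sum_j J j * (j == k)%:R.
    by rewrite (bigD1 k)//= eqxx mulr1 big1 ?addr0// => j /negbTE ->; exact: mulr0.
  rewrite -sumrB; congr bigop; apply/funext => j; congr BigBody.
  by rewrite -mulrBr /= !mxE eqxx/= mul0r subr0.
apply: le_trans (ler_normB _ _) _.
rewrite (_ : 2 * L = L + 2^-1 * (2 * L)); last by field.
apply: lerD; first exact: J0.
by apply: sumJ; rewrite ?mulr_ge0.
Qed.

Let resid n i := (dt (W n) z) 0 i + \sum_j W n z 0 j * (dx j (W n) z) 0 i.

Let resid_expand n (w : V) i : ('D_(w, 1) (W n) z) 0 i =
  (dt (W n) z) 0 i + \sum_j w 0 j * (dx j (W n) z) 0 i.
Proof.
have [_ dW _] := iterate_C1 n.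
rewrite derive_expand; last exact: dW.
by rewrite mxE summxE mxE mul1r addrC; congr (_ + _); apply: eq_bigr => j _; rewrite mxE.
Qed.

(** The residual of an iterate is, up to the difference of two iterates, a
    contraction of the previous residual: the recursion b_(n+1) <= b_n / 2 +
    O(2^-n) gives the rate 3/4. *)
Lemma iterate_residual B n i : (forall i, `|resid 0 i| <= B) -> 16 * d%:R * v * L <= B ->
  `|resid n i| <= B * (3 / 4) ^+ n.
Proof.
move=> B1 B2.
have B0 : 0 <= B by apply: le_trans B2; rewrite !mulr_ge0.
elim: n i => [|n IH] i; first by rewrite expr0 mulr1.
have E : resid n.+1 i = - (\sum_j (dx j U (foot t (W n) z)) 0 i * ((z.2 - t) * resid n j)) +
    \sum_j (W n.+1 z 0 j - W n z 0 j) * (dx j (W n.+1) z) 0 i.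
  have E1 := etrans (esym (resid_expand n.+1 (W n z) i)) (iterate_derive n (W n z, 1) i).
  have E2 : \sum_j (dx j U (foot t (W n) z)) 0 i * ((W n z, 1 : R).1 0 j - (W n z, 1 : R).2 * W n z 0 j -
      (z.2 - t) * ('D_(W n z, 1) (W n) z) 0 j) =
      - (\sum_j (dx j U (foot t (W n) z)) 0 i * ((z.2 - t) * resid n j)).
    have alg (x a b y y' : R) : y = y' -> x * (a - 1 * a - b * y) = - (x * (b * y')) by move=> ->; ring.
    rewrite -sumrN; apply: eq_bigr => j _.
    exact: alg _ _ _ _ _ (resid_expand n (W n z) j).
  rewrite -[X in X + _](etrans E1 E2) /resid -addrA; congr (_ + _).
  by rewrite -big_split/=; apply: eq_bigr => j _; ring.
rewrite E; apply: le_trans (ler_normD _ _) _; rewrite normrN.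
have q0 : 0 <= (3 / 4 : R) ^+ n by rewrite exprn_ge0// divr_ge0.
have A1 := sumJ n i (IH) (mulr_ge0 B0 q0).
have A2 : `|\sum_j (W n.+1 z 0 j - W n z 0 j) * (dx j (W n.+1) z) 0 i| <= 4^-1 * B * 2^-1 ^+ n.
  apply: le_trans (ler_norm_sum _ _ _) _.
  apply: le_trans (_ : \sum_(j < d) (2 * v * 2^-1 ^+ n * (2 * L)) <= _).
    apply: ler_sum => j _; rewrite normrM; apply: ler_pM => //; last exact: iterate_jacobian.
    have := iterate_contraction n; apply: le_trans.
    by apply: le_trans (norm_coord _ j); rewrite !mxE.
  rewrite sumr_const card_ord -[leLHS]mulr_natl.
  rewrite (_ : d%:R * _ = 4^-1 * (16 * d%:R * v * L) * 2^-1 ^+ n); last by field.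
  by rewrite ler_wpM2r ?exprn_ge0// ler_wpM2l.
apply: le_trans (lerD A1 A2) _.
have A3 : (2^-1 : R) ^+ n <= (3 / 4) ^+ n.
  by apply: lerXn2r; rewrite ?nnegrE ?invr_ge0 ?divr_ge0//; lra.
have A4 : 4^-1 * B * 2^-1 ^+ n <= 4^-1 * B * (3 / 4) ^+ n.
  by rewrite ler_wpM2l ?mulr_ge0.
apply: le_trans (lerD (lexx _) A4) _.
rewrite exprS (_ : B * (3 / 4 * _) = 2^-1 * (B * (3 / 4) ^+ n) + 4^-1 * B * (3 / 4) ^+ n)//.
by field.
Qed.

End close.

End iterates.

(** * Comparison fields with small acceleration in the vacuum *)

Section gate.
Context {R : realType} {d : nat} (T : R).
Local Notation V := ('rV[R]_d).
Local Notation X := (V * R)%type.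
Local Notation mX := (V * measurableTypeR R)%type.

(** The threshold with the value at 0 replaced by 0: where the two fields
    coincide, [null_critical] shows that their gluing contributes nothing. *)
Definition gate (e x : R) : R := \1_(~` [set (0:R)]) x * threshold (e ^+ 4) (x - e ^+ 2).

Lemma gate01 e x : 0 < e -> 0 <= gate e x <= 1.
Proof.
move=> e0; have /andP[t0 t1] := threshold01 (x - e ^+ 2) (exprn_gt0 4 e0).
by rewrite /gate indicE; case: (_ \in _) => /=; rewrite ?mul1r ?mul0r ?lexx ?ler01// t0.
Qed.

Lemma gate_neq0 e x : x != 0 -> gate e x = threshold (e ^+ 4) (x - e ^+ 2).
Proof. by move=> x0; rewrite /gate indicE mem_set ?mul1r//=; exact/eqP. Qed.

Lemma measurable_gate e : 0 < e -> measurable_fun setT (gate e).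
Proof.
move=> e0; apply: measurable_funM.
  by apply: measurable_indic; apply: measurableC; exact: measurable_set1.
apply: continuous_measurable_fun => x.
apply: (@continuous_comp _ _ _ (fun x => x - e ^+ 2) (threshold (e ^+ 4))).
  by apply: cvgB; [exact: cvg_id|exact: cvg_cst].
apply: differentiable_continuous; apply/derivable1_diffP.
by have [] := is_derive_threshold (x - e ^+ 2) (exprn_gt0 4 e0).
Qed.

Lemma cvg_gate x : 0 <= x -> (fun n => gate (@harmonic R n) x) @ \oo --> (0:R).
Proof.
move=> x0; have [->|xn0] := eqVneq x 0.
  rewrite /gate (_ : (fun n => _) = cst 0); first exact: cvg_cst.
  by apply/funext => n; rewrite indicE memNset ?mul0r//=; apply; exact: erefl.
have {}x0 : 0 < x by rewrite lt_neqAle eq_sym xn0.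
rewrite (_ : (fun n => _) = (fun n => threshold (@harmonic R n ^+ 4) (x - @harmonic R n ^+ 2))); last first.
  by apply/funext => n; exact: gate_neq0.
have h k : (fun n => @harmonic R n ^+ k.+1) @ \oo --> (0:R).
  elim: k => [|k IH]; first exact: cvg_harmonic.
  under eq_fun do rewrite exprS.
  rewrite -(mul0r 0); apply: cvgM => //; exact: cvg_harmonic.
have q : (fun n => ppow 2 (x - @harmonic R n ^+ 2)) @ \oo --> ppow 2 x.
  have : (fun n => x - @harmonic R n ^+ 2) @ \oo --> x.
    by rewrite -[X in _ --> X]subr0; apply: cvgB; [exact: cvg_cst|exact: h].
  by move=> c; apply: continuous_cvg c; exact: continuous_ppow.
have q0 : ppow 2 x != 0 by rewrite ppow_ge0 ?ltW// gt_eqF// powR_gt0.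
rewrite -(mul0r (ppow 2 x)^-1); apply: cvgM; first exact: h.
apply: cvgV => //; rewrite -[X in _ --> X]add0r.
by apply: cvgD => //; exact: h.
Qed.

(** The gate tends to 0 pointwise as [e] tends to 0; dominated convergence on a
    set of finite measure. *)
Lemma gate_integral_small (f : X -> R) (D : set mX) (eps : R) : continuous f ->
  (forall z, 0 <= f z) -> measurable D -> (lebesgue_spacetime D < +oo)%E -> 0 < eps ->
  exists e, 0 < e /\ (\int[lebesgue_spacetime]_(z in D) (gate e (f z))%:E <= eps%:E)%E.
Proof.
move=> cf f0 mD Dfin eps0.
have h0 n : 0 < @harmonic R n by rewrite invr_gt0.
have mf n : measurable_fun D (fun z : mX => (gate (harmonic n) (f z))%:E).
  apply/measurable_EFinP; apply: measurable_funTS.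
  apply: (measurableT_comp (measurable_gate (h0 n))); exact: continuous_measurable_st.
have ae1 : {ae lebesgue_spacetime, forall z : mX, D z ->
   (fun n => (gate (harmonic n) (f z))%:E) @ \oo --> (cst 0%:E : mX -> \bar R) z}.
  apply: aeW => z _; apply: cvg_EFin; first by apply: nearW.
  by apply: cvg_gate.
have ae2 : {ae lebesgue_spacetime, forall (z : mX) n, D z ->
    (`|(gate (harmonic n) (f z))%:E| <= (cst 1%:E : mX -> \bar R) z)%E}.
  apply: aeW => z n _ /=; rewrite lee_fin.
  by have /andP[a b] := gate01 (f z) (h0 n); rewrite ger0_norm.
have i1 : lebesgue_spacetime.-integrable D (cst 1%:E : mX -> \bar R).
  apply/integrableP; split; first exact: measurable_cst.
  under eq_integral do rewrite /= normr1.
  by rewrite integral_cst// mul1e.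
have m0 : measurable_fun D (cst 0%:E : mX -> \bar R) by exact: measurable_cst.
have [_ _ H] := @dominated_convergence _ _ _ lebesgue_spacetime D mD _ _ _ mf m0 ae1 i1 ae2.
move: H; rewrite integral0 => H.
have e0 : (0 < eps%:E)%E by rewrite lte_fin.
have [n _ Hn] := H _ (open_ereal_lt' e0).
by exists (harmonic n); split => //; apply: ltW; exact: (Hn n (leqnn n)).
Qed.

End gate.

Lemma ae_forall_fin dd (Y : measurableType dd) (R : realType)
    (mu : {measure set Y -> \bar R}) (I : finType) (P : I -> Y -> Prop) :
  (forall i, {ae mu, forall x, P i x}) -> {ae mu, forall x, forall i, P i x}.
Proof. by move=> H; exact: (@filter_forall _ I P (almost_everywhere mu)). Qed.

Section comparison.
Context {R : realType} {d : nat} (T : R) (T_gt0 : 0 < T).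
Local Notation V := ('rV[R]_d).
Local Notation X := (V * R)%type.
Local Notation mX := (V * measurableTypeR R)%type.
Variables (g v rmax : R) (r : X -> R) (U : X -> V).
Hypotheses (g1 : 1 < g) (S : C1_solution g T r U).
Hypothesis vac : 2 <= g \/ forall z, strip T z -> 0 < r z.
Hypothesis v0 : 0 <= v.
Hypothesis Uv : forall z, strip T z -> enorm (U z) <= v.
Hypothesis rmaxP : forall z, strip T z -> r z <= rmax.
Variables (N L s t : R).
Hypotheses (N0 : 0 <= N) (L0 : 0 <= L) (tT : 0 < t < T).
Hypothesis UL : forall j z, open_strip T z /\ `|z.1| <= N + v * T ->
  forall i, `|(dx j U z) 0 i| <= L.
Hypothesis st : (t - s) * L * d%:R <= 2^-1.

Let Q z := g / (g - 1) * r z `^ (g - 1).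

Let T_ge0 : 0 <= T. Proof. exact: ltW. Qed.
Let Cr : C1_strip T r. Proof. by have [] := S. Qed.
Let CU : C1_strip T U. Proof. by have [] := S. Qed.
Let r0 : forall z, strip T z -> 0 <= r z. Proof. by have [] := S. Qed.

Let region (z : X) := [/\ open_strip T z, s <= z.2 <= t & `|z.1| <= N].

Let Wn := iterate U t.

Let region_close z : region z -> `|z.2 - t| * L * d%:R <= 2^-1.
Proof.
move=> [_ /andP[sz zt] _]; apply: le_trans st.
apply: ler_wpM2r => //; apply: ler_wpM2r => //.
by rewrite distrC ger0_norm ?subr_ge0// lerB.
Qed.

Let CW n : C1_strip T (Wn n). Proof. exact: (iterate_C1 T_gt0 S). Qed.

Lemma derive_family_bounded (Y : X -> V) (w : X) : C1_strip T Y ->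
  exists2 K, 0 <= K & forall i z, open_strip T z /\ `|z.1| <= N -> `|('D_w Y z) 0 i| <= K.
Proof.
move=> CY; apply: (sup_family (h := fun i K z => `|('D_w Y z) 0 i| <= K)).
  by move=> i K K' z KK _ h; exact: le_trans h KK.
move=> i; have [K K0 KP] := derive_bounded T_ge0 w N (C1_strip_coord T_ge0 i CY).
exists K => // z [Tz zN]; rewrite -derive_coord; first exact: KP.
by have [_ dY _] := CY; exact: dY.
Qed.

Lemma iterate_residual_bound : exists2 B, 0 <= B & forall n i z, region z ->
  `|(dt (Wn n) z) 0 i + \sum_j Wn n z 0 j * (dx j (Wn n) z) 0 i| <= B * (3 / 4) ^+ n.
Proof.
have [B1 B10 B1P] := derive_family_bounded (0, 1) CU.
exists (B1 + d%:R * (v * L) + 16 * d%:R * v * L); first by rewrite !addr_ge0// !mulr_ge0.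
move=> n i z rz; have [Tz zt zN] := rz.
apply: (iterate_residual T_gt0 S v0 Uv L0 tT UL Tz zN (region_close rz)); last first.
  by rewrite lerDr addr_ge0// !mulr_ge0.
move=> k; apply: le_trans (_ : B1 + d%:R * (v * L) <= _); last by rewrite lerDl !mulr_ge0.
apply: le_trans (ler_normD _ _) _; apply: lerD; first exact: B1P.
apply: le_trans (ler_norm_sum _ _ _) _.
apply: le_trans (_ : \sum_(j < d) (v * L) <= _); last first.
  by rewrite sumr_const card_ord -[leLHS]mulr_natl.
apply: ler_sum => j _; rewrite normrM; apply: ler_pM => //.
  by apply: le_trans (coord_le_enorm _ _) _; apply: Uv; exact: open_strip_strip.
by apply: UL; split => //; rewrite (le_trans zN)// lerDl mulr_ge0.
Qed.

Let D n (z : X) := U z - Wn n z.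

Let derive_D n w z : open_strip T z -> 'D_w (D n) z = 'D_w U z - 'D_w (Wn n) z.
Proof.
move=> Tz; have [_ dU _] := CU; have [_ dW _] := CW n.
by rewrite [LHS]deriveB//; apply: diff_derivable; [exact: dU|exact: dW].
Qed.

Let UL' k z : region z -> forall i, `|(dx k U z) 0 i| <= L.
Proof.
move=> [Tz _ zN]; apply: UL; split => //; rewrite (le_trans zN)// lerDl mulr_ge0//.
Qed.

Let WL' n k z i : region z -> `|(dx k (Wn n) z) 0 i| <= 2 * L.
Proof.
move=> rz; have [Tz zt zN] := rz.
exact: (iterate_jacobian T_gt0 S v0 Uv L0 tT UL Tz zN (region_close rz)).
Qed.

Let DL n k z i : region z -> `|(dx k (D n) z) 0 i| <= 3 * L.
Proof.
move=> rz; have [Tz _ _] := rz; rewrite /dx derive_D// !mxE.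
apply: le_trans (ler_normB _ _) _.
rewrite (_ : 3 * L = L + 2 * L); last by ring.
by apply: lerD; [exact: UL'|exact: WL'].
Qed.

Let fluid_small n e : 0 < e -> exists M, forall z, open_strip T z -> z.2 <= t ->
  `|z.1| <= N -> r z != 0 -> dotv (D n z) (D n z) < M * r z + e ^+ 2.
Proof.
move=> e0; have d1 : 0 < 2 * (d%:R + 1) :> R by rewrite mulr_gt0// ltr_wpDl.
have e1 : 0 < e / (2 * (d%:R + 1)) by rewrite divr_gt0.
have [K K0 KP] := iterate_fluid T_gt0 g1 S vac v0 Uv N0 L0 tT UL n e1.
(* |W_n - U|^2 <= d (a + K r)^2 <= 2 d a^2 + 2 d K^2 rmax r with 2 d a^2 < e^2. *)
exists (2 * d%:R * K ^+ 2 * rmax) => z Tz zt zN rz.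
have sz := open_strip_strip Tz; have rz0 := r0 sz; have rzm := rmaxP sz.
have := KP z (conj Tz (conj zt (conj zN rz))).
set a := e / _; set b := K * r z => ab.
have b0 : 0 <= b by exact: mulr_ge0.
have A : dotv (D n z) (D n z) <= d%:R * (a + b) ^+ 2.
  rewrite /dotv; apply: le_trans (_ : \sum_(i < d) (a + b) ^+ 2 <= _); last first.
    by rewrite sumr_const card_ord -[leLHS]mulr_natl.
  apply: ler_sum => i _; rewrite -expr2 -real_normK ?num_real//.
  rewrite ler_pXn2r ?nnegrE ?addr_ge0 ?(ltW e1)//; apply: le_trans ab.
  apply: le_trans (norm_coord _ i) _; rewrite /D -normrN opprB//.
apply: le_lt_trans A _.
have ab2 : (a + b) ^+ 2 <= 2 * a ^+ 2 + 2 * b ^+ 2.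
  by have := sqr_ge0 (a - b); rewrite sqrrB sqrrD; lra.
apply: le_lt_trans (ler_wpM2l (ler0n _ d) ab2) _.
have b2 : b ^+ 2 <= K ^+ 2 * (rmax * r z).
  by rewrite exprMn ler_wpM2l ?sqr_ge0// expr2 ler_wpM2r.
have a2 : 2 * d%:R * a ^+ 2 < e ^+ 2.
  rewrite /a expr_div_n mulrA ltr_pdivrMr ?exprn_gt0// [ltRHS]mulrC ltr_pM2r ?exprn_gt0//.
  have d0 := ler0n R d; rewrite expr2; nra.
have B : 2 * d%:R * b ^+ 2 <= 2 * d%:R * K ^+ 2 * rmax * r z.
  rewrite (_ : _ * r z = 2 * d%:R * (K ^+ 2 * (rmax * r z))); last by ring.
  by rewrite ler_wpM2l ?mulr_ge0.
rewrite (_ : d%:R * _ = 2 * d%:R * b ^+ 2 + 2 * d%:R * a ^+ 2); last by ring.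
exact: ler_ltD.
Qed.

Let Lam := (2 + 27 * d%:R) * L.

(** The number of iterations is chosen first, to make the acceleration of the
    iterate small, then the threshold, to make the cost of gluing small. The
    bound on the gradient is independent of [delta]; this matters because the
    damping rate of the cutoff depends on it. *)
Lemma comparison_fields (delta : R) : 0 < delta -> exists (W : X -> V) (H : X -> R),
  [/\ C1_strip T W, forall z, strip T z -> enorm (W z) <= v,
    forall z, open_strip T z -> z.2 <= t -> `|z.1| <= N -> r z != 0 -> \forall y \near z, W y = U y &
    forall z k i, open_strip T z -> s <= z.2 <= t -> `|z.1| <= N ->
      `|(dx k W z) 0 i| <= (2 + 27 * d%:R) * L] /\
  [/\ measurable_fun setT (H : mX -> R), forall z, 0 <= H z,
    (\int[lebesgue_spacetime]_(z in slab T N) (H z)%:E <= delta%:E)%E &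
    {ae lebesgue_spacetime, forall z, open_strip T z -> s <= z.2 <= t -> `|z.1| <= N ->
      r z = 0 -> forall i, `|accel W Q z i| <= H z}].
Proof.
move=> delta0.
have [B B0 BP] := iterate_residual_bound.
pose vol : R := fine (lebesgue_spacetime (slab T N : set mX)).
have vol0 : 0 <= vol by exact: fine_ge0.
have volE : lebesgue_spacetime (slab T N : set mX) = vol%:E.
  by rewrite fineK// ge0_fin_numE//; exact: slab_fin.
have [n nP] : exists n, B * (3 / 4) ^+ n * vol <= delta / 2.
  have : (fun n => B * (3 / 4) ^+ n * vol) @ \oo --> (0 : R).
    rewrite -(mul0r vol) -(mulr0 B); apply: cvgM; last exact: cvg_cst.
    apply: cvgM; first exact: cvg_cst.
    by apply: cvg_expr; rewrite ger0_norm; lra.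
  have d2 : 0 < delta / 2 by rewrite divr_gt0.
  by move=> /(cvgr_le _)/(_ _ d2)[n _ /(_ n (leqnn n))]; exists n.
have CD : C1_strip T (D n) by exact: C1_stripB.
have [Bt Bt0 BtP] := derive_family_bounded (0, 1) CD.
pose Bd := 3 * L + Bt.
have Bd0 : 0 <= Bd by rewrite addr_ge0// mulr_ge0.
have Lam0 : 0 <= Lam by rewrite mulr_ge0// addr_ge0// mulr_ge0.
pose B2 := 9 * (d%:R * Bd).
have B20 : 0 <= B2 by rewrite !mulr_ge0.
pose B3 := B2 + d%:R * (2 * v * Lam + v * B2).
have B30 : 0 <= B3 by rewrite addr_ge0// !mulr_ge0// addr_ge0// !mulr_ge0.
pose f (z : X) : R := dotv (D n (clampt T z)) (D n (clampt T z)).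
have cf : continuous f.
  apply: (C1_strip_continuous T_ge0 (f := fun z => dotv (D n z) (D n z))).
  by apply: (C1_strip_sum T_ge0 _ (F := fun i z => D n z 0 i * D n z 0 i)) => i; apply: (C1_stripM T_ge0); exact: C1_strip_coord.
have f0 z : 0 <= f z by exact: dotv_ge0.
have d3 : 0 < delta / 2 / (B3 + 1) by rewrite !divr_gt0// ltr_wpDl.
have [e [e0 eP]] := gate_integral_small cf f0 (measurable_slab T N) (slab_fin T N) d3.
have [M MP] := fluid_small n e0.
pose W := blend r U (Wn n) M e.
have CWb : C1_strip T W by apply: blend_C1.
pose c := B * (3 / 4) ^+ n.
have c0 : 0 <= c by rewrite mulr_ge0// exprn_ge0// divr_ge0.
pose H (z : X) := c + B3 * gate e (f z).
have mgate : measurable_fun setT (fun z : mX => gate e (f z)).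
  apply: (measurableT_comp (measurable_gate e0)); exact: continuous_measurable_st.
have g01 z := gate01 (f z) e0.
have near_U z : open_strip T z -> z.2 <= t -> `|z.1| <= N -> r z != 0 -> \forall y \near z, W y = U y.
  by move=> Tz zt zN rz; apply: (blend_near T_ge0) => //; exact: MP.
have sumD z w : open_strip T z -> (forall i, `|('D_w (D n) z) 0 i| <= Bd) ->
    9 * (\sum_j `|('D_w (D n) z) 0 j|) <= B2.
  move=> Tz DB; rewrite ler_wpM2l//.
  apply: le_trans (_ : \sum_(j < d) Bd <= _); first by apply: ler_sum => j _; exact: DB.
  by rewrite sumr_const card_ord -[leLHS]mulr_natl.
have WLam z k i : open_strip T z -> s <= z.2 <= t -> `|z.1| <= N -> `|(dx k W z) 0 i| <= Lam.
  move=> Tz zt zN; have rz : region z by [].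
  have [rz0|rz0] := eqVneq (r z) 0; last first.
    have /andP[_ zt'] := zt.
    rewrite /dx (near_eq_derive _ (near_U z Tz zt' zN rz0)).
    by apply: le_trans (UL' _ rz _) _; rewrite ler_peMl// ler_wpDr ?mulr_ge0// ler1n.
  have A := blend_vacuum_derive T_ge0 M Cr r0 CU (CW n) e0 ('e_k, 0) i Tz rz0.
  rewrite -[X in `|X|](subrK ((dx k (Wn n) z) 0 i)).
  apply: le_trans (ler_normD _ _) _; rewrite addrC /Lam mulrDl.
  apply: lerD; first exact: WL'.
  apply: le_trans A _.
  have /andP[t0 t1] := threshold01 (dotv (U z - Wn n z) (U z - Wn n z) - e ^+ 2) (exprn_gt0 4 e0).
  rewrite (_ : 27 * d%:R * L = 9 * 1 * (d%:R * (3 * L))); last by ring.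
  apply: ler_pM.
  - by rewrite mulr_ge0.
  - exact: sumr_ge0.
  - by rewrite ler_wpM2l.
  - apply: le_trans (_ : \sum_(j < d) (3 * L) <= _); first by apply: ler_sum => j _; exact: DL.
    by rewrite sumr_const card_ord -[leLHS]mulr_natl.
exists W, H; split; split => //.
- move=> z Tz; apply: blend_enorm => //; first exact: Uv.
  exact: (iterate_enorm Uv).
- apply: measurable_funD; first exact: measurable_cst.
  by apply: measurable_funM => //; exact: measurable_cst.
- by move=> z; rewrite addr_ge0// mulr_ge0//; have /andP[] := g01 z.
- have -> : (\int[lebesgue_spacetime]_(z in slab T N) (H z)%:E = (c * vol)%:E +
      B3%:E * \int[lebesgue_spacetime]_(z in slab T N) (gate e (f z))%:E)%E.
    have mE : measurable_fun (slab T N : set mX) (fun z : mX => (gate e (f z))%:E).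
      by apply/measurable_EFinP; exact: measurable_funTS.
    rewrite -ge0_integralZl_EFin//; first last.
    - by move=> z _; rewrite lee_fin; have /andP[] := g01 z.
    - exact: measurable_slab.
    rewrite EFinM -volE -integral_cst; last exact: measurable_slab.
    rewrite -ge0_integralD//.
    - exact: measurable_slab.
    - by move=> z _ /=; rewrite mule_ge0 ?lee_fin//; have /andP[] := g01 z.
    - exact: measurable_funeM.
  apply: le_trans (_ : ((c * vol)%:E + B3%:E * (delta / 2 / (B3 + 1))%:E <= _)%E).
    by rewrite leeD2l// lee_wpmul2l.
  rewrite -EFinM -EFinD lee_fin [leRHS]splitr; apply: lerD => //.
  have d20 : 0 <= delta / 2 by rewrite divr_ge0// ltW.
  by rewrite mulrA ler_pdivrMr ?ltr_wpDl// mulrC ler_wpM2l// lerDl.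
- have ae1 : {ae lebesgue_spacetime, forall z, forall kj : option 'I_d * 'I_d, open_strip T z ->
      D n z 0 kj.2 = 0 -> 'D_(if kj.1 is Some k then ('e_k, 0) else (0, 1)) (fun z => D n z 0 kj.2) z = 0}.
    apply: ae_forall_fin => -[k j]; apply: (null_critical T_ge0) => /=; exact: C1_strip_coord.
  apply: ae_imp ae1 => z crit Tz zt zN rz0 i; have rz : region z by [].
  have [_ dD _] := CD.
  have crit' : D n z = 0 -> forall w, w = (0, 1) \/ (exists k, w = ('e_k, 0)) ->
      forall j, ('D_w (D n) z) 0 j = 0.
    move=> D0 w ww j; rewrite -derive_coord; last exact: dD.
    by case: ww => [->|[k ->]]; [apply: (crit (None, j))|apply: (crit (Some k, j))] => //=; rewrite D0 mxE.
  have DBd w : w = (0, 1) \/ (exists k, w = ('e_k, 0)) -> forall j, `|('D_w (D n) z) 0 j| <= Bd.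
    case=> [->|[k ->]] j; first by apply: le_trans (BtP j z (conj Tz zN)) _; rewrite lerDr mulr_ge0.
    by apply: le_trans (DL n k j rz) _; rewrite lerDl.
  pose G := gate e (f z).
  have sz := open_strip_strip Tz.
  have fE : f z = dotv (D n z) (D n z) by rewrite /f clampt_id.
  have GE : D n z != 0 -> threshold (e ^+ 4) (dotv (D n z) (D n z) - e ^+ 2) = G.
    move=> Dn0; rewrite /G gate_neq0 fE//; apply: contra Dn0 => /eqP/dotv_eq0 ->//.
  have G01 : 0 <= G <= 1 by exact: g01.
  have /andP[G0 G1] := G01.
  have W1 j : `|W z 0 j - Wn n z 0 j| <= G * (2 * v).
    apply: le_trans (blend_vacuum U (Wn n) M e0 j rz0) _.
    have [D0|/GE] := eqVneq (D n z) 0; last first.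
      rewrite -/(D n z) => ->; rewrite ler_wpM2l// (le_trans (norm_coord _ _))//.
      rewrite mulr2n mulrDl mul1r (le_trans (ler_normB _ _))// lerD//.
        by rewrite (le_trans (norm_le_enorm _))// Uv.
      by rewrite (le_trans (norm_le_enorm _))//; exact: (iterate_enorm Uv).
    rewrite -/(D n z) D0 mxE normr0 mulr0; apply: mulr_ge0 => //; exact: mulr_ge0.
  have W2 w : w = (0, 1) \/ (exists k, w = ('e_k, 0)) ->
      `|('D_w W z) 0 i - ('D_w (Wn n) z) 0 i| <= G * B2.
    move=> ww; apply: le_trans (blend_vacuum_derive T_ge0 M Cr r0 CU (CW n) e0 w i Tz rz0) _.
    have [D0|/GE] := eqVneq (D n z) 0.
      rewrite -/(D n) big1; first by rewrite mulr0; apply: mulr_ge0.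
      move=> j _.
      by rewrite (crit' D0 w ww) normr0.
    rewrite -/(D n z) => ->; rewrite mulrAC mulrC ler_wpM2l//.
    by apply: sumD => //; exact: DBd.
  have Q0 : dx i Q z = 0.
    have [_ /(_ z _ Tz)] := enthalpy_C1 T_ge0 g1 S vac.
    have [_ dr _] := Cr.
    by rewrite /dx => ->; rewrite (derive_at_min _ r0 (dr _ Tz) Tz rz0) mulr0.
  have E : accel W Q z i = ((dt (Wn n) z) 0 i + \sum_j Wn n z 0 j * (dx j (Wn n) z) 0 i) +
      (((dt W z) 0 i - (dt (Wn n) z) 0 i) +
       \sum_j ((W z 0 j - Wn n z 0 j) * (dx j W z) 0 i +
          Wn n z 0 j * ((dx j W z) 0 i - (dx j (Wn n) z) 0 i))).
    rewrite /accel Q0 addr0 addrACA subrKC -big_split/=; congr (_ + _).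
    by apply: eq_bigr => j _; ring.
  rewrite E /H; apply: le_trans (ler_normD _ _) _; apply: lerD; first exact: BP.
  rewrite -/G mulrC /B3 mulrDr; apply: le_trans (ler_normD _ _) _; apply: lerD.
    by apply: W2; left.
  apply: le_trans (ler_norm_sum _ _ _) _.
  apply: le_trans (_ : \sum_(j < d) (G * (2 * v * Lam + v * B2)) <= _); last first.
    by rewrite sumr_const card_ord -[leLHS]mulr_natl mulrCA.
  apply: ler_sum => j _; apply: le_trans (ler_normD _ _) _; rewrite [leRHS]mulrDr; apply: lerD.
    by rewrite normrM mulrA; apply: ler_pM => //; exact: WLam.
  rewrite normrM mulrCA; apply: ler_pM => //; last by apply: W2; right; exists j.
  by apply: le_trans (coord_le_enorm _ _) _; exact: (iterate_enorm Uv).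
Qed.

End comparison.

(** * Uniqueness in the cone over a short time *)

Section pointwise.
Context {R : realType} {d : nat}.
Local Notation V := ('rV[R]_d).
Local Notation X := (V * R)%type.
Implicit Types (u U W : V).

(** In the vacuum both the density and the kinetic term vanish, whatever the
    comparison field is. *)
Lemma same_state_energy0 (g r rho : R) u U W : 1 < g -> 0 <= r ->
  same_state rho u r U -> (r != 0 -> W = U) ->
  relative_energy g r W rho u = 0 /\ forall i, rho * (u 0 i - W 0 i) = 0.
Proof.
move=> g1 r0 [Er Eu] WU; subst rho.
rewrite relative_energyE potential_energy_diag// addr0.
have [->|rn0] := eqVneq r 0; first by split=> [|i]; rewrite ?mulr0 mul0r.
rewrite (WU rn0) (Eu rn0); split=> [|i]; last by rewrite subrr mulr0.
by rewrite big1 ?mulr0// => i _; rewrite subrr mulr0.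
Qed.

Lemma energy0_same_state (g r rho : R) u U : 1 < g -> 0 <= r -> 0 <= rho ->
  potential_energy g r rho + (r != 0)%:R * (2^-1 * rho * dotv (u - U) (u - U)) = 0 ->
  same_state rho u r U.
Proof.
move=> g1 r0 rho0 E.
have p0 := potential_energy_ge0 g1 r0 rho0.
have k0 : 0 <= (r != 0)%:R * (2^-1 * rho * dotv (u - U) (u - U)).
  by rewrite !mulr_ge0// dotv_ge0.
have {E} /eqP := E; rewrite paddr_eq0// => /andP[/eqP pE /eqP kE].
have Er : rho = r.
  apply/eqP/negP => /negP nE; have := @potential_energy_gt0 _ g r rho g1 r0 rho0.
  by rewrite pE ltxx eq_sym nE => /(_ isT).
split=> // rn0; move: kE; rewrite -Er rn0 mul1r => /eqP.
rewrite mulf_eq0 mulf_eq0 (negbTE rn0) invr_eq0 pnatr_eq0/= => /eqP /dotv_eq0 /eqP.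
by rewrite subr_eq0 => /eqP.
Qed.

(** The quadratic term and the divergence term are controlled by the relative
    energy; the acceleration term, of first order in the density, is kept. *)
Lemma dissipation_bound (g v Lam : R) (r rh : X -> R) (W u : X -> V) (Q : X -> R) z :
  1 < g -> 0 <= Lam -> 0 <= r z -> 0 <= rh z -> enorm (u z) <= v -> enorm (W z) <= v ->
  (forall k i, `|(dx k W z) 0 i| <= Lam) ->
  dissipation g r W Q rh u z <=
    (2 + (g - 1)) * (d%:R * Lam) * relative_energy g (r z) (W z) (rh z) (u z) +
    rh z * (2 * v) * \sum_i `|accel W Q z i|.
Proof.
move=> g1 L0 r0 rh0 uv Wv WL; set a := fun i => u z 0 i - W z 0 i.
have p0 := potential_energy_ge0 g1 r0 rh0.
have g0 : 0 <= g - 1 by rewrite subr_ge0 ltW.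
rewrite relative_energyE -/(potential_energy _ _ _) /dissipation.
set P := potential_energy _ _ _ in p0 *.
set A2 := \sum_i (u z 0 i - W z 0 i) * (u z 0 i - W z 0 i).
have A20 : 0 <= A2 by apply: sumr_ge0 => i _; rewrite -expr2 sqr_ge0.
have A1 : - rh z * (\sum_i (u z 0 i - W z 0 i) * accel W Q z i) <=
    rh z * (2 * v) * \sum_i `|accel W Q z i|.
  rewrite mulNr -mulrN -mulrA ler_wpM2l// -sumrN mulr_sumr; apply: ler_sum => i _.
  apply: le_trans (ler_norm _) _; rewrite normrN normrM ler_wpM2r//.
  apply: le_trans (ler_normB _ _) _; rewrite mulr2n mulrDl mul1r.
  by apply: lerD; apply: le_trans (coord_le_enorm _ _) _.
have A2' : - (\sum_i \sum_j (u z 0 i - W z 0 i) * (u z 0 j - W z 0 j) * (dx j W z) 0 i) <= d%:R * Lam * A2.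
  apply: le_trans (_ : \sum_i \sum_j (2^-1 * Lam * (a i * a i) + 2^-1 * Lam * (a j * a j)) <= _).
    rewrite -sumrN; apply: ler_sum => i _; rewrite -sumrN; apply: ler_sum => j _.
    apply: le_trans (ler_norm _) _; rewrite normrN normrM -/(a i) -/(a j).
    have h : `|a i * a j| <= 2^-1 * (a i * a i + a j * a j).
      have := sqr_ge0 (a i - a j); have := sqr_ge0 (a i + a j).
      by rewrite sqrrB sqrrD !expr2 ler_norml => *; apply/andP; split; lra.
    apply: le_trans (ler_pM _ _ h (WL j i)) _ => //.
    by rewrite [leLHS](_ : _ = 2^-1 * Lam * (a i * a i) + 2^-1 * Lam * (a j * a j))//; ring.
  have Ei i : \sum_j (2^-1 * Lam * (a i * a i) + 2^-1 * Lam * (a j * a j)) =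
      d%:R * (2^-1 * Lam) * (a i * a i) + 2^-1 * Lam * A2.
    rewrite big_split/= sumr_const card_ord -[X in X + _]mulr_natl -[X in _ + X]mulr_sumr.
    by congr (_ + _); ring.
  rewrite (eq_bigr _ (fun i _ => Ei i)) big_split/= sumr_const card_ord -[X in _ + X]mulr_natl.
  rewrite -[X in X + _]mulr_sumr -/A2 (_ : d%:R * Lam * A2 = d%:R * (2^-1 * Lam) * A2 + d%:R * (2^-1 * Lam * A2))//.
  by field.
have A3 : - ((g - 1) * divx W z * P) <= (g - 1) * (d%:R * Lam) * P.
  rewrite -mulNr ler_wpM2r// -mulrN ler_wpM2l//.
  apply: le_trans (ler_norm _) _; rewrite normrN /divx.
  apply: le_trans (ler_norm_sum _ _ _) _.
  apply: le_trans (_ : \sum_(j < d) Lam <= _); first by apply: ler_sum => j _; exact: WL.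
  by rewrite sumr_const card_ord -[leLHS]mulr_natl.
have dL0 : 0 <= d%:R * Lam by exact: mulr_ge0.
have A2'' := ler_wpM2l rh0 A2'.
have A4 : 0 <= (g - 1) * (d%:R * Lam) * (2^-1 * rh z * A2) by rewrite !mulr_ge0.
have A5 : 0 <= 2 * (d%:R * Lam) * P by rewrite !mulr_ge0.
move: A1 A2'' A3 A4 A5; set S1 := \sum_i _; set S2 := \sum_i _; set dL := d%:R * Lam.
set S3 := \sum_i _; set dv := divx _ _.
move=> A1 A2'' A3 A4 A5.
rewrite mulrN in A2''.
rewrite (_ : (2 + (g - 1)) * dL * _ = (rh z * (dL * A2) + (g - 1) * dL * P) +
  ((g - 1) * dL * (2^-1 * rh z * A2) + 2 * dL * P)); last by field.
have A6 := lerD (lerD A1 A2'') A3; have A7 := addr_ge0 A4 A5.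
apply: le_trans A6 _; rewrite -addrA [leLHS]addrC lerD2r.
by rewrite lerDl.
Qed.

Lemma early_dissipation0 (g : R) (r rh : X -> R) (W u : X -> V) (Q : X -> R) z :
  (forall i, rh z * (u z 0 i - W z 0 i) = 0) -> potential_energy g (r z) (rh z) = 0 ->
  dissipation g r W Q rh u z = 0.
Proof.
move=> H p0; rewrite /dissipation p0 mulr0 subr0 mulNr 2!mulr_sumr !big1 ?oppr0 ?subr0 ?addr0 //.
- move=> i _; rewrite mulr_sumr big1// => j _.
  by rewrite mulrA mulrA H !mul0r.
- by move=> i _; rewrite mulrA H mul0r.
Qed.

End pointwise.

Section cone_slice.
Context {R : realType} {d : nat} (T : R) (T_gt0 : 0 < T).
Local Notation V := ('rV[R]_d).
Local Notation X := (V * R)%type.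
Local Notation mX := (V * measurableTypeR R)%type.
Variables (g v rmin rmax C eta : R) (rho0 : V -> R) (u0 : V -> V).
Variables (rho : X -> R) (u : X -> V) (r : X -> R) (U : X -> V).
Hypotheses (g1 : 1 < g) (AW : admissible_weak_solution g T rho0 u0 rho u).
Hypotheses (S : C1_solution g T r U) (C0 : 0 <= C) (v0 : 0 <= v) (rmin0 : 0 <= rmin).
Hypothesis vac : 2 <= g \/ forall z, strip T z -> 0 < r z.
Hypothesis Uv : forall z, strip T z -> enorm (U z) <= v.
Hypothesis rb : forall z, strip T z -> rmin <= r z <= rmax.
Hypothesis initial : {ae lebesgue_rV d, forall x, ~ eball eta x ->
  same_state (rho0 x) (u0 x) (r (x, 0)) (U (x, 0))}.
Hypothesis bounds : {ae lebesgue_spacetime, forall z : X, open_strip T z ->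
  rmin <= rho z <= rmax /\ enorm (u z) <= v}.
Hypothesis flux : forall (r' rho' : R) (U' u' : V),
  rmin <= r' <= rmax -> rmin <= rho' <= rmax -> enorm U' <= v -> enorm u' <= v ->
  enorm (relative_flux g r' U' rho' u') <= C * relative_energy g r' U' rho' u'.

Variables (w N L : R).
Hypotheses (w0 : 0 < w) (N0 : 0 <= N) (L0 : 0 <= L).
Hypothesis UL : forall j z, open_strip T z /\ `|z.1| <= N + v * T ->
  forall i, `|(dx j U z) 0 i| <= L.

(** The set where [cutoff] is nonzero. *)
Definition in_cone (z : X) := eta + w + C * z.2 < smooth_norm w z.1 < N - C * z.2.

Let Lam := (2 + 27 * d%:R) * L.
Let K := (2 + (g - 1)) * (d%:R * Lam).
Let phi : X -> R := cutoff K C eta w N.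
Let Q z := g / (g - 1) * r z `^ (g - 1).
Let P z := r z `^ g.

Let T_ge0 : 0 <= T. Proof. exact: ltW. Qed.
Let Cr : C1_strip T r. Proof. by have [] := S. Qed.
Let CU : C1_strip T U. Proof. by have [] := S. Qed.
Let r0 : forall z, strip T z -> 0 <= r z. Proof. by have [] := S. Qed.
Let Cphi : C1_strip T phi. Proof. exact: cutoff_C1. Qed.
Let phi0 z : 0 <= phi z. Proof. exact: cutoff_ge0. Qed.
Let Lam0 : 0 <= Lam. Proof. by rewrite mulr_ge0// addr_ge0// mulr_ge0. Qed.

Let phi_slab (z : X) : strip T z -> phi z != 0 -> `|z.1| <= N.
Proof.
move=> Tz; apply: contraNT; rewrite -ltNge => zN.
by rewrite /phi (cutoff_support K eta w C0 Tz zN).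
Qed.

(** The relative energy with the kinetic part restricted to the fluid. It bounds
    from below the relative energy with respect to every comparison field equal
    to [U] in the fluid, and it vanishes exactly when the states agree. *)
Definition state_defect (z : X) : R :=
  potential_energy g (r z) (rho z) + (r z != 0)%:R *
    (2^-1 * rho z * dotv (u z - U z) (u z - U z)).

Lemma measurable_state_defect : measurable_fun (strip T) (state_defect : mX -> R).
Proof.
have mD : measurable (strip T : set mX) by exact: measurable_strip.
have mC (f : X -> R) : C1_strip T f -> measurable_fun (strip T) (f : mX -> R).
  by move=> Cf; apply: (cont_strip_measurable (C1_strip_continuous T_ge0 Cf)).
have mrho : measurable_fun (strip T) (rho : mX -> R) by have [? _] := weak_density_Lp AW.
have mu i : measurable_fun (strip T) (fun z : mX => u z 0 i).
  exact: (measurableT_comp (measurable_coord i) (weak_velocity_measurable AW)).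
have mr := mC _ Cr.
have mpow (f : mX -> R) p : measurable_fun (strip T) f -> measurable_fun (strip T) (fun x => f x `^ p).
  by move=> mf; exact: (measurableT_comp (measurable_powR p) mf).
apply: measurable_funD.
  apply: measurable_funD; last by apply: measurable_funM => //; exact: mpow.
  apply: measurable_funB; first exact: mpow.
  by apply: measurable_funM; [exact: measurable_funM|exact: mpow].
apply: measurable_funM.
  rewrite (_ : (fun x => _) = (fun z : mX => \1_(~` [set (0:R)]) (r z))).
    apply: (measurableT_comp _ mr); apply: measurable_indic.
    by apply: measurableC; exact: measurable_set1.
  apply/funext => z; rewrite indicE; have [->|rx] := eqVneq (r z) 0.
    by rewrite memNset//=; apply; exact: erefl.
  by rewrite mem_set//=; exact/eqP.
apply: measurable_funM; first exact: measurable_funM.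
have mDi i : measurable_fun (strip T) (fun z : mX => (u z - U z) 0 i).
  rewrite (_ : (fun x => _) = (fun z : mX => u z 0 i - U z 0 i)).
    by apply: measurable_funB => //; apply: (mC (fun z => U z 0 i)); exact: C1_strip_coord.
  by apply/funext => x; rewrite !mxE.
exact: (measurable_sum _ (fun i => measurable_funM (mDi i) (mDi i))).
Qed.

Lemma state_defect0 z : strip T z -> 0 <= rho z ->
  state_defect z = 0 <-> same_state (rho z) (u z) (r z) (U z).
Proof.
move=> Tz rh0; split; first by apply: energy0_same_state => //; exact: r0.
move=> ss; have [_ E] := same_state_energy0 g1 (r0 Tz) ss (fun=> erefl).
rewrite /state_defect -mulrA (_ : rho z * _ = 0); last first.
  rewrite dotvBB mulr_sumr big1// => i _.
  by rewrite mulrA E mul0r.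
by rewrite !mulr0 addr0; case: ss => -> _; rewrite potential_energy_diag//; exact: r0.
Qed.

Section slice.
Variables (s t : R).
Hypotheses (tT : 0 < t < T) (st : (t - s) * L * d%:R <= 2^-1).
Hypothesis early : {ae lebesgue_spacetime, forall z : X, open_strip s z -> in_cone z ->
  same_state (rho z) (u z) (r z) (U z)}.
Hypothesis mass_t : forall psi : X -> R, C1c_strip T psi -> weak_mass t psi rho u rho0.
Hypothesis momentum_t : forall zeta : X -> V, C1c_strip T zeta ->
  weak_momentum g t zeta rho u rho0 u0.
Hypothesis energy_t : forall chi : X -> R, C1c_strip T chi ->
  (forall z, strip T z -> 0 <= chi z) -> local_energy_ineq g t chi rho u rho0 u0.
Hypothesis bounds_t : {ae lebesgue_rV d, forall x : V,
  rmin <= rho (x, t) <= rmax /\ enorm (u (x, t)) <= v}.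

Let tT' : 0 <= t <= T. Proof. by case/andP: tT => /ltW -> /ltW ->. Qed.
Let open_t (z : X) : open_strip t z -> open_strip T z.
Proof. by case/andP: tT => _ tT1 /andP[z0 zt]; apply/andP; split=> //; exact: lt_trans zt tT1. Qed.

Definition cone_defect (x : V) : R := phi (x, t) * state_defect (x, t).

Let rmax0 : 0 <= rmax.
Proof.
have z0 : strip T ((0, 0) : X) by rewrite /strip/= lexx.
by have /andP[a b] := rb z0; rewrite (le_trans rmin0)// (le_trans a b).
Qed.

Section comparison_field.
Variables (W : X -> V) (H : X -> R).
Hypotheses (CW : C1_strip T W) (Wv : forall z, strip T z -> enorm (W z) <= v).
Hypothesis WU : forall z, open_strip T z -> z.2 <= t -> `|z.1| <= N -> r z != 0 ->
  \forall y \near z, W y = U y.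
Hypothesis WL : forall z k i, open_strip T z -> s <= z.2 <= t -> `|z.1| <= N ->
  `|(dx k W z) 0 i| <= Lam.
Hypothesis H0 : forall z, 0 <= H z.
Hypothesis WH : {ae lebesgue_spacetime, forall z, open_strip T z -> s <= z.2 <= t ->
  `|z.1| <= N -> r z = 0 -> forall i, `|accel W Q z i| <= H z}.

Let F z := dt phi z * relative_energy g (r z) (W z) (rho z) (u z) +
    dotv (grad phi z) (relative_flux g (r z) (W z) (rho z) (u z)) +
    phi z * dissipation g r W Q rho u z.

Let A x := phi (x, t) * relative_energy g (r (x, t)) (W (x, t)) (rho (x, t)) (u (x, t)) -
    phi (x, 0) * relative_energy g (r (x, 0)) (W (x, 0)) (rho0 x) (u0 x).

Lemma field_near_id z : open_strip T z -> z.2 <= t -> `|z.1| <= N -> r z != 0 -> W z = U z.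
Proof. by move=> Tz zt zN rz; exact: nbhs_singleton (WU Tz zt zN rz). Qed.

(** The comparison field is known to be [U] in the fluid at positive times only;
    the value at time 0 is recovered by continuity, as the fluid region is open.
    *)
Lemma field_initial x : `|x| <= N -> r (x, 0) != 0 -> W (x, 0) = U (x, 0).
Proof.
move=> xN rx; have z0 : strip T ((x, 0) : X) by rewrite /strip/= lexx.
have rx0 : 0 < r (x, 0) by rewrite lt_neqAle eq_sym rx r0.
have lim (Y : normedModType R) (f : X -> Y) : C1_strip T f ->
    (fun h : R => f (clampt T (h *: ((0, 1) : X) + (x, 0)))) @ (0:R)^'+ --> f (x, 0).
  move=> Cf; have cf := C1_strip_continuous T_ge0 Cf.
  rewrite -[X in f X](clampt_id z0).
  exact: (cvg_comp (fun h : R => h *: ((0, 1) : X) + (x, 0)) (f \o clampt T) (@cvg_line R d (x, 0) (0, 1)) (cf (x, 0))).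
have nr : \forall h \near (0:R)^'+, 0 < r (clampt T (h *: ((0, 1) : X) + (x, 0))).
  exact: cvgr_gt (lim _ _ Cr) _ rx0.
have EV : \forall h \near (0:R)^'+, W (clampt T (h *: ((0, 1) : X) + (x, 0))) =
    U (clampt T (h *: ((0, 1) : X) + (x, 0))).
  near=> h.
  have h0 : 0 < h by near: h; exact: nbhs_right_gt.
  have ht : h < t by near: h; apply: nbhs_right_lt; have /andP[] := tT.
  have rh : 0 < r (clampt T (h *: ((0, 1) : X) + (x, 0))) by near: h.
  have E : h *: ((0, 1) : X) + (x, 0) = (x, h).
    congr (_, _) => /=; first by rewrite scaler0 add0r.
    by rewrite -[_ *: _]/(h * 1) mulr1 addr0.
  have Th : open_strip T ((x, h) : X).
    by apply: open_t; rewrite /open_strip/= h0.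
  rewrite E (clampt_id (open_strip_strip Th)) in rh *.
  by apply: field_near_id => //=; [exact: ltW|rewrite gt_eqF].
have := cvg_unique _ (lim _ _ CW); apply => //.
by apply: cvg_trans (lim _ _ CU); apply: near_eq_cvg; apply: filterS EV => h ->.
Unshelve. all: by end_near. Qed.

Lemma cone_initial : {ae lebesgue_rV d, forall x : V,
  phi (x, 0) * relative_energy g (r (x, 0)) (W (x, 0)) (rho0 x) (u0 x) = 0}.
Proof.
apply: ae_imp initial => x ini.
have z0 : strip T ((x, 0) : X) by rewrite /strip/= lexx.
have [->|px] := eqVneq (phi (x, 0)) 0; first by rewrite mul0r.
have xN := phi_slab z0 px.
have nb : ~ eball eta x.
  move/cutoff_neq0 : px => /andP[/= h _]; rewrite /eball/= => xe.
  have := smooth_le_enorm w0 x; rewrite mulr0 addr0 in h; lra.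
have [-> _] := same_state_energy0 g1 (r0 z0) (ini nb) (field_initial xN).
by rewrite mulr0.
Qed.

Lemma cone_transport z : open_strip t z -> phi z != 0 ->
  dt Q z + \sum_j W z 0 j * dx j Q z = - g * r z `^ (g - 1) * divx W z /\
  dt P z + \sum_j W z 0 j * dx j P z = - g * r z `^ g * divx W z.
Proof.
move=> tz pz; have Tz := open_t tz; have sz := open_strip_strip Tz.
have zN := phi_slab sz pz; have zt : z.2 <= t by case/andP: tz => _ /ltW.
apply: (comparison_transport T_ge0 g1 S vac Tz).
have [rz|rz] := eqVneq (r z) 0.
  have [_ dr _] := Cr; have Dr w' := derive_at_min w' r0 (dr _ Tz) Tz rz.
  by rewrite rz mul0r oppr0 /dt Dr add0r big1// => j _; rewrite /dx Dr mulr0.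
have nU := WU Tz zt zN rz.
rewrite (_ : divx W z = divx U z); last first.
  by apply: eq_bigr => i _; rewrite /dx (near_eq_derive _ nU).
by rewrite (nbhs_singleton nU); exact: (density_transport T_ge0 S).
Qed.

(** Three cases: before the last time step the states agree and everything
    vanishes; in the fluid the acceleration vanishes; in the vacuum it is at
    most [H]. *)
Lemma cone_integrand Phi : (forall z, strip T z -> `|z.1| <= N -> `|phi z| <= Phi) ->
  {ae lebesgue_spacetime, forall z : X, open_strip t z ->
   F z <= Phi * (rmax * (2 * v) * d%:R) * (\1_(slab T N) z * H z)}.
Proof.
move=> PhiP; apply: ae_imp3 (bounds) (early) (WH) => z bz ez hz tz.
have Tz := open_t tz; have sz := open_strip_strip Tz.
have /andP[z0 zt] := tz; have {}zt := ltW zt.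
have [rhob uv] := bz Tz; have rbz := rb sz; have rz0 := r0 sz.
have rh0 : 0 <= rho z by have /andP[h _] := rhob; exact: le_trans h.
have A0 : 0 <= relative_energy g (r z) (W z) (rho z) (u z).
  rewrite relative_energyE addr_ge0 ?potential_energy_ge0// mulr_ge0 ?mulr_ge0//.
  by apply: sumr_ge0 => i _; rewrite -expr2 sqr_ge0.
have tr := cutoff_transport T_ge0 K eta N w0 z A0 (flux rbz rhob (Wv sz) uv).
have Phi0 : `|z.1| <= N -> 0 <= Phi by move=> zN; apply: le_trans (PhiP z sz zN).
have R0 : 0 <= Phi * (rmax * (2 * v) * d%:R) * (\1_(slab T N) z * H z).
  rewrite indicE; case: (boolP (z \in slab T N)) => zS; last by rewrite mul0r mulr0.
  rewrite !mulr_ge0// Phi0//; apply: normv_le => // i.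
  by move: zS; rewrite inE => -[+ _] => /(_ i); rewrite /= in_itv/= -ler_norml.
have FK : F z <= phi z * (dissipation g r W Q rho u z - K * relative_energy g (r z) (W z) (rho z) (u z)).
  rewrite /F; apply: le_trans (lerD tr (lexx _)) _.
  by rewrite -/phi (_ : _ + _ = phi z * (dissipation g r W Q rho u z -
    K * relative_energy g (r z) (W z) (rho z) (u z)))//; ring.
apply: le_trans FK _.
have [pz|pz] := eqVneq (phi z) 0; first by rewrite pz mul0r.
have zN := phi_slab sz pz.
have [zs|sz'] := ltP z.2 s.
  have zs' : open_strip s z by rewrite /open_strip/= z0.
  have ss := ez zs' ((cutoff_neq0 _ _ _ _ _ _).1 pz).
  have [E1 E2] := same_state_energy0 g1 rz0 ss (field_near_id Tz zt zN).
  have p0 : potential_energy g (r z) (rho z) = 0.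
    by case: ss => <- _; rewrite potential_energy_diag.
  by rewrite (early_dissipation0 _ E2 p0) E1 mulr0 subr0 mulr0.
have st' : s <= z.2 <= t by rewrite sz'.
have := dissipation_bound Q g1 Lam0 rz0 rh0 uv (Wv sz) (fun k i => @WL z k i Tz st' zN).
rewrite -/K -lerBlDl => D.
apply: le_trans (ler_wpM2l (phi0 z) D) _.
have [rz|rz] := eqVneq (r z) 0; last first.
  have E i : accel W Q z i = 0.
    have nU := WU Tz zt zN rz.
    rewrite -(fluid_accel T_ge0 g1 S vac i Tz rz) /accel /dt /dx.
    rewrite (near_eq_derive _ nU) (nbhs_singleton nU); congr (_ + _ + _).
    by apply: eq_bigr => j _; rewrite (near_eq_derive _ nU).
  by rewrite big1 ?mulr0// => i _; rewrite E normr0.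
have zS : z \in slab T N.
  by apply: contrapT => /negP; rewrite notin_setE => /(notin_slab sz); rewrite ltNge zN.
have S0 : 0 <= \sum_i `|accel W Q z i| by exact: sumr_ge0.
have v20 : 0 <= 2 * v by exact: mulr_ge0.
have rv0 : 0 <= rho z * (2 * v) by exact: mulr_ge0.
rewrite indicE zS mul1r -[leRHS]mulrA; apply: ler_pM => //.
- exact: mulr_ge0.
- by apply: le_trans (ler_norm _) _; exact: PhiP.
- rewrite -[leRHS]mulrA; apply: ler_pM => //; first by apply: ler_wpM2r => //; have /andP[] := rhob.
  apply: le_trans (_ : \sum_(i < d) H z <= _); first by apply: ler_sum => i _; exact: hz.
  by rewrite sumr_const card_ord -[leLHS]mulr_natl.
Qed.

Lemma cone_defect_le : {ae lebesgue_rV d, forall x : V, 0 <= cone_defect x <= A x}.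
Proof.
apply: ae_imp2 bounds_t cone_initial => x [rhob uv] A0.
have zT : open_strip T ((x, t) : X) by exact: tT.
have zs := open_strip_strip zT; have rz0 := r0 zs.
have rh0 : 0 <= rho (x, t) by have /andP[h _] := rhob; exact: le_trans h.
have p0 := potential_energy_ge0 g1 rz0 rh0.
have k0 (Y : V) : 0 <= 2^-1 * rho (x, t) * dotv (u (x, t) - Y) (u (x, t) - Y).
  by rewrite !mulr_ge0// dotv_ge0.
apply/andP; split.
  by rewrite /cone_defect /state_defect mulr_ge0// addr_ge0// mulr_ge0.
rewrite /cone_defect /state_defect /A A0 subr0.
have [->|px] := eqVneq (phi (x, t)) 0; first by rewrite !mul0r.
rewrite ler_wpM2l// relative_energyE -dotvBB addrC lerD2r.
have [_|rz] := eqVneq (r (x, t)) 0; first by rewrite mul0r.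
by rewrite mul1r (field_near_id zT _ (phi_slab zs px) rz).
Qed.

Lemma measurable_cone_defect : measurable_fun setT cone_defect.
Proof.
apply: measurable_funM; last exact: measurable_slice measurable_state_defect tT'.
apply: measurable_slice tT'.
by apply: (cont_strip_measurable (C1_strip_continuous T_ge0 Cphi)); first exact: measurable_strip.
Qed.

Lemma C1c_mulr (f : X -> R) : C1_strip T f -> C1c_strip T (fun z => phi z * f z).
Proof.
move=> Cf; split; first exact: C1_stripM.
have [_ [k ck kP]] : C1c_strip T phi by exact: cutoff_C1c.
by exists k => // z Tz nk; rewrite kP// mul0r.
Qed.

Lemma C1c_scaler (f : X -> V) : C1_strip T f -> C1c_strip T (fun z => phi z *: f z).
Proof.
move=> Cf; split; first exact: C1_stripZv.
have [_ [k ck kP]] : C1c_strip T phi by exact: cutoff_C1c.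
by exists k => // z Tz nk; rewrite kP// scale0r.
Qed.

Lemma cone_defect_integral (Phi delta : R) : 0 <= Phi ->
  (forall z, strip T z -> `|z.1| <= N -> `|phi z| <= Phi) ->
  measurable_fun setT (H : mX -> R) ->
  (\int[lebesgue_spacetime]_(z in slab T N) (H z)%:E <= delta%:E)%E ->
  (\int[lebesgue_rV d]_x `|(cone_defect x)%:E| <= (Phi * (rmax * (2 * v) * d%:R) * delta)%:E)%E.
Proof.
move=> Phi0 PhiP mH Hd; pose c := Phi * (rmax * (2 * v) * d%:R).
have c0 : 0 <= c by rewrite !mulr_ge0.
have [CQ _] := enthalpy_C1 T_ge0 g1 S vac; have [CP _] := pressure_C1 T_ge0 g1 S.
have rho_ge0 := weak_density_ge0 AW.
have CWW : C1_strip T (fun z => 2^-1 * dotv (W z) (W z) - Q z).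
  apply: (C1_stripB T_ge0) => //; apply: (C1_stripM T_ge0); first exact: C1_strip_cst.
  by apply: (C1_strip_sum T_ge0 _ (F := fun i z => W z 0 i * W z 0 i)) => i; apply: (C1_stripM T_ge0); exact: C1_strip_coord.
have cphi : C1c_strip T phi by exact: cutoff_C1c.
have [G [iG GF iA AG]] := relative_energy_ineq T_ge0 g1 N0 tT Cphi CW CP CQ
  (fun z => @cutoff_support _ _ T K C eta w N C0 z) (fun z _ => conj erefl erefl) cone_transport rho_ge0
  (mass_t (C1c_mulr CWW)) (momentum_t (C1c_scaler CW)) (energy_t cphi (fun z _ => phi0 z)).
rewrite -/A in iA AG.
have mD : measurable (open_strip t : set mX) by exact: measurable_open_strip.
have mS : measurable (slab T N : set mX) by exact: measurable_slab.
have leA : (\int[lebesgue_rV d]_x `|(cone_defect x)%:E| <= \int[lebesgue_rV d]_x `|(A x)%:E|)%E.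
  apply: ae_ge0_le_integral => //.
  - by apply: measurableT_comp => //; apply/measurable_EFinP; exact: measurable_cone_defect.
  - by apply: measurableT_comp => //; have /integrableP[] := iA.
  apply: ae_imp cone_defect_le => x /andP[h1 h2] _.
  by rewrite lee_fin !ger0_norm//; exact: le_trans h2.
apply: le_trans leA _.
have -> : (\int[lebesgue_rV d]_x `|(A x)%:E| = (\int[lebesgue_rV d]_x A x)%:E)%E.
  rewrite /Rintegral fineK; last exact: integrable_fin_num.
  apply: ae_eq_integral => //.
  - by apply: measurableT_comp => //; have /integrableP[] := iA.
  - by have /integrableP[] := iA.
  apply: ae_imp cone_defect_le => x /andP[h1 h2] _ /=.
  by rewrite ger0_norm//; exact: le_trans h2.
apply: le_trans (_ : (\int[lebesgue_spacetime]_(z in open_strip t) G z)%:E <= _)%E; first by rewrite lee_fin.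
rewrite /Rintegral fineK; last exact: integrable_fin_num.
rewrite integralE; apply: le_trans (geeDl _ _) _.
  by rewrite oppe_le0; apply: integral_ge0.
have mG : measurable_fun (open_strip t) (EFin \o (G : mX -> R)) by have /integrableP[] := iG.
apply: le_trans (_ : (\int[lebesgue_spacetime]_(z in open_strip t) (c * (\1_(slab T N) z * H z))%:E <= _)%E).
  apply: ae_ge0_le_integral => //.
  - exact: measurable_funepos.
  - by move=> z _; rewrite lee_fin !mulr_ge0.
  - apply/measurable_EFinP; apply: measurable_funTS; apply: measurable_funM; first exact: measurable_cst.
    by apply: measurable_funM => //; exact: measurable_indic.
  apply: ae_imp2 GF (cone_integrand PhiP) => z Gz Fz tz.
  rewrite funeposE/= Gz// ge_max; apply/andP; split; first by rewrite lee_fin; exact: Fz.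
  by rewrite lee_fin !mulr_ge0.
under eq_integral do rewrite EFinM.
rewrite ge0_integralZl_EFin//; last 2 first.
- by move=> z _; rewrite lee_fin mulr_ge0.
- apply/measurable_EFinP; apply: measurable_funTS.
  by apply: measurable_funM => //; exact: measurable_indic.
rewrite [leRHS]EFinM -/c; apply: lee_wpmul2l => //; apply: le_trans Hd.
apply: le_trans (_ : (\int[lebesgue_spacetime]_z (\1_(slab T N) z * H z)%:E <= _)%E).
  apply: ge0_subset_integral => //.
    apply/measurable_EFinP.
    by apply: measurable_funM => //; exact: measurable_indic.
  by move=> z _; rewrite lee_fin mulr_ge0.
rewrite [leRHS]integral_mkcond le_eqVlt; apply/orP; left; apply/eqP.
apply: eq_integral => z _; rewrite patchE indicE.
by case: ifPn => _; rewrite ?mul1r ?mul0r.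
Qed.

End comparison_field.

(** The integral of [cone_defect] is independent of the comparison field and is
    bounded by an arbitrarily small number. *)
Lemma cone_slice : {ae lebesgue_rV d, forall x : V, in_cone (x, t) ->
  same_state (rho (x, t)) (u (x, t)) (r (x, t)) (U (x, t))}.
Proof.
have [Phi Phi0 PhiP] := cont_strip_bounded T_ge0 N (C1_strip_continuous T_ge0 Cphi).
pose c := Phi * (rmax * (2 * v) * d%:R).
have c0 : 0 <= c by rewrite !mulr_ge0.
have rm z : strip T z -> r z <= rmax by move=> /rb/andP[].
(* The constant c does not depend on the comparison field, as the cutoff does not. *)
have I0 : (\int[lebesgue_rV d]_x `|(cone_defect x)%:E| = 0)%E.
  apply/eqP; rewrite eq_le integral_ge0// andbT; apply/lee_addgt0Pr => e e0.
  have d0 : 0 < e / (c + 1) by rewrite divr_gt0// ltr_wpDl.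
  have [W [H [[CW Wv WU WL] [mH H0 Hd WH]]]] :=
    comparison_fields T_gt0 g1 S vac v0 Uv rm N0 L0 tT UL st d0.
  apply: le_trans (cone_defect_integral CW Wv WU WL H0 WH Phi0 PhiP mH Hd) _.
  rewrite add0e lee_fin -/c mulrA ler_pdivrMr ?ltr_wpDl// mulrC ler_wpM2l ?(ltW e0)//.
  by rewrite lerDl.
have mcd : measurable_fun setT (EFin \o cone_defect).
  by apply/measurable_EFinP; exact: measurable_cone_defect.
have cd0 := (ae_eq_integral_abs (lebesgue_rV d) measurableT mcd).1 I0.
apply: ae_imp2 cd0 bounds_t => x /(_ I)[] E [rhob _] cx.
have zs : strip T ((x, t) : X) by exact: tT'.
have rh0 : 0 <= rho (x, t) by have /andP[h _] := rhob; exact: le_trans h.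
apply/(state_defect0 zs rh0)/eqP; move/eqP: E; rewrite mulf_eq0 => /orP[|//] /eqP p0.
by have := (cutoff_neq0 K C eta w N (x, t)).2 cx; rewrite -/phi p0 eqxx.
Qed.

End slice.

(** Passing from slices to space-time requires a measurable exceptional set,
    provided by [state_defect]. *)
Lemma cone_step s t : 0 < t <= T -> (t - s) * L * d%:R <= 2^-1 ->
  {ae lebesgue_spacetime, forall z : X, open_strip s z -> in_cone z ->
    same_state (rho z) (u z) (r z) (U z)} ->
  {ae lebesgue_spacetime, forall z : X, open_strip t z -> in_cone z ->
    same_state (rho z) (u z) (r z) (U z)}.
Proof.
move=> /andP[t0 tT] st early.
pose B : set mX := (open_strip t `&` (in_cone : set X)) `&` (strip T `&` state_defect @^-1` (~` [set 0])).
have mB : measurable B.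
  apply: measurableI; last first.
    apply: measurable_state_defect; first exact: measurable_strip.
    by apply: measurableC; exact: measurable_set1.
  apply: measurableI; first exact: measurable_open_strip.
  have csn : continuous (fun z : X => smooth_norm w z.1).
    move=> z; apply: differentiable_continuous.
    by have [_ /(_ z 0)[]] := smooth_norm_C1 (d := d) T_ge0 w0.
  have lin (a b : R) : continuous (fun z : X => a + b * z.2).
    move=> z; apply: cvgD; first exact: cvg_cst.
    by apply: cvgM; [exact: cvg_cst|exact: cvg_snd].
  have op (f h : X -> R) : continuous f -> continuous h -> measurable ([set z | f z < h z] : set mX).
    move=> cf ch; apply: open_measurable_st.
    rewrite (_ : [set z | _] = (fun z => h z - f z) @^-1` [set x | 0 < x]); last first.
      by apply/seteqP; split => z /=; rewrite subr_gt0.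
    by apply: open_comp => [z _|]; [apply: cvgB; [exact: ch|exact: cf]|exact: open_gt].
  have -> : (in_cone : set X) = [set z : X | eta + w + C * z.2 < smooth_norm w z.1] `&`
      [set z : X | smooth_norm w z.1 < N + (- C) * z.2].
    by apply/seteqP; split => z /=; rewrite /in_cone mulNr; [move/andP|move=> [-> ->]].
  by apply: measurableI; apply: op.
have tT' (z : X) : open_strip t z -> open_strip T z.
  by move=> /andP[z0 zt]; apply/andP; split => //; exact: lt_le_trans zt tT.
have B0 : lebesgue_spacetime B = 0%E.
  apply: ae_unslice => //.
  have weak : {ae @lebesgue_measure R, forall q : R, 0 < q < T ->
    [/\ forall psi : X -> R, C1c_strip T psi -> weak_mass q psi rho u rho0,
     forall zeta : X -> V, C1c_strip T zeta -> weak_momentum g q zeta rho u rho0 u0 &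
     forall chi : X -> R, C1c_strip T chi ->
       (forall z, strip T z -> 0 <= chi z) -> local_energy_ineq g q chi rho u rho0 u0]}.
    apply: ae_imp2 (weak_equations AW) (weak_energy AW) => q e1 e2 qT.
    by have [? ?] := e1 qT; split => //; exact: e2.
  apply: ae_imp3 weak (ae_slices bounds) (ae_slices early) => q wq bq eq.
  have mBq : measurable (ysection B q) by exact: measurable_ysection.
  apply: (measure_negligible mBq).
  have [qt|nqt] := boolP (0 < q < t); last first.
    apply: (@negligibleS _ _ _ _ set0) => [x|]; last exact: negligible_set0.
    by rewrite /ysection/= inE => -[[] +]; rewrite /open_strip/= (negbTE nqt).
  have /andP[q0 qt'] := qt.
  have qT : 0 < q < T by rewrite q0 (lt_le_trans qt').
  have [w1 w2 w3] := wq qT.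
  have bq' : {ae lebesgue_rV d, forall x : V, rmin <= rho (x, q) <= rmax /\ enorm (u (x, q)) <= v}.
    by apply: ae_imp bq => x; apply.
  have ss : {ae lebesgue_rV d, forall x : V, in_cone (x, q) ->
      same_state (rho (x, q)) (u (x, q)) (r (x, q)) (U (x, q))}.
    have [qs|sq] := ltP q s.
      by apply: ae_imp eq => x; apply; rewrite /open_strip/= q0.
    apply: (cone_slice qT _ early w1 w2 w3 bq').
    apply: le_trans st; apply: ler_wpM2r => //; apply: ler_wpM2r => //.
    by rewrite lerD2r ltW.
  have : {ae lebesgue_rV d, forall x : V, ~ ysection B q x}.
    apply: ae_imp2 ss bq' => x ss [rhob _]; rewrite /ysection/= inE => -[[_ /ss cx] [zs]] /=; apply.
    apply/(state_defect0 zs) => //; have /andP[h _] := rhob; exact: le_trans h.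
  by apply: negligibleS => x /= Bx; apply; exact: Bx.
have nB : {ae lebesgue_spacetime, forall z : X, ~ B z}.
  by exists B; split => // z /= nnB; apply: contrapT => /nnB.
apply: ae_imp2 nB bounds => z nB bz tz cz.
have zs := open_strip_strip (tT' z tz); have [rhob _] := bz (tT' z tz).
apply/(state_defect0 zs); first by have /andP[h _] := rhob; exact: le_trans h.
by apply: contrapT => D0; apply: nB; split.
Qed.

End cone_slice.

(** * Strictly positive speed, everywhere bounds, cone boundaries *)

Section speed.
Context {R : realType} {d : nat}.
Local Notation V := ('rV[R]_d).

Lemma relative_flux_rigid (g r rho : R) (U : V) : 1 < g -> 0 < rho ->
  relative_flux g r U rho U = potential_energy g r rho *: U.
Proof.
move=> g1 rho0; rewrite /relative_flux subrr.
have -> : enorm (0 : V) = 0 by rewrite /enorm dotv0l sqrtr0.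
have E : rho `^ g = rho * rho `^ (g - 1).
  by rewrite mulr_powRB1 ?ltW// (lt_trans ltr01).
have gn0 : g - 1 != 0 by rewrite subr_eq0 gt_eqF.
apply/rowP => i; rewrite !mxE expr0n/= mulr0 mul0r sub0r /potential_energy E.
by field.
Qed.

(** Two fluids that move with the same velocity of length [v] but have different
    densities transport their relative energy at speed [v]. In particular [C] is
    positive. *)
Lemma speed_le (g rmin rmax v C : R) : (0 < d)%N -> 1 < g -> 0 <= rmin -> rmin < rmax -> 0 < v ->
  (forall (r' rho' : R) (U' u' : V),
    rmin <= r' <= rmax -> rmin <= rho' <= rmax -> enorm U' <= v -> enorm u' <= v ->
    enorm (relative_flux g r' U' rho' u') <= C * relative_energy g r' U' rho' u') ->
  v <= C.
Proof.
move=> d0 g1 r0 rr v0 H; pose i0 := Ordinal d0.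
pose U : V := v *: delta_mx 0 i0.
have Ue : enorm U = v.
  rewrite enormZ ger0_norm ?ltW// (_ : enorm _ = 1) ?mulr1// /enorm /dotv.
  rewrite (bigD1 i0)//= big1 ?addr0 ?mxE ?eqxx ?mulr1 ?sqrtr1// => i ii.
  by rewrite mxE eqxx (negbTE ii) mulr0.
have rmax0 : 0 < rmax by exact: le_lt_trans rr.
have := H rmin rmax U U; rewrite relative_flux_rigid// enormZ Ue.
have p0 := @potential_energy_gt0 _ g rmin rmax g1 r0 (ltW rmax0) (negbT (lt_eqF rr)).
rewrite gtr0_norm// relative_energyE big1; last by move=> i _; rewrite subrr mulr0.
rewrite mulr0 add0r !lexx (ltW rr) => /(_ isT isT isT isT).
by rewrite mulrC ler_pM2r.
Qed.

End speed.

Section density.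
Context {R : realType} {d : nat} (T : R) (T_gt0 : 0 < T).
Local Notation V := ('rV[R]_d).
Local Notation X := (V * R)%type.
Local Notation mX := (V * measurableTypeR R)%type.

Let T_ge0 : 0 <= T. Proof. exact: ltW. Qed.

(** Almost everywhere bounds of continuous functions hold everywhere on the
    closed strip. *)
Lemma ae_strip_le (f : X -> R) (c : R) : continuous (f \o clampt T) ->
  {ae lebesgue_spacetime, forall z : X, open_strip T z -> f z <= c} ->
  forall z, strip T z -> f z <= c.
Proof.
move=> cf H z Tz; rewrite leNgt; apply/negP => fz.
pose O : set X := ((f \o clampt T) @^-1` [set y | c < y]) `&` open_strip T.
have oO : open O.
  apply: openI; last exact: open_open_strip.
  by apply: open_comp => [y _|]; [exact: cf|exact: open_gt].
have O0 : O !=set0.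
  (* The segment from z to mid-time lies in the open strip, except possibly for its starting point z. *)
  pose w : X := (0, T / 2 - z.2).
  have lim := cvg_comp (fun h : R => h *: w + z) (f \o clampt T) (@cvg_line R d z w) (cf z).
  have n1 : \forall h \near (0:R)^'+, c < (f \o clampt T) (h *: w + z).
    by apply: cvgr_gt lim _ _; rewrite /= clampt_id.
  have n2 : \forall h \near (0:R)^'+, 0 < h < 1.
    near=> h; apply/andP; split; near: h; first exact: nbhs_right_gt.
    exact: nbhs_right_lt.
  have [h [h1 h2]] : exists h, c < (f \o clampt T) (h *: w + z) /\ 0 < h < 1.
    have := @filter_ex _ _ (at_right_proper_filter (0:R)) _ (filterI n1 n2).
    by move=> [h [? ?]]; exists h.
  exists (h *: w + z); split => //; rewrite /open_strip/= -[_ *: _]/(h * (T / 2 - z.2)).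
  have /andP[h0 h11] := h2; have /andP[z0 zT] := Tz.
  have m1 : 0 <= (1 - h) * z.2 by rewrite mulr_ge0// subr_ge0 ltW.
  have m2 : 0 <= (1 - h) * (T - z.2) by rewrite mulr_ge0// subr_ge0// ltW.
  have m3 : 0 < h * T by rewrite mulr_gt0.
  by apply/andP; split; lra.
have [y [/= y1 y2] /(_ y2)] := ae_open oO O0 (P := fun y => open_strip T y -> f y <= c) (ae_imp (fun y h _ => h) H).
by rewrite leNgt -(clampt_id (open_strip_strip y2)) y1.
Unshelve. all: by end_near. Qed.

(** The cones leave out the sphere of radius [eta + C * t]. It is negligible
    because, as [C] is positive, each point of space lies on it at one time at
    most. *)
Lemma sphere_null (eta C : R) : 0 < C ->
  {ae lebesgue_spacetime, forall z : X, enorm z.1 != eta + C * z.2}.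
Proof.
move=> C0; pose B : set mX := [set z | enorm z.1 = eta + C * z.2].
have mB : measurable B.
  apply: closed_measurable_st.
  rewrite (_ : B = (fun z : X => enorm z.1 - (eta + C * z.2)) @^-1` [set 0]); last first.
    by apply/seteqP; split => z /=; rewrite /B/= => /eqP; [rewrite -subr_eq0 => /eqP|rewrite subr_eq0 => /eqP].
  have csn : continuous (fun z : X => smooth_norm 1 z.1).
    move=> z; apply: differentiable_continuous.
    by have [_ /(_ z 0)[]] := smooth_norm_C1 (d := d) T_ge0 ltr01.
  have ce : continuous (fun z : X => enorm z.1).
    rewrite (_ : (fun z : X => enorm z.1) = (fun z => Num.sqrt (smooth_norm 1 z.1 * smooth_norm 1 z.1 - 1))).
      move=> z; apply: (@continuous_comp _ _ _ (fun z : X => smooth_norm 1 z.1 * smooth_norm 1 z.1 - 1) Num.sqrt).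
        by apply: cvgB; [apply: cvgM; exact: csn|exact: cvg_cst].
      exact: sqrt_continuous.
    apply/funext => z; rewrite -expr2 /smooth_norm sqr_sqrtr ?expr1n ?addrK//.
    by rewrite addr_ge0// dotv_ge0.
  apply: closed_comp; last exact: closed_eq.
  move=> z _; apply: cvgB; first exact: ce.
  apply: cvgD; first exact: cvg_cst.
  by apply: cvgM; [exact: cvg_cst|exact: cvg_snd].
exists B; split => //.
- rewrite /lebesgue_spacetime/= /product_measure1 integral0_eq// => x _.
  rewrite (_ : _ \o _ = fun x => lebesgue_measure (xsection B x))//.
  have -> : xsection B x = [set (enorm x - eta) / C].
    apply/seteqP; split => q; rewrite /xsection/= inE /B/=.
      by move=> ->; rewrite addrAC subrr add0r mulrC mulKf// gt_eqF.
    by move=> ->; rewrite mulrC divfK ?gt_eqF// addrC subrK.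
  exact: lebesgue_measure_set1.
- by move=> z /= /negP; rewrite negbK => /eqP.
Qed.

End density.

(** * Uniqueness in all cones *)

Section full_cone.
Context {R : realType} {d : nat} (T : R) (T_gt0 : 0 < T).
Local Notation V := ('rV[R]_d).
Local Notation X := (V * R)%type.
Variables (g v rmin rmax C eta : R) (rho0 : V -> R) (u0 : V -> V).
Variables (rho : X -> R) (u : X -> V) (r : X -> R) (U : X -> V).
Hypotheses (g1 : 1 < g) (AW : admissible_weak_solution g T rho0 u0 rho u).
Hypotheses (S : C1_solution g T r U) (C0 : 0 < C) (v0 : 0 <= v) (rmin0 : 0 <= rmin).
Hypothesis vac : 2 <= g \/ forall z, strip T z -> 0 < r z.
Hypothesis Uv : forall z, strip T z -> enorm (U z) <= v.
Hypothesis rb : forall z, strip T z -> rmin <= r z <= rmax.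
Hypothesis initial : {ae lebesgue_rV d, forall x, ~ eball eta x ->
  same_state (rho0 x) (u0 x) (r (x, 0)) (U (x, 0))}.
Hypothesis bounds : {ae lebesgue_spacetime, forall z : X, open_strip T z ->
  rmin <= rho z <= rmax /\ enorm (u z) <= v}.
Hypothesis flux : forall (r' rho' : R) (U' u' : V),
  rmin <= r' <= rmax -> rmin <= rho' <= rmax -> enorm U' <= v -> enorm u' <= v ->
  enorm (relative_flux g r' U' rho' u') <= C * relative_energy g r' U' rho' u'.

(** The step length [h] depends on the cone only, so finitely many steps reach
    the final time. *)
Lemma same_state_cone (w N : R) : 0 < w -> 0 <= N ->
  {ae lebesgue_spacetime, forall z : X, open_strip T z -> in_cone C eta w N z ->
    same_state (rho z) (u z) (r z) (U z)}.
Proof.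
move=> w0 N0.
have [L L0 UL] := jacobian_bound T_gt0 S (N + v * T).
(* The largest time step allowed by cone_step, up to the 1 that avoids a division by 0. *)
pose h := (2 * (L * d%:R + 1))^-1.
have Ld0 : 0 <= L * d%:R by exact: mulr_ge0.
have h0 : 0 < h by rewrite invr_gt0 mulr_gt0// ltr_wpDl.
have hL : h * L * d%:R <= 2^-1.
  rewrite -mulrA mulrC /h invfM mulrCA -[leRHS]mulr1 ler_wpM2l//.
  by rewrite ler_pdivrMr ?ltr_wpDl// mul1r lerDl.
have P k : {ae lebesgue_spacetime, forall z : X, open_strip (Num.min T (k%:R * h)) z ->
    in_cone C eta w N z -> same_state (rho z) (u z) (r z) (U z)}.
  elim: k => [|k IH].
    apply: aeW => z; rewrite mul0r min_r ?(ltW T_gt0)// => /andP[z0 z1].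
    by have := lt_trans z0 z1; rewrite ltxx.
  apply: (cone_step T_gt0 g1 AW S (ltW C0) v0 rmin0 vac Uv rb initial bounds flux w0 N0 L0 UL _ _ IH).
    by rewrite lt_min T_gt0 mulr_gt0 ?ltr0n//= ge_min lexx.
  apply: le_trans hL; apply: ler_wpM2r => //; apply: ler_wpM2r => //.
  rewrite lerBlDl minEle [X in _ <= X + _]minEle -natr1 mulrDl mul1r.
  by case: ifP; case: ifP; lra.
have [k kP] : exists k : nat, T <= k%:R * h.
  exists (Num.truncn (T / h)).+1; rewrite -ler_pdivrMr//.
  by apply: ltW; exact: truncnS_gt.
by have := P k; rewrite min_l.
Qed.

(** Countably many cones, with smoothing parameter 1 / (m + 1) and outer radius
    m, exhaust the exterior of the closed ball. *)
Lemma same_state_outside : {ae @lebesgue_measure R, forall t : R, 0 < t < T ->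
  {ae lebesgue_rV d, forall x, ~ eball (eta + C * t) x ->
    same_state (rho (x, t)) (u (x, t)) (r (x, t)) (U (x, t))}}.
Proof.
have cones : {ae lebesgue_spacetime, forall z : X, forall m : nat, open_strip T z ->
    in_cone C eta m.+1%:R^-1 m%:R z -> same_state (rho z) (u z) (r z) (U z)}.
  by apply: ae_foralln => m; apply: same_state_cone => //; rewrite invr_gt0 ltr0n.
have sph : {ae lebesgue_spacetime, forall z : X, enorm z.1 != eta + C * z.2}.
  exact: (sphere_null T_gt0).
apply: ae_imp2 (ae_slices cones) (ae_slices sph) => t ct st tT.
apply: ae_imp2 ct st => x cx sx /negP; rewrite /eball/= -leNgt => xe.
have {}xe : 0 < enorm x - (eta + C * t).
  by rewrite subr_gt0 lt_neqAle eq_sym sx.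
pose a := Num.max ((enorm x - (eta + C * t))^-1) (enorm x + 1 + C * t).
pose m := (Num.truncn a).+1.
have am : a < m%:R by exact: truncnS_gt.
clearbody m.
have := am; rewrite gt_max => /andP[am1 am2].
have m1 : m.+1%:R^-1 < enorm x - (eta + C * t).
  rewrite -[ltRHS]invrK ltf_pV2 ?posrE ?invr_gt0 ?ltr0n//.
  by apply: lt_trans am1 _; rewrite ltr_nat.
have w0 : 0 < m.+1%:R^-1 :> R by rewrite invr_gt0 ltr0n.
have w1 : m.+1%:R^-1 <= 1 :> R by rewrite invf_le1 ?ltr0n// ler1n.
apply: (cx m tT).
have s1 := enorm_le_smooth m.+1%:R^-1 x; have s2 := smooth_le_enorm w0 x.
move: m1 w0 w1 s1 s2; rewrite /in_cone/=; set W := m.+1%:R^-1 => m1 w0 w1 s1 s2.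
by apply/andP; split; lra.
Qed.

End full_cone.

Theorem corollary4p5 (R : realType) (d : nat) (gamma T : R)
    (rho0 : 'rV[R]_d -> R) (u0 : 'rV[R]_d -> 'rV[R]_d)
    (rho : 'rV[R]_d * R -> R) (u : 'rV[R]_d * R -> 'rV[R]_d)
    (r : 'rV[R]_d * R -> R) (U : 'rV[R]_d * R -> 'rV[R]_d)
    (eta rmin rmax v C : R) :
  (0 < d)%N -> 1 < gamma -> 0 < T ->
  admissible_weak_solution gamma T rho0 u0 rho u ->
  C1_solution gamma T r U ->
  0 < eta ->
  {ae lebesgue_rV d, forall x, ~ eball eta x ->
    same_state (rho0 x) (u0 x) (r (x, 0)) (U (x, 0))} ->
  0 <= rmin -> rmin < rmax -> (gamma < 2 -> 0 < rmin) -> 0 < v ->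
  {ae lebesgue_spacetime, forall z : 'rV[R]_d * R, open_strip T z ->
    [/\ rmin <= rho z <= rmax, rmin <= r z <= rmax,
        enorm (u z) <= v & enorm (U z) <= v]} ->
  (forall (r' rho' : R) (U' u' : 'rV[R]_d),
    rmin <= r' <= rmax -> rmin <= rho' <= rmax ->
    enorm U' <= v -> enorm u' <= v ->
    enorm (relative_flux gamma r' U' rho' u') <=
      C * relative_energy gamma r' U' rho' u') ->
  {ae @lebesgue_measure R, forall t : R, 0 < t < T ->
    {ae lebesgue_rV d, forall x, ~ eball (eta + C * t) x ->
      same_state (rho (x, t)) (u (x, t)) (r (x, t)) (U (x, t))}}.
Proof.
move=> d0 g1 T0 AW S eta0 initial rmin0 rr g2 v0 bounds flux.
have T_ge0 := ltW T0.
have C0 : 0 < C by apply: (lt_le_trans v0); exact: speed_le d0 g1 rmin0 rr v0 flux.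
have [Cr CU _ _ _] := S.
have r_le z : strip T z -> r z <= rmax.
  apply: (ae_strip_le T0 (C1_strip_continuous T_ge0 Cr)).
  by apply: ae_imp bounds => y h /h[_ /andP[]].
have r_ge z : strip T z -> rmin <= r z.
  move=> Tz; rewrite -lerN2.
  apply: (ae_strip_le T0 (f := fun z => - r z)) Tz.
    exact: (C1_strip_continuous T_ge0 (C1_stripN T_ge0 Cr)).
  by apply: ae_imp bounds => y h /h[_ /andP[? _] _ _]; rewrite lerN2.
have Uv z : strip T z -> enorm (U z) <= v.
  have nv : v \is Num.nneg by rewrite nnegrE ltW.
  have sqE (y : 'rV[R]_d) : (enorm y <= v) = (dotv y y <= v ^+ 2).
    by rewrite -sqr_enorm ler_pXn2r// nnegrE enorm_ge0.
  rewrite sqE; apply: (ae_strip_le T0 (f := fun z => dotv (U z) (U z))).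
    apply: (C1_strip_continuous T_ge0).
    apply: (C1_strip_sum T_ge0 _ (F := fun i z => U z 0 i * U z 0 i)) => i.
    by apply: (C1_stripM T_ge0); exact: C1_strip_coord.
  by apply: ae_imp bounds => y h /h[_ _ _]; rewrite sqE.
have rb z : strip T z -> rmin <= r z <= rmax by move=> Tz; rewrite r_ge// r_le.
have vac : 2 <= gamma \/ forall z, strip T z -> 0 < r z.
  have [|/g2 h] := leP 2 gamma; first by left.
  by right=> z Tz; exact: lt_le_trans h (r_ge z Tz).
have bounds' : {ae lebesgue_spacetime, forall z : 'rV[R]_d * R, open_strip T z ->
    rmin <= rho z <= rmax /\ enorm (u z) <= v}.
  by apply: ae_imp bounds => z h /h[].
exact: (same_state_outside T0 g1 AW S C0 (ltW v0) rmin0 vac Uv rb initial bounds' flux).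
Qed.
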